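(* Let $\theta_{n+1}=\theta_n-\alpha_nF(\theta_n,\xi_{n+1})$, $n\ge 0$, be the stochastic gradient algorithm with Markovian dynamics described in the context. Suppose that: (i) $\lim_{n\to\infty}\alpha_n=0$, $\limsup_{n\to\infty}|\alpha_{n+1}^{-1}-\alpha_n^{-1}|<\infty$, $\sum_{n=0}^\infty\alpha_n=\infty$, and there exists a real number $r\in(0,\infty)$ such that $\sum_{n=0}^\infty\alpha_n^2\gamma_n^{2r}<\infty$; (ii) there exist a differentiable function $f:\mathbb{R}^{d_\theta}\to\mathbb{R}$ and a Borel-measurable function $\tilde F:\mathbb{R}^{d_\theta}\times\mathbb{R}^{d_\xi}\to\mathbb{R}^{d_\theta}$ such that $\nabla f$ is locally Lipschitz continuous and $F(\theta,\xi)-\nabla f(\theta)=\tilde F(\theta,\xi)-(\Pi\tilde F)(\theta,\xi)$ for each $\theta\in\mathbb{R}^{d_\theta}$, $\xi\in\mathbb{R}^{d_\xi}$, where $(\Pi\tilde F)(\theta,\xi)=\int\tilde F(\theta,\xi')\Pi_\theta(\xi,d\xi')$; (iii) for any compact set $Q\subset\mathbb{R}^{d_\theta}$ and $s\in(0,1)$, there exists a Borel-measurable function $\varphi_{Q,s}:\mathbb{R}^{d_\xi}\to[1,\infty)$ such that $\max\{\|F(\theta,\xi)\|,\|\tilde F(\theta,\xi)\|,\|(\Pi\tilde F)(\theta,\xi)\|\}\le\varphi_{Q,s}(\xi)$ and $\|(\Pi\tilde F)(\theta',\xi)-(\Pi\tilde F)(\theta'',\xi)\|\le\varphi_{Q,s}(\xi)\|\theta'-\theta''\|^s$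 for all $\theta,\theta',\theta''\in Q$, $\xi\in\mathbb{R}^{d_\xi}$; (iv) given a compact set $Q\subset\mathbb{R}^{d_\theta}$ and $s\in(0,1)$, $\sup_{n\ge0}E\left(\varphi_{Q,s}^2(\xi_n)I_{\{\tau_Q\ge n\}}\mid\theta_0=\theta,\xi_0=\xi\right)<\infty$ for all $\theta\in\mathbb{R}^{d_\theta}$, $\xi\in\mathbb{R}^{d_\xi}$, where $\tau_Q=\inf\{n\ge0:\theta_n\notin Q\}$; (v) for any compact set $Q\subset\mathbb{R}^{d_\theta}$ and any $a\in f(Q)$, there exist $\delta_{Q,a}\in(0,1)$, $\mu_{Q,a}\in(1,2]$, $M_{Q,a}\in[1,\infty)$ such that $|f(\theta)-a|\le M_{Q,a}\|\nabla f(\theta)\|^{\mu_{Q,a}}$ for all $\theta\in Q$ satisfying $|f(\theta)-a|\le\delta_{Q,a}$; (vi) for any compact set $Q\subset\mathbb{R}^{d_\theta}$ there exist $\nu_Q\in(0,1]$, $N_Q\in[1,\infty)$ such that $d(\theta,S)\le N_Q\|\nabla f(\theta)\|^{\nu_Q}$ for all $\theta\in Q$. Let $p=\min\{1,r\}$ and $\Lambda=\{\sup_{n\ge0}\|\theta_n\|<\infty\}$. Then $$\|\nabla f(\theta_n)\|^2=o(\gamma_n^{-p}),\qquad d(f(\theta_n),C)=o(\gamma_n^{-p})$$ w.p.1 on $\Lambda$. Moreover, $$\|\nabla f(\theta_n)\|^2=o(\gamma_n^{-\hat p}),\quad d(f(\theta_n),C)=o(\gamma_n^{-\hat p}),\quad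 d(\theta_n,S)=o(\gamma_n^{-\hat q})$$ w.p.1 on $\Lambda\cap\{\hat r>r\}$, and $$\|\nabla f(\theta_n)\|^2=O(\gamma_n^{-\hat p}),\quad d(f(\theta_n),C)=O(\gamma_n^{-\hat p}),\quad d(\theta_n,S)=O(\gamma_n^{-\hat q})$$ w.p.1 on $\Lambda\cap\{\hat r\le r\}$.
   Context: $F:\mathbb{R}^{d_\theta}\times\mathbb{R}^{d_\xi}\to\mathbb{R}^{d_\theta}$ is Borel-measurable and $\{\alpha_n\}_{n\ge0}$ is a sequence of positive real numbers. On a probability space $(\Omega,\mathcal{F},P)$, $\theta_0$ is an $\mathbb{R}^{d_\theta}$-valued random variable and $\{\xi_n\}_{n\ge0}$ is an $\mathbb{R}^{d_\xi}$-valued stochastic process which is a Markov process controlled by $\{\theta_n\}_{n\ge0}$: there is a family of transition probability kernels $\{\Pi_\theta(\cdot,\cdot)\}_{\theta\in\mathbb{R}^{d_\theta}}$ on $\mathbb{R}^{d_\xi}$ such that $P(\xi_{n+1}\in B\mid\theta_0,\xi_0,\dots,\theta_n,\xi_n)=\Pi_{\theta_n}(\xi_n,B)$ w.p.1 for any Borel set $B\subseteq\mathbb{R}^{d_\xi}$ and $n\ge0$. $\|\cdot\|$ is the Euclidean norm and $d(\cdot,\cdot)$ the induced distance. $\gamma_0=0$, $\gamma_n=\sum_{i=0}^{n-1}\alpha_i$ for $n\ge1$. $S=\{\theta\in\mathbb{R}^{d_\theta}:\nabla f(\theta)=0\}$, $C=\{f(\theta):\theta\in S\}$. ''W.p.1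 on an event $A$'' means for all $\omega\in A$ outside a set of probability zero; $o,O$ are as $n\to\infty$ for each fixed $\omega$. $\hat A$ is the (random) set of accumulation points of $\{\theta_n\}_{n\ge0}$, $\hat f=\liminf_{n\to\infty}f(\theta_n)$, and $\hat Q=\{\theta:d(\theta,\hat A)\le\rho\}$ on $\Lambda$, $\hat Q=\hat A$ otherwise, where $\rho$ is an arbitrary positive (deterministic or random) quantity. With a fixed choice of the constants in (v) and (vi), on $\Lambda$ set $\hat\mu=\mu_{\hat Q,\hat f}$, $\hat\nu=\mu_{\hat Q,\hat f}\,\nu_{\hat Q}/2$, and off $\Lambda$ set $\hat\mu=2$, $\hat\nu=1$. Further, $\hat r=1/(2-\hat\mu)$ if $\hat\mu<2$ and $\hat r=\infty$ if $\hat\mu=2$; $\hat p=\hat\mu\min\{r,\hat r\}$; $\hat q=\hat\nu\min\{r,\hat r\}$. *)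

(* Defs.v *)
From HB Require Import structures.
From mathcomp Require Export all_boot all_order all_algebra.
From mathcomp Require Export all_classical all_reals all_analysis.
From mathcomp Require Export measurable_realfun.
Export Order.TTheory GRing.Theory Num.Theory.
Export numFieldNormedType.Exports.

Set Implicit Arguments.
Unset Strict Implicit.
Unset Printing Implicit Defensive.

Local Open Scope classical_set_scope.
Local Open Scope ring_scope.

(* R^d is 'rV[R]_d, and it carries its Borel sigma-algebra. *)
HB.instance Definition _ (R : realType) (m n : nat) :=
  Measurable.copy 'M[R]_(m, n) (g_sigma_algebraType (@open 'M[R]_(m, n))).

(* The library norm on 'rV[R]_d is the sup norm: same topology, hence same
   compact sets, cluster points and differentials, but a different value. *)
Definition enorm (R : realType) (d : nat) (x : 'rV[R]_d) : R :=
  Num.sqrt (\sum_(i < d) x ord0 i ^+ 2).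

(* Extended real valued so that the distance to the empty set is +oo; in
   particular a finite upper bound on the distance makes the set nonempty. *)
Definition edist_set (R : realType) (d : nat) (x : 'rV[R]_d)
    (A : set 'rV[R]_d) : \bar R :=
  ereal_inf [set (enorm (x - y))%:E | y in A].

Definition rdist_set (R : realType) (x : R) (A : set R) : \bar R :=
  ereal_inf [set `|x - y|%:E | y in A].

Definition grad (R : realType) (d : nat) (f : 'rV[R]_d -> R)
    (x : 'rV[R]_d) : 'rV[R]_d :=
  \row_(i < d) 'D_(delta_mx ord0 i) f x.

Definition crit_points (R : realType) (d : nat) (f : 'rV[R]_d -> R) :
  set 'rV[R]_d := [set x | grad f x = 0].

Definition crit_values (R : realType) (d : nat) (f : 'rV[R]_d -> R) :
  set R := f @` crit_points f.

Definition locally_lipschitz (R : realType) (m n : nat)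
    (g : 'rV[R]_m -> 'rV[R]_n) : Prop :=
  forall x : 'rV[R]_m, exists2 U, nbhs x U &
    exists L : R, forall y z, U y -> U z ->
      enorm (g y - g z) <= L * enorm (y - z).

Section conditional_expectation.
Context {d : measure_display} {T : measurableType d} {R : realType}.
Variable P : probability T R.
Local Open Scope ereal_scope.

(* Y is a version of E(X | G), for X >= 0. *)
Definition is_cond_expectation (G : set (set T)) (X Y : T -> \bar R) : Prop :=
  [/\ forall w, 0 <= Y w,
      forall B : set (\bar R), measurable B -> G (Y @^-1` B) &
      forall A, G A -> \int[P]_(w in A) Y w = \int[P]_(w in A) X w].

(* g is a version of z |-> E(X | Z = z), for X >= 0: it is unique only up to a
   null set for the law of Z. *)
Definition is_cond_expectation_at {d' : measure_display}
    {T' : measurableType d'} (Z : T -> T') (X : T -> \bar R)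
    (g : T' -> \bar R) : Prop :=
  measurable_fun setT g /\
  is_cond_expectation (g_sigma_algebra_preimage Z) X (g \o Z).

End conditional_expectation.

Section controlled_markov.
Context {d : measure_display} {T : measurableType d} {R : realType}.
Context {dt dx : nat}.

Definition history (theta : nat -> T -> 'rV[R]_dt) (xi : nat -> T -> 'rV[R]_dx)
    (n : nat) : set (set T) :=
  <<s \bigcup_(k in [set k | (k <= n)%N])
        (g_sigma_algebra_preimage (theta k) `|`
         g_sigma_algebra_preimage (xi k)) >>.

Definition controlled_markov (P : probability T R)
    (theta : nat -> T -> 'rV[R]_dt) (xi : nat -> T -> 'rV[R]_dx)
    (Pi : 'rV[R]_dt -> R.-pker 'rV[R]_dx ~> 'rV[R]_dx) : Prop :=
  (forall n, measurable_fun setT (xi n)) /\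
  forall (B : set 'rV[R]_dx) (n : nat), measurable B ->
    exists2 Y : T -> \bar R,
      is_cond_expectation P (history theta xi n)
        (fun w => (\1_(xi n.+1 @^-1` B) w)%:E) Y &
      {ae P, forall w, Y w = Pi (theta n w) (xi n w) B}.

End controlled_markov.

Section kernel_average.
Context {R : realType} {dt dx : nat}.
Variables (Pi : 'rV[R]_dt -> R.-pker 'rV[R]_dx ~> 'rV[R]_dx)
  (G : 'rV[R]_dt -> 'rV[R]_dx -> 'rV[R]_dt).

(* The vector integral defining kernel_average exists at every point. *)
Definition kernel_integrable : Prop :=
  forall theta xi (i : 'I_dt),
    (Pi theta xi).-integrable setT (fun xi' => (G theta xi' ord0 i)%:E).

Definition kernel_average (theta : 'rV[R]_dt) (xi : 'rV[R]_dx) : 'rV[R]_dt :=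
  \row_(i < dt) \int[Pi theta xi]_xi' (G theta xi' ord0 i).

End kernel_average.

Section pathwise.
Context {R : realType} {d : nat}.
Implicit Types (x : nat -> 'rV[R]_d) (Q : set 'rV[R]_d) (f : 'rV[R]_d -> R).

Definition exit_time x Q : \bar R :=
  ereal_inf [set n%:R%:E | n in [set n | ~ Q (x n)]].

Definition bounded_path x : Prop :=
  (ereal_sup (range (fun n => (enorm (x n))%:E)) < +oo)%E.

Definition acc_points x : set 'rV[R]_d := cluster (x @ \oo).

Definition Qhat x (rho : R) : set 'rV[R]_d :=
  if `[< bounded_path x >]
  then [set y | (edist_set y (acc_points x) <= rho%:E)%E]
  else acc_points x.

(* Only used along bounded paths, where the liminf is finite. *)
Definition fhat f x : R := fine (limn_einf (fun n => (f (x n))%:E)).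

Definition muhat f (mu : set 'rV[R]_d -> R -> R) x rho : R :=
  if `[< bounded_path x >] then mu (Qhat x rho) (fhat f x) else 2.

Definition nuhat f (mu : set 'rV[R]_d -> R -> R) (nu : set 'rV[R]_d -> R)
    x rho : R :=
  if `[< bounded_path x >]
  then mu (Qhat x rho) (fhat f x) * nu (Qhat x rho) / 2 else 1.

Definition rhat f mu x rho : \bar R :=
  if muhat f mu x rho < 2 then ((2 - muhat f mu x rho)^-1)%:E else +oo%E.

Definition phat f mu (r : R) x rho : R :=
  muhat f mu x rho * fine (Order.min r%:E (rhat f mu x rho)).

Definition qhat f mu nu (r : R) x rho : R :=
  nuhat f mu nu x rho * fine (Order.min r%:E (rhat f mu x rho)).

End pathwise.

(* Main.v *)
Require Import Defs.
From mathcomp Require Import ring lra.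

(** The recursion is gradient descent with an additive error,
    theta_(n+1) = theta_n - alpha_n (grad f(theta_n) + w_n), and the proof
    separates what is random, the size of the accumulated error, from what is
    true of every single path.

    _The noise._  By the Poisson equation, w_n is a martingale difference plus
    PF(theta_n, xi_n) - PF(theta_n, xi_(n+1)), where PF is the kernel average
    of the Poisson solution.  Weighted by alpha_n gamma_n^r, the martingale
    differences have summable variances on the event that the path stays in a
    fixed compact set, so their series converges almost surely (Kolmogorov's
    maximal inequality, [l2_series_cvg]).  The remaining terms telescope by
    parts; this leaves the variation of the weights, and the variation of PF
    in theta, which is small by Hoelder continuity.  Countably many compact
    sets exhaust the bounded paths ([ae_noise_cvg]).  Abel summation then says
    that the tails e_n = sum_(i >= n) alpha_i w_i are o(gamma_n^-r)
    ([weighted_tail]).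

    _One path._  The shifted point x_n = theta_n - e_n makes the step
    x_(n+1) = x_n - alpha_n grad f(theta_n), in which the noise appears only
    through the distance e_n between x_n and theta_n.  With v_n = f(x_n) - l,
    where l is the lower limit of f(theta_n), and G_n = ||grad f(x_n)||^2, a
    Taylor expansion gives
      v_(n+1) <= v_n - alpha_n G_n / 2 + O(alpha_n ||e_n||^2),
    and the Lojasiewicz inequality says G_n >= c |v_n|^(2/mu) as long as v_n is
    small.  In the time scale gamma_n this is the differential inequality
    v' <= - c |v|^(2/mu) + o(t^(-2s)) for each s <= r.  Its unforced solutions
    decay like t^(-mu/(2-mu)) and the forcing allows the rate t^(-mu s), so the
    worse of the two, which is given by s = min(r, 1/(2-mu)) with 1/0 read as
    infinity, is the rate of the theorem: a small o when the forcing decides, a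
    big O when the drift does.  The upper bound on v_n is a comparison with an explicit barrier
    ([power_barrier], [recursion_upper]); the lower bound holds because a very
    negative v_n could only decrease further ([recursion_lower]); and G_n obeys
    the bound of v_n because a large gradient persists long enough to drag v_n
    below it ([recursion_gradient]).

    _Distances._  Since the gradient tends to 0, l is a critical value, so
    |f(theta_n) - l| bounds the distance to the critical values; the distance
    to the critical points is bounded by a power of the gradient.  The rate
    with exponent min(1, r) follows, because mu r > r and mu/(2-mu) > 1. *)

Set Implicit Arguments.
Unset Strict Implicit.
Unset Printing Implicit Defensive.

Local Open Scope classical_set_scope.
Local Open Scope ring_scope.

(** * Tangent inequalities for real powers *)

Section powers.
Context {R : realType}.
Implicit Types (a q s t u x y : R).

Lemma ln_le_subr1 x : 0 < x -> ln x <= x - 1.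
Proof.
move=> x0; have := @le_ln1Dx R (x - 1).
by rewrite addrCA subrr addr0; apply; lra.
Qed.

(** Convexity of the power, reduced to 1 + x <= exp x by homogeneity. *)
Lemma powRN_tangent a t u : 0 <= a -> 0 < t -> 0 < u ->
  u `^ (- a) - a * u `^ (- a - 1) * (t - u) <= t `^ (- a).
Proof.
move=> a0 t0 u0.
have tuE : t = u * (t / u) by field; lra.
have tu0 : 0 < t / u by rewrite divr_gt0.
have -> : u `^ (- a) - a * u `^ (- a - 1) * (t - u) =
          u `^ (- a) * (1 - a * (t / u - 1)).
  rewrite powRD; last by apply/implyP => _; rewrite gt_eqF.
  by rewrite powR_inv1 ?(ltW u0)//; field; lra.
rewrite [in leRHS]tuE powRM ?(ltW u0) ?(ltW tu0)//.
apply: ler_wpM2l; first exact: powR_ge0.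
rewrite /powR gt_eqF//.
have := @expR_ge1Dx R (- a * ln (t / u)).
apply: le_trans.
have := ler_wpM2l a0 (ln_le_subr1 tu0); lra.
Qed.

(** Convexity of the power: by homogeneity this is Young's inequality for x / y
    and 1. *)
Lemma powR_tangent q x y : 1 <= q -> 0 <= x -> 0 < y ->
  y `^ q + q * y `^ (q - 1) * (x - y) <= x `^ q.
Proof.
move=> q1 x0 y0.
have xyE : x = y * (x / y) by field; lra.
have xy0 : 0 <= x / y by rewrite divr_ge0// ltW.
have -> : y `^ q + q * y `^ (q - 1) * (x - y) =
          y `^ q * (1 + q * (x / y - 1)).
  rewrite powRD; last by apply/implyP => _; rewrite gt_eqF.
  by rewrite powR_inv1 ?(ltW y0)//; field; lra.
rewrite [in leRHS]xyE powRM ?(ltW y0)//.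
apply: ler_wpM2l; first exact: powR_ge0.
move: q1; rewrite le_eqVlt => /predU1P[<-|q1]; first by rewrite powRr1//; lra.
have q0 : 0 < q by lra.
have qp0 : 0 < (1 - q^-1)^-1.
  by rewrite invr_gt0 subr_gt0 invf_lt1.
have := @conjugate_powR R (x / y) 1 q (1 - q^-1)^-1 xy0 ler01 q0 qp0.
rewrite invrK powR1 => /(_ _); rewrite mulr1 mul1r.
have -> : q^-1 + (1 - q^-1) = 1 by ring.
move=> /(_ erefl) h.
have := ler_wpM2l (ltW q0) h.
have -> : q * ((x / y) `^ q / q + (1 - q^-1)) = (x / y) `^ q + q - 1.
  by field; lra.
lra.
Qed.

Lemma ler_powRN a t u : 0 <= a -> 0 < t -> t <= u -> u `^ (- a) <= t `^ (- a).
Proof.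
move=> a0 t0 tu; have u0 : 0 < u by lra.
rewrite !powRN lef_pV2 ?posrE ?powR_gt0//.
by apply: ge0_ler_powR => //; rewrite nnegrE ltW.
Qed.

End powers.

Section gamma_powers.
Context {R : realType}.
Variables (ga : nat -> R).
Hypothesis ga_oo : ga @ \oo --> +oo.
Implicit Types (a b c : R).

Lemma near_gamma_ge c : \forall n \near \oo, c <= ga n.
Proof. exact: (cvgryPge _).1 ga_oo c. Qed.

Lemma near_powRN_le a c : 0 < a -> 0 < c ->
  \forall n \near \oo, ga n `^ (- a) <= c.
Proof.
move=> a0 c0; near=> n.
have g0 : c `^ (- a^-1) <= ga n by near: n; exact: near_gamma_ge.
have := ler_powRN (ltW a0) (powR_gt0 _ c0) g0.
by rewrite -powRrM mulNr mulrN opprK mulVf ?gt_eqF// powRr1// ltW.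
Unshelve. all: by end_near. Qed.

Lemma near_powRN_le_mul a b c : a < b -> 0 < c ->
  \forall n \near \oo, ga n `^ (- b) <= c * ga n `^ (- a).
Proof.
move=> ab c0; near=> n.
have g0 : 0 < ga n by apply: (@lt_le_trans _ _ 1) => //; near: n; exact: near_gamma_ge.
have -> : - b = - (b - a) - a by lra.
rewrite powRD; last by apply/implyP => _; rewrite gt_eqF.
apply: ler_wpM2r; first exact: powR_ge0.
by near: n; apply: near_powRN_le => //; rewrite subr_gt0.
Unshelve. all: by end_near. Qed.

End gamma_powers.

(** * Scalar recursions with a power drift *)

Section barrier.
Context {R : realType}.
Implicit Types (k a b q x y s : R).

(** A short explicit Euler step of y' = - k y^q preserves the order on [0, b]:
    the condition on s keeps the slope of the map nonnegative there. *)
Lemma drift_map_mono q k s b x y : 1 <= q -> 0 <= k * s ->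
  k * s * (q * b `^ (q - 1)) <= 1 -> 0 <= x -> x <= y -> y <= b ->
  x - k * s * x `^ q <= y - k * s * y `^ q.
Proof.
move=> q1 ks0 ksb x0 xy yb.
have [y0|y0] := leP y 0; first by have -> : x = y by lra.
have tg := powR_tangent q1 x0 y0.
have yb1 : y `^ (q - 1) <= b `^ (q - 1).
  by apply: ge0_ler_powR; rewrite ?nnegrE ?subr_ge0//; lra.
have slope : k * s * (q * y `^ (q - 1)) <= 1.
  apply: le_trans ksb; rewrite ler_wpM2l// ler_wpM2l//; lra.
have h1 := ler_wpM2l ks0 tg.
have h2 : k * s * (q * y `^ (q - 1)) * (y - x) <= 1 * (y - x).
  by rewrite ler_wpM2r// subr_ge0.
nra.
Qed.

(** Discrete comparison principle.  The barrier K e^-a is a supersolution of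
    v' = - k |v|^q + eps; its decrement over a step is at most the step times
    its slope, by convexity, and the Euler map preserves the order. *)
Lemma power_barrier (al ga v eps : nat -> R) (k K a q h : R) (n0 : nat) :
  (forall n, ga n.+1 = ga n + al n) -> (forall n, 0 < al n) ->
  (forall n, 0 <= eps n) ->
  0 < k -> 0 < K -> 0 < a -> 1 <= q -> 0 < h ->
  (forall n, (n0 <= n)%N -> k * al n * (q * (K * h `^ (- a)) `^ (q - 1)) <= 1) ->
  (forall n, (n0 <= n)%N ->
     v n.+1 <= v n - k * al n * `|v n| `^ q + al n * eps n) ->
  (forall n e, (n0 <= n)%N -> e = ga n - ga n0 + h ->
     K * a * e `^ (- a - 1) + eps n <= k * (K * e `^ (- a)) `^ q) ->
  v n0 <= K * h `^ (- a) ->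
  forall n, (n0 <= n)%N -> v n <= K * (ga n - ga n0 + h) `^ (- a).
Proof.
move=> gaS al0 eps0 k0 K0 a0 q1 h0 small drift bar init.
have eh n : (n0 <= n)%N -> h <= ga n - ga n0 + h.
  elim: n => [|n IH]; first by rewrite leqn0 => /eqP ->; lra.
  rewrite leq_eqVlt => /predU1P[->|]; first by lra.
  rewrite ltnS => /IH; rewrite gaS; have := al0 n; lra.
elim=> [|n IH]; first by rewrite leqn0 => /eqP <-; rewrite subrr add0r.
rewrite leq_eqVlt => /predU1P[<-|]; first by rewrite subrr add0r.
rewrite ltnS => nn; move/(_ nn): IH => IH.
have e0 := eh n nn; set e := ga n - ga n0 + h in IH e0 *.
have eS : ga n.+1 - ga n0 + h = e + al n by rewrite gaS /e; ring.
have bS : K * (e `^ (- a) - a * e `^ (- a - 1) * al n) <= K * (e + al n) `^ (- a).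
  rewrite ler_wpM2l ?(ltW K0)//.
  have := @powRN_tangent R a (e + al n) e (ltW a0).
  have -> : e + al n - e = al n by ring.
  by apply; have := al0 n; lra.
rewrite eS; apply: le_trans bS.
have barn := bar n e nn erefl.
have h1 : al n * (K * a * e `^ (- a - 1) + eps n) <= al n * (k * (K * e `^ (- a)) `^ q).
  by rewrite ler_wpM2l// ltW.
suff h2 : v n - k * al n * `|v n| `^ q <=
    K * e `^ (- a) - k * al n * (K * e `^ (- a)) `^ q.
  have := drift n nn; lra.
have ks0 : 0 <= k * al n by rewrite mulr_ge0 ?ltW.
have b0 : 0 <= K * e `^ (- a) by rewrite mulr_ge0 ?powR_ge0 ?ltW.
have bh : K * e `^ (- a) <= K * h `^ (- a).
  by rewrite ler_wpM2l ?(ltW K0)// ler_powRN// ltW.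
have mono := @drift_map_mono q k (al n) (K * h `^ (- a)) _ _ q1 ks0 (small n nn).
have [v0|v0] := leP 0 (v n).
  by rewrite ger0_norm//; apply: mono.
have := mono 0 _ (lexx _) b0 bh; rewrite powR0; last by lra.
have : 0 <= k * al n * `|v n| `^ q by rewrite mulr_ge0 ?powR_ge0.
lra.
Qed.

End barrier.

(** The situation of a perturbed descent, stripped to numbers: v is the excess of
    an objective over its lower limit, G the squared gradient, eps the
    perturbation, al the steps and ga the elapsed time.  The condition
    q a <= a + 1 says that t^-a does not decay faster than the solutions of
    v' = - v^q. *)
Section recursion.
Context {R : realType}.
Variables (al ga v G eps : nat -> R) (c c1 C a q del B : R).
Hypothesis al_gt0 : forall n, 0 < al n.
Hypothesis al_cvg0 : forall x, 0 < x -> \forall n \near \oo, al n <= x.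
Hypothesis gaS : forall n, ga n.+1 = ga n + al n.
Hypothesis ga_oo : ga @ \oo --> +oo.
Hypotheses (c0 : 0 < c) (c10 : 0 < c1) (C0 : 0 <= C) (a0 : 0 < a)
  (q1 : 1 <= q) (qa : q * a <= a + 1) (del0 : 0 < del).
Hypothesis eps_ge0 : forall n, 0 <= eps n.
Hypothesis eps_small : forall k, 0 < k ->
  \forall n \near \oo, eps n <= k * ga n `^ (- (q * a)).
Hypothesis G_ge0 : forall n, 0 <= G n.
Hypothesis G_bounded : \forall n \near \oo, G n <= B.
Hypothesis descent : \forall n \near \oo,
  v n.+1 <= v n - c * al n * G n + al n * eps n.
Hypothesis loja : \forall n \near \oo, `|v n| <= del -> c1 * `|v n| `^ q <= G n.
Hypothesis G_decay : \forall n \near \oo,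
  G n - C * al n * (G n + eps n) <= G n.+1.
Hypothesis v_low : forall x, 0 < x -> \forall n \near \oo, - x <= v n.
Hypothesis v_freq : forall x N, 0 < x -> exists2 n, (N <= n)%N & v n <= x.

Let qa0 : 0 < q * a. Proof. by rewrite mulr_gt0//; have := q1; lra. Qed.

Let ga_mono n m : (n <= m)%N -> ga n <= ga m.
Proof.
elim: m => [|m IH]; first by rewrite leqn0 => /eqP ->.
rewrite leq_eqVlt => /predU1P[->//|]; rewrite ltnS => /IH.
rewrite gaS; have := al_gt0 m; lra.
Qed.

Lemma near_eps_le x : 0 < x -> \forall n \near \oo, eps n <= x.
Proof.
move=> x0; near=> n.
have h1 : eps n <= 1 * ga n `^ (- (q * a)) by near: n; apply: eps_small.
have h2 : ga n `^ (- (q * a)) <= x by near: n; apply: near_powRN_le.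
by rewrite mul1r in h1; apply: le_trans h2.
Unshelve. all: by end_near. Qed.

(** Above a small level the drift beats the perturbation, so after dipping
    below the level, which happens infinitely often, v never climbs back. *)
Lemma recursion_cvg0 x : 0 < x -> \forall n \near \oo, `|v n| <= x.
Proof.
move=> x0; pose y := Num.min x del.
have y0 : 0 < y by rewrite lt_min x0.
have [yx yd] : y <= x /\ y <= del by rewrite !ge_min !lexx orbT.
have d0 : 0 < c * (c1 * (y / 2) `^ q).
  by rewrite !mulr_gt0// powR_gt0// divr_gt0.
have H : \forall n \near \oo, [/\ - y <= v n, al n <= 1,
   eps n <= Num.min (y / 2) (c * (c1 * (y / 2) `^ q)),
   v n.+1 <= v n - c * al n * G n + al n * eps n &
   (`|v n| <= del -> c1 * `|v n| `^ q <= G n)].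
  near=> n; split; near: n => //.
  - exact: v_low.
  - exact: al_cvg0.
  - by apply: near_eps_le; rewrite lt_min d0 andbT divr_gt0.
case: H => N _ HN.
have [n0 Nn0 vn0] := v_freq N y0.
exists n0 => // n /= n0n; rewrite ler_norml.
have Nn : (N <= n)%N := leq_trans Nn0 n0n.
have [low _ _ _ _] := HN n Nn; apply/andP; split; first by lra.
apply: le_trans yx; elim: n n0n Nn {low} => [|n IH] n0n Nn.
  by move: n0n; rewrite leqn0 => /eqP <-.
move: n0n; rewrite leq_eqVlt => /predU1P[<-//|]; rewrite ltnS => n0n.
have Nn' : (N <= n)%N := leq_trans Nn0 n0n.
have vy := IH n0n Nn'.
have [low al1] := HN n Nn'; rewrite le_min => /andP[e1 e2] de lo.
have an0 := al_gt0 n.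
have ae : al n * eps n <= eps n.
  by have := eps_ge0 n; nra.
have aG : 0 <= c * al n * G n by rewrite !mulr_ge0// ltW.
have [vh|vh] := leP (v n) (y / 2); first by lra.
have nv : `|v n| = v n by rewrite ger0_norm//; lra.
rewrite nv in lo; have {}lo := lo ltac:(lra).
have pq : (y / 2) `^ q <= v n `^ q.
  by have q1' := q1; apply: ge0_ler_powR; rewrite ?nnegrE; lra.
have h1 : c * (c1 * (y / 2) `^ q) <= c * G n.
  rewrite ler_wpM2l ?(ltW c0)//; apply: le_trans lo.
  by rewrite ler_wpM2l// ltW.
have h2 : al n * eps n <= al n * (c * G n).
  by rewrite ler_wpM2l ?(ltW an0)//; lra.
lra.
Unshelve. all: by end_near. Qed.

Let k := c * c1.
Let k0 : 0 < k. Proof. exact: mulr_gt0. Qed.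

Lemma recursion_drift : \forall n \near \oo,
  v n.+1 <= v n - k * al n * `|v n| `^ q + al n * eps n.
Proof.
near=> n.
have h1 : v n.+1 <= v n - c * al n * G n + al n * eps n by near: n.
have h2 : `|v n| <= del by near: n; exact: recursion_cvg0.
have h3 : c1 * `|v n| `^ q <= G n by move: h2; near: n.
have h4 : c * al n * (c1 * `|v n| `^ q) <= c * al n * G n.
  by rewrite ler_wpM2l// mulr_ge0// ltW.
rewrite /k; lra.
Unshelve. all: by end_near. Qed.

(** A value of - v above the noise level could only grow from there on,
    whereas v tends to 0. *)
Lemma recursion_lower x : 0 < x ->
  \forall n \near \oo, - v n <= x * ga n `^ (- a).
Proof.
move=> x0; have q1' := q1.
have y0 : 0 < k * x `^ q by rewrite mulr_gt0// powR_gt0.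
have H : \forall n \near \oo, [/\ 1 <= ga n,
    eps n <= (k * x `^ q) * ga n `^ (- (q * a)) &
    v n.+1 <= v n - k * al n * `|v n| `^ q + al n * eps n].
  near=> n; split; near: n.
  - exact: near_gamma_ge.
  - exact: eps_small.
  - exact: recursion_drift.
case: H => N _ HN; exists N => // n /= Nn; rewrite leNgt; apply/negP => bad.
have gn0 : 0 < ga n by have [g1 _ _] := HN n Nn; lra.
have b0 : 0 < x * ga n `^ (- a) by rewrite mulr_gt0// powR_gt0.
have grow m : (n <= m)%N -> v m <= v n.
  elim: m => [|m IH]; first by rewrite leqn0 => /eqP <-.
  rewrite leq_eqVlt => /predU1P[<-//|]; rewrite ltnS => nm.
  have vm := IH nm.
  have [g1 e1 d1] := HN m (leq_trans Nn nm).
  have h1 : eps m <= k * `|v m| `^ q.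
    apply: (le_trans e1); rewrite -mulrA ler_wpM2l ?(ltW k0)//.
    rewrite -mulNr mulrC mulNr mulrC -mulNr [- q * a]mulrC.
    have -> : a * - q = (- a) * q by ring.
    rewrite powRrM -powRM ?powR_ge0 ?(ltW x0)//.
    apply: ge0_ler_powR; rewrite ?nnegrE ?mulr_ge0 ?powR_ge0 ?(ltW x0)//; first by lra.
    have : x * ga m `^ (- a) <= x * ga n `^ (- a).
      by rewrite ler_wpM2l ?(ltW x0)// ler_powRN ?ga_mono ?(ltW a0).
    by rewrite ltr0_norm; lra.
  have := ler_wpM2l (ltW (al_gt0 m)) h1; lra.
have [M _ HM] := recursion_cvg0 (divr_gt0 b0 (@ltr0n R 2)).
have := HM (maxn n M) (leq_maxr _ _); have := grow _ (leq_maxl n M).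
by rewrite /= ler_norml => ? /andP[? ?]; lra.
Unshelve. all: by end_near. Qed.

(** The barrier is K (ga_n - ga_N + h)^-a.  At n = N it equals K h^-a, a fixed
    level that v is below once N is large; the shift costs at most a factor 2
    for large n. *)
Lemma recursion_upper K h : 0 < K -> 0 < h ->
  K * a * h `^ (q * a - a - 1) <= k / 2 * K `^ q ->
  \forall n \near \oo, v n <= 2 * K * ga n `^ (- a).
Proof.
move=> K0 h0 Kh; have [q1' qa'] := (q1, qa).
have Kq0 : 0 < k / 2 * K `^ q by rewrite mulr_gt0 ?powR_gt0 ?divr_gt0.
have Kh0 : 0 < K * h `^ (- a) by rewrite mulr_gt0 ?powR_gt0.
have mon0 : 0 < k * (q * (K * h `^ (- a)) `^ (q - 1)).
  by rewrite !mulr_gt0 ?powR_gt0//; lra.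
have H : \forall n \near \oo, [/\ h <= ga n,
    al n <= (k * (q * (K * h `^ (- a)) `^ (q - 1)))^-1,
    eps n <= (k / 2 * K `^ q) * ga n `^ (- (q * a)),
    `|v n| <= K * h `^ (- a) &
    v n.+1 <= v n - k * al n * `|v n| `^ q + al n * eps n].
  near=> n; split; near: n.
  - exact: near_gamma_ge.
  - by apply: al_cvg0; rewrite invr_gt0.
  - exact: eps_small.
  - exact: recursion_cvg0.
  - exact: recursion_drift.
case: H => N _ HN.
have bar : forall n, (N <= n)%N -> v n <= K * (ga n - ga N + h) `^ (- a).
  apply: (@power_barrier R al ga v eps k K a q h N) => //.
  - move=> n Nn; have [_ h2 _ _ _] := HN n Nn.
    have := ler_wpM2l (ltW mon0) h2; rewrite divff ?gt_eqF//; lra.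
  - by move=> n Nn; have [] := HN n Nn.
  - move=> n e Nn eE.
    have [_ _ h3 _ _] := HN n Nn; have [hN _ _ _ _] := HN N (leqnn N).
    have he : h <= e by have := ga_mono Nn; lra.
    have eg : e <= ga n by lra.
    have e0 : 0 < e by lra.
    have E1 : (K * e `^ (- a)) `^ q = K `^ q * e `^ (- (q * a)).
      rewrite powRM ?powR_ge0 ?(ltW K0)// -powRrM; congr (_ * _ `^ _); ring.
    have E2 : e `^ (- a - 1) = e `^ (q * a - a - 1) * e `^ (- (q * a)).
      rewrite -powRD; last by apply/implyP => _; rewrite gt_eqF.
      by congr (_ `^ _); ring.
    have p0 : 0 <= e `^ (- (q * a)) by exact: powR_ge0.
    have h4 : e `^ (q * a - a - 1) <= h `^ (q * a - a - 1).
      have -> : q * a - a - 1 = - (a + 1 - q * a) by ring.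
      by apply: ler_powRN => //; rewrite subr_ge0.
    have h5 : K * a * e `^ (q * a - a - 1) <= k / 2 * K `^ q.
      apply: le_trans Kh; rewrite ler_wpM2l// mulr_ge0 ?ltW//.
    have h6 : ga n `^ (- (q * a)) <= e `^ (- (q * a)).
      by apply: ler_powRN => //; exact: ltW.
    have h7 := ler_wpM2r p0 h5.
    have h8 := ler_wpM2l (ltW Kq0) h6.
    rewrite E1 E2 mulrA.
    have -> : k * (K `^ q * e `^ (- (q * a))) =
      k / 2 * K `^ q * e `^ (- (q * a)) + k / 2 * K `^ q * e `^ (- (q * a)).
      by field.
    by apply: lerD h7 _; apply: le_trans h8.
  - by have [_ _ _ h4 _] := HN N (leqnn N); apply: le_trans h4; exact: ler_norm.
(* dividing the time by 2^(1/a) doubles its power -a *)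
pose rt := 2 `^ (a^-1) : R.
have rt1 : 1 < rt.
  rewrite ltNge; apply/negP => hc.
  have : (2 `^ a^-1) `^ a <= 1 `^ a :> R.
    by apply: ge0_ler_powR; rewrite ?nnegrE ?powR_ge0// ltW.
  by rewrite powR1 -powRrM mulVf ?gt_eqF// powRr1//; lra.
near=> n.
have Nn : (N <= n)%N by near: n; exists N.
apply: (le_trans (bar n Nn)); rewrite -mulrA mulrCA ler_wpM2l ?(ltW K0)//.
have gl : rt * ga N / (rt - 1) <= ga n by near: n; exact: near_gamma_ge.
have gn : h <= ga n by have [] := HN n Nn.
have gN : h <= ga N by have [] := HN N (leqnn N).
have key : ga n / rt <= ga n - ga N + h.
  rewrite ler_pdivrMr; last by lra.
  rewrite ler_pdivrMr in gl; last by lra.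
  nra.
have := ler_powRN (ltW a0) (_ : 0 < ga n / rt) key.
have g0 : 0 < ga n by lra.
have i0 : 0 < rt^-1 by rewrite invr_gt0; lra.
move=> /(_ (mulr_gt0 g0 i0)) /le_trans; apply.
rewrite powRM ?(ltW g0) ?(ltW i0)// [leLHS]mulrC; apply: ler_wpM2r; first exact: powR_ge0.
have -> : rt^-1 = 2 `^ (- a^-1) by rewrite powRN.
by rewrite -powRrM mulrNN mulVf ?gt_eqF// powRr1.
Unshelve. all: by end_near. Qed.

(** Suppose G_n is much larger than the bound be_n on |v_n| and on eps_n.  By
    G_decay, G falls at rate at most C (G + eps), while A v falls at rate at
    least (C + 1) G - A eps, because A = (C + 1) / c.  Hence G - A v grows at
    rate at least be_n for all later times, against the boundedness of G. *)
Lemma recursion_gradient x : 0 < x ->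
  (\forall n \near \oo, `|v n| <= x * ga n `^ (- a)) ->
  (\forall n \near \oo, eps n <= x * ga n `^ (- a)) ->
  \forall n \near \oo, G n <= (2 * ((C + 1) / c) + (C + 1) / c + C + 1) * x * ga n `^ (- a).
Proof.
move=> x0 vx ex; have [C0' c0'] := (C0, c0); set A := (C + 1) / c.
have A0 : 0 < A by rewrite divr_gt0//; lra.
have Ac : A * c = C + 1 by rewrite /A -mulrA mulVf ?mulr1// gt_eqF.
have H : \forall n \near \oo, [/\ 1 <= ga n, `|v n| <= x * ga n `^ (- a),
    eps n <= x * ga n `^ (- a),
    v n.+1 <= v n - c * al n * G n + al n * eps n &
    G n - C * al n * (G n + eps n) <= G n.+1 /\ G n <= B].
  near=> n; split; near: n => //; first exact: near_gamma_ge.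
  exact: filterI.
case: H => N _ HN; exists N => // n /= Nn; rewrite leNgt; apply/negP => bad.
pose be m := x * ga m `^ (- a).
have [gn1 vn _ _ _] := HN n Nn.
have be0 : 0 < be n by rewrite mulr_gt0// powR_gt0//; lra.
have bem m : (n <= m)%N -> be m <= be n.
  move=> nm; rewrite ler_wpM2l ?(ltW x0)// ler_powRN ?ga_mono ?(ltW a0)//; lra.
pose Z m := G m - A * v m.
have Zn : (A + A + C + 1) * be n < Z n.
  move: vn bad; rewrite /Z -/(be n) -mulrA -/(be n) ler_norml => /andP[_ vb].
  have := ler_wpM2l (ltW A0) vb; lra.
have grow m : (n <= m)%N -> Z n + be n * (ga m - ga n) <= Z m.
  elim: m => [|m IH]; first by rewrite leqn0 => /eqP <-; lra.
  rewrite leq_eqVlt => /predU1P[<-|]; first by lra.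
  rewrite ltnS => nm; have Zm := IH nm.
  have [_ v1 e1 d1 [G1 _]] := HN m (leq_trans Nn nm).
  have b1 := bem m nm; rewrite -/(be m) in v1 e1.
  have bg : 0 <= be n * (ga m - ga n).
    by rewrite mulr_ge0 ?(ltW be0)// subr_ge0 ga_mono.
  have vb : - be n <= v m by move: v1; rewrite ler_norml; lra.
  have Gm : (A + C + 1) * be n <= G m.
    have := ler_wpM2l (ltW A0) vb; rewrite /Z in Zm Zn *; lra.
  have am := al_gt0 m.
  have inc : be n <= G m - (A + C) * eps m.
    have : (A + C) * eps m <= (A + C) * be n by rewrite ler_wpM2l; lra.
    lra.
  have h1 := ler_wpM2l (ltW am) inc.
  have h2 := ler_wpM2l (ltW A0) d1.
  have h3 : A * (c * al m * G m) = (C + 1) * al m * G m.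
    by rewrite !mulrA Ac.
  rewrite gaS /Z in Zm *; lra.
have [M _ HM] : \forall m \near \oo, n%:R + (B + A * be n) / be n + ga n <= ga m.
  exact: near_gamma_ge.
have := grow (maxn n M) (leq_maxl _ _); have := HM _ (leq_maxr n M).
have [_ v1 _ _ [_ GB]] := HN _ (leq_trans Nn (leq_maxl n M)).
rewrite -/(be _) in v1.
have b1 := bem _ (leq_maxl n M).
have vb : - be n <= v (maxn n M) by move: v1; rewrite ler_norml; lra.
move=> /= h1 h2.
have h3 : (B + A * be n) / be n <= ga (maxn n M) - ga n.
  have := ler0n R n; lra.
have h4 := ler_wpM2l (ltW be0) h3.
rewrite mulrCA divff ?gt_eqF// mulr1 in h4.
have := ler_wpM2l (ltW A0) vb.
have : 0 < (A + A + C + 1) * be n by rewrite mulr_gt0//; lra.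
rewrite /Z in Zn h2 *; lra.
Unshelve. all: by end_near. Qed.

(** Below the critical exponent, the condition of the barrier holds for
    arbitrarily small K, provided that the shift h is large. *)
Lemma recursion_o x : q * a < a + 1 -> 0 < x ->
  \forall n \near \oo, `|v n| <= x * ga n `^ (- a).
Proof.
move=> qa' x0; pose K := x / 2.
have K0 : 0 < K by rewrite divr_gt0.
pose t := a + 1 - q * a.
have t0 : 0 < t by rewrite /t; lra.
pose y := k / 2 * K `^ q / (K * a).
have y0 : 0 < y by rewrite !(divr_gt0, mulr_gt0)// powR_gt0.
have up := @recursion_upper K (y `^ (- t^-1)) K0 (powR_gt0 _ y0).
near=> n; rewrite ler_norml; apply/andP; split.
  by rewrite lerNl; near: n; exact: recursion_lower.
have -> : x = 2 * K by rewrite /K; lra.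
near: n; apply: up.
rewrite -powRrM; have -> : - t^-1 * (q * a - a - 1) = 1.
  by rewrite /t; field; rewrite -/t; lra.
by rewrite powRr1 ?(ltW y0)// /y mulrC divfK// gt_eqF// mulr_gt0.
Unshelve. all: by end_near. Qed.

(** At the shift h = 1 the condition of the barrier is met by
    K^(q - 1) = 2 a / k, whether or not the exponent is critical. *)
Lemma recursion_O : 1 < q ->
  exists2 x, 0 < x & \forall n \near \oo, `|v n| <= x * ga n `^ (- a).
Proof.
move=> q1'; pose y := 2 * a / k.
have y0 : 0 < y by rewrite !(divr_gt0, mulr_gt0).
pose K := y `^ ((q - 1)^-1); have K0 : 0 < K by exact: powR_gt0.
exists (2 * K); first exact: mulr_gt0.
near=> n; rewrite ler_norml; apply/andP; split.
  by rewrite lerNl; near: n; apply: recursion_lower; exact: mulr_gt0.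
near: n; apply: (@recursion_upper K 1) => //.
rewrite powR1 mulr1 -(mulr_powRB1 (ltW K0)); last by lra.
rewrite /K -powRrM mulVf; last by lra.
rewrite powRr1 ?(ltW y0)// /y -/K.
have -> : k / 2 * (K * (2 * a / k)) = K * a by field; rewrite gt_eqF.
by [].
Unshelve. all: by end_near. Qed.

End recursion.

(** * Euclidean norm and Taylor estimates *)

Section euclid.
Context {R : realType} {d : nat}.
Implicit Types (x y z : 'rV[R]_d).

Definition dotv x y : R := \sum_(i < d) x ord0 i * y ord0 i.

Lemma enorm_ge0 x : 0 <= enorm x. Proof. exact: sqrtr_ge0. Qed.

Lemma enorm_sqr x : enorm x ^+ 2 = \sum_(i < d) x ord0 i ^+ 2.
Proof. by rewrite /enorm sqr_sqrtr// sumr_ge0// => i _; exact: sqr_ge0. Qed.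

Lemma enorm_sqr_dot x : enorm x ^+ 2 = dotv x x.
Proof. by rewrite enorm_sqr; apply: eq_bigr => i _; rewrite expr2. Qed.

Lemma dotvDr x y z : dotv x (y + z) = dotv x y + dotv x z.
Proof. by rewrite -big_split; apply: eq_bigr => i _; rewrite mxE mulrDr. Qed.

Lemma dotvZr k x y : dotv x (k *: y) = k * dotv x y.
Proof. by rewrite mulr_sumr; apply: eq_bigr => i _; rewrite mxE mulrCA. Qed.

Lemma dotvDl x y z : dotv (x + y) z = dotv x z + dotv y z.
Proof. by rewrite -big_split; apply: eq_bigr => i _; rewrite mxE mulrDl. Qed.

Lemma enormN x : enorm (- x) = enorm x.
Proof. by congr Num.sqrt; apply: eq_bigr => i _; rewrite mxE sqrrN. Qed.

Lemma enormB x y : enorm (x - y) = enorm (y - x).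
Proof. by rewrite -enormN opprB. Qed.

Lemma enormZ k x : enorm (k *: x) = `|k| * enorm x.
Proof.
rewrite -sqrtr_sqr -sqrtrM ?sqr_ge0//; congr Num.sqrt.
by rewrite mulr_sumr; apply: eq_bigr => i _; rewrite mxE exprMn.
Qed.

Lemma enorm0 : enorm (0 : 'rV[R]_d) = 0.
Proof. by rewrite -(scale0r 0) enormZ normr0 mul0r. Qed.

Lemma coord_le_enorm x i : `|x ord0 i| <= enorm x.
Proof.
rewrite -sqrtr_sqr ler_sqrt; last by rewrite sumr_ge0// => j _; exact: sqr_ge0.
by rewrite (bigD1 i)//= lerDl sumr_ge0// => j _; exact: sqr_ge0.
Qed.

Lemma enorm_eq0 x : enorm x = 0 -> x = 0.
Proof.
move=> x0; apply/rowP => i; rewrite mxE; apply/eqP.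
by rewrite -normr_le0 -x0 coord_le_enorm.
Qed.

Lemma dotv_young x y k : 0 < k ->
  2 * `|dotv x y| <= k * enorm x ^+ 2 + k^-1 * enorm y ^+ 2.
Proof.
move=> k0; apply: le_trans (_ : 2 * \sum_i `|x ord0 i * y ord0 i| <= _).
  by rewrite ler_pM2l// ler_norm_sum.
rewrite !enorm_sqr !mulr_sumr -big_split; apply: ler_sum => i _ /=.
set a := x _ _; set b := y _ _; rewrite normrM -(real_normK (num_real a)) -(real_normK (num_real b)).
have : 0 <= k * (`|a| - k^-1 * `|b|) ^+ 2 by rewrite mulr_ge0 ?sqr_ge0// ltW.
have -> : k * (`|a| - k^-1 * `|b|) ^+ 2 =
  k * `|a| ^+ 2 + k^-1 * `|b| ^+ 2 - 2 * (`|a| * `|b|) by field; rewrite gt_eqF.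
by rewrite subr_ge0.
Qed.

Lemma dotv_le x y : `|dotv x y| <= enorm x * enorm y.
Proof.
have [/enorm_eq0 ->|x0] := eqVneq (enorm x) 0.
  rewrite /dotv big1 ?normr0 ?mulr_ge0 ?enorm_ge0// => i _.
  by rewrite mxE mul0r.
have [/enorm_eq0 ->|y0] := eqVneq (enorm y) 0.
  rewrite /dotv big1 ?normr0 ?mulr_ge0 ?enorm_ge0// => i _.
  by rewrite mxE mulr0.
have xp : 0 < enorm x by rewrite lt_def x0 enorm_ge0.
have yp : 0 < enorm y by rewrite lt_def y0 enorm_ge0.
have := @dotv_young x y (enorm y / enorm x) (divr_gt0 yp xp).
have -> : enorm y / enorm x * enorm x ^+ 2 +
  (enorm y / enorm x)^-1 * enorm y ^+ 2 = 2 * (enorm x * enorm y).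
  by field; rewrite x0 y0.
by rewrite ler_pM2l.
Qed.

Lemma enormD x y : enorm (x + y) <= enorm x + enorm y.
Proof.
rewrite -ler_sqr ?nnegrE ?addr_ge0 ?enorm_ge0//.
rewrite enorm_sqr_dot dotvDl !dotvDr sqrrD -!enorm_sqr_dot.
have := dotv_le x y; have := dotv_le y x; rewrite !ler_norml.
move=> /andP[_ h1] /andP[_ h2]; rewrite mulr2n; lra.
Qed.

Lemma coord_le_norm x i : `|x ord0 i| <= `|x|.
Proof.
rewrite [leRHS]/Num.norm/= mx_normrE; apply/bigmax_geP; right.
by exists (ord0, i).
Qed.

Lemma norm_le_enorm x : `|x| <= enorm x.
Proof.
rewrite [leLHS]/Num.norm/= mx_normrE; apply/bigmax_leP; split=> [|[i j] _].
  exact: enorm_ge0.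
by rewrite ord1; exact: coord_le_enorm.
Qed.

Lemma enorm_le_sum x : enorm x <= \sum_(i < d) `|x ord0 i|.
Proof.
have S0 : 0 <= \sum_(i < d) `|x ord0 i| by exact: sumr_ge0.
rewrite -ler_sqr ?nnegrE ?enorm_ge0// enorm_sqr expr2 mulr_suml.
apply: ler_sum => i _; rewrite -(real_normK (num_real (x _ _))) expr2 ler_wpM2l//.
by rewrite (bigD1 i)//= lerDl sumr_ge0.
Qed.

Lemma enorm_le_norm x : enorm x <= d%:R * `|x|.
Proof.
apply: le_trans (enorm_le_sum x) _.
apply: le_trans (_ : \sum_(i < d) `|x| <= _).
  by apply: ler_sum => i _; exact: coord_le_norm.
by rewrite sumr_const card_ord mulr_natl.
Qed.

Lemma nbhs_norm_ex (x : 'rV[R]_d) (A : set 'rV[R]_d) :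
  (exists2 e, 0 < e & forall y, `|x - y| < e -> A y) -> nbhs x A.
Proof.
move=> [e e0 eA]; apply/nbhs_ballP; exists e => //= y.
by rewrite -ball_normE; exact: eA.
Qed.

Lemma enorm_continuous : continuous (@enorm R d).
Proof.
move=> x; have FF := nbhs_filter x.
apply/(@cvgrPdist_le _ _ _ _ FF) => e e0; apply: nbhs_norm_ex.
exists (e / (d%:R + 1)); first by rewrite divr_gt0// ltr_wpDl.
move=> y; rewrite ltr_pdivlMr ?ltr_wpDl// => /ltW xy.
have {}xy : d%:R * `|x - y| <= e.
  by apply: le_trans xy; rewrite mulrC ler_wpM2l// lerDl.
apply: le_trans xy; apply: le_trans (enorm_le_norm _).
have h1 := enormD (x - y) y; rewrite subrK in h1.
have h2 := enormD (y - x) x; rewrite subrK enormB in h2.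
rewrite ler_norml; lra.
Qed.

End euclid.

Section smooth.
Context {R : realType} {d : nat}.
Variable f : 'rV[R]_d -> R.
Hypothesis f_diff : forall t, differentiable f t.
Implicit Types (x y z u : 'rV[R]_d).

Lemma derive_dot x u : 'D_u f x = dotv (grad f x) u.
Proof.
rewrite (deriveE _ (f_diff x)) {1}(row_sum_delta u) linear_sum.
apply: eq_bigr => i _ /=; rewrite linearZ/= mxE (deriveE _ (f_diff x)).
by rewrite mulrC.
Qed.

Lemma mean_value x y : exists2 t : R, 0 <= t <= 1 &
  f y - f x = dotv (grad f (x + t *: (y - x))) (y - x).
Proof.
set u := y - x.
pose p (t : R) := f (x + t *: u).
have pE t : (fun h : R => h^-1 *: ((p \o shift t) (h *: 1) - p t)) =
    (fun h : R => h^-1 *: ((f \o shift (x + t *: u)) (h *: u) - f (x + t *: u))).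
  apply: funext => h; rewrite /p /=; congr (_ *: (f _ - _)).
  by rewrite /shift/= [h *: 1]mulr1 scalerDl addrCA.
have dp (t : R) : is_derive t 1 p (dotv (grad f (x + t *: u)) u).
  rewrite -derive_dot; apply: DeriveDef.
    rewrite /derivable pE; exact: diff_derivable.
  by rewrite /derive pE.
have [|t t01] := @MVT_segment R p (fun t => dotv (grad f (x + t *: u)) u) 0 1 ler01 (fun t _ => dp t).
  apply: continuous_subspaceT => t; apply: differentiable_continuous.
  by apply/derivable1_diffP; exact: ex_derive.
rewrite /p scale1r scale0r addr0 subr0 mulr1 /u [x + _]addrC subrK => E.
by exists t => //; move: t01; rewrite in_itv.
Qed.

End smooth.

Section local_lipschitz.
Context {R : realType} {m n : nat}.
Variable g : 'rV[R]_m -> 'rV[R]_n.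
Hypothesis g_lip : locally_lipschitz g.

(** Near each point of the compact set one constant serves as Lipschitz bound,
    and its inverse as radius; compactness makes it uniform. *)
Lemma locally_lipschitz_compact (K : set 'rV[R]_m) : compact K ->
  exists L : R, 0 < L /\ forall x z, K x -> `|z - x| < L^-1 ->
    enorm (g z - g x) <= L * enorm (z - x).
Proof.
move=> /compact_near_coveringP cK.
have [] := cK R (+oo : set_system R) (fun i x => 0 < i /\ forall z, `|z - x| < i^-1 ->
    enorm (g z - g x) <= i * enorm (z - x)) _ _.
  move=> x Kx; have [U Ux [L HL]] := g_lip x.
  have [e /= e0 eU] := (nbhs_ballP _ _).1 Ux.
  exists (ball x (e / 2), [set i | Num.max (Num.max L 1) (2 / e) <= i]).
    split; first by apply: nbhsx_ballx; rewrite divr_gt0.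
    by apply: nbhs_pinfty_ge; exact: num_real.
  move=> [x' i] /= [xx']; rewrite !ge_max => /andP[/andP[Li i1] ei].
  have i0 : 0 < i by lra.
  split=> // z zx; apply: le_trans (_ : L * enorm (z - x') <= _); last first.
    by rewrite ler_wpM2r// enorm_ge0.
  apply: HL; apply: eU.
    rewrite (splitr e); apply: ball_triangle xx' _.
    rewrite -ball_normE /ball_/= distrC; apply: lt_le_trans zx _.
    rewrite -[e / 2]invrK invf_div lef_pV2 ?posrE ?divr_gt0//.
  by move: xx'; apply: le_ball; lra.
move=> L [_ HL]; exists (Num.max L 1 + 1).
have := HL (Num.max L 1 + 1).
have hL : L < Num.max L 1 + 1.
  by rewrite ltr_pwDr// le_max lexx.
move=> /(_ hL) KL; split.
  by rewrite ltr_pwDr// le_max ler01 orbT.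
by move=> x z Kx; have [_] := KL x Kx; exact.
Qed.

Lemma locally_lipschitz_continuous : continuous g.
Proof.
move=> x; have [L [L0 HL]] := locally_lipschitz_compact (@compact_set1 _ x).
have FF := nbhs_filter x.
apply/(@cvgrPdist_le _ _ _ _ FF) => e e0; apply: nbhs_norm_ex.
have D0 : 0 < L * (m%:R + 1) by rewrite mulr_gt0// ltr_wpDl.
exists (Num.min L^-1 (e / (L * (m%:R + 1)))).
  by rewrite lt_min invr_gt0 L0 divr_gt0.
move=> z; rewrite lt_min distrC => /andP[h1]; rewrite ltr_pdivlMr// => h2.
rewrite distrC; apply: le_trans (norm_le_enorm _) _.
apply: le_trans (HL x z erefl h1) _; apply: le_trans (ltW h2).
rewrite [leRHS]mulrC -mulrA ler_wpM2l ?(ltW L0)//.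
by apply: le_trans (enorm_le_norm _) _; rewrite ler_wpM2r// lerDl.
Qed.

End local_lipschitz.

Section descent.
Context {R : realType} {d : nat}.
Variable f : 'rV[R]_d -> R.
Hypothesis f_diff : forall t, differentiable f t.

Lemma taylor_bound (L r : R) (x z : 'rV[R]_d) : 0 <= L ->
  (forall y, `|y - x| < r -> enorm (grad f y - grad f x) <= L * enorm (y - x)) ->
  `|z - x| < r ->
  `|f z - f x - dotv (grad f x) (z - x)| <= L * enorm (z - x) ^+ 2.
Proof.
move=> L0 HL zx; have [t /andP[t0 t1] ->] := mean_value f_diff x z.
set y := x + _.
have yx : y - x = t *: (z - x) by rewrite /y addrC addKr.
have -> : dotv (grad f y) (z - x) - dotv (grad f x) (z - x) =
          dotv (grad f y - grad f x) (z - x).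
  rewrite dotvDl; congr (_ + _).
  by rewrite /dotv -sumrN; apply: eq_bigr => i _; rewrite [in RHS]mxE mulNr.
apply: le_trans (dotv_le _ _) _; rewrite expr2 mulrA ler_wpM2r ?enorm_ge0//.
apply: le_trans (HL y _) _.
  rewrite yx normrZ ger0_norm//; apply: le_lt_trans zx.
  by rewrite ler_piMl.
by rewrite yx enormZ ger0_norm// ler_wpM2l// ler_piMl// enorm_ge0.
Qed.

End descent.

(** * Compactness, accumulation points and lower limits *)

Section compact_sets.
Context {R : realType} {d : nat}.
Implicit Types (x y z : 'rV[R]_d) (A K : set 'rV[R]_d).

Lemma nbhs_norm_lt x e : 0 < e -> nbhs x [set y | `|x - y| < e].
Proof. by move=> e0; apply: nbhs_norm_ex; exists e. Qed.

Lemma norm_ball_compact (M : R) : compact [set x : 'rV[R]_d | `|x| <= M].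
Proof.
apply: bounded_closed_compact.
  exists M; split; first exact: num_real.
  by move=> y My x /= /le_trans; apply; exact: ltW.
have -> : [set x : 'rV[R]_d | `|x| <= M] = Num.norm @^-1` [set y | y <= M] by [].
by apply: preimage_closed => [x _|]; [exact: norm_continuous|exact: closed_le].
Qed.

Lemma continuous_compact_bounded (g : 'rV[R]_d -> R) K :
  continuous g -> compact K -> exists2 B, 0 < B & forall x, K x -> `|g x| <= B.
Proof.
move=> cg cK; have : bounded_set (g @` K).
  apply: compact_bounded; apply: continuous_compact => //.
  exact: continuous_subspaceT.
move=> /ex_strict_bound_gt0[B B0 HB]; exists B => // x Kx.
by apply: ltW; apply: HB; exists x.
Qed.

Lemma edist_leP x A (r : R) : (edist_set x A <= r%:E)%E <->
  forall e, 0 < e -> exists2 y, A y & enorm (x - y) < r + e.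
Proof.
split=> [xA e e0|H].
  have /ereal_inf_ltP[_ [y Ay <-]] : (edist_set x A < (r + e)%:E)%E.
    by apply: le_lt_trans xA _; rewrite lte_fin ltrDl.
  by rewrite lte_fin; exists y.
apply/lee_addgt0Pr => e /H[y Ay xy]; apply: ge_ereal_inf.
by exists (enorm (x - y))%:E; [exists y|rewrite -EFinD lee_fin ltW].
Qed.

Lemma edist_nbhd_compact A (r : R) : (exists2 B, 0 < B & forall x, A x -> `|x| <= B) ->
  compact [set y | (edist_set y A <= r%:E)%E].
Proof.
move=> [B B0 AB]; apply: bounded_closed_compact.
  exists (r + 1 + B); split; first exact: num_real.
  move=> M lM x /= /edist_leP /(_ _ ltr01)[y Ay xy].
  apply: le_trans (ltW lM); rewrite -(subrK y x).
  apply: le_trans (ler_normD _ _) _; apply: lerD (AB _ Ay).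
  exact: le_trans (norm_le_enorm _) (ltW xy).
move=> x clx; apply/edist_leP => e e0.
have e20 : 0 < e / 2 by rewrite divr_gt0.
have [] := clx [set y | `|x - y| < e / 2 / (d%:R + 1)].
  by apply: nbhs_norm_lt; rewrite divr_gt0// ltr_wpDl.
move=> z [/edist_leP /(_ _ e20)[y Ay zy] /=].
rewrite ltr_pdivlMr ?ltr_wpDl// => xz; exists y => //.
have := enormD (x - z) (z - y); rewrite addrA subrK => h.
have : enorm (x - z) <= e / 2.
  apply: le_trans (enorm_le_norm _) _; apply: le_trans (ltW xz).
  by rewrite mulrC ler_wpM2l// lerDl.
lra.
Qed.

End compact_sets.

Lemma bounded_path_norm {R : realType} {d : nat} (x : nat -> 'rV[R]_d) :
  bounded_path x -> exists B, forall n, `|x n| <= B.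
Proof.
move=> bx; exists (fine (ereal_sup (range (fun n => (enorm (x n))%:E)))) => n.
have le_sup : ((enorm (x n))%:E <= ereal_sup (range (fun n => (enorm (x n))%:E)))%E.
  by apply: ereal_sup_ubound; exists n.
apply: le_trans (norm_le_enorm _) _; rewrite -lee_fin fineK//.
rewrite ge0_fin_numE//; apply: le_trans le_sup; rewrite lee_fin; exact: enorm_ge0.
Qed.

Section accumulation.
Context {R : realType} {d : nat}.
Variable x : nat -> 'rV[R]_d.
Variable B : R.
Hypothesis xB : forall n, `|x n| <= B.

Lemma acc_points_bounded y : acc_points x y -> `|y| <= B + 1.
Proof.
move=> cly; have [||z [[n _ <-] /= xy]] := cly (range x) [set z | `|y - z| < 1].
- by exists 0%N => // n _; exists n.
- exact: nbhs_norm_lt.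
rewrite -(subrK (x n) y); apply: le_trans (ler_normD _ _) _.
by have := xB n; lra.
Qed.

(** Otherwise the points of the path away from the accumulation points would,
    by compactness, have an accumulation point of their own. *)
Lemma near_acc_points e : 0 < e ->
  \forall n \near \oo, exists2 y, acc_points x y & `|x n - y| < e.
Proof.
move=> e0; have cK := @norm_ball_compact R d B.
have /compact_near_coveringP nc := cK.
have : \forall n \near \oo, [set z : 'rV[R]_d | `|z| <= B] `<=`
    [set z | x n = z -> exists2 y, acc_points x y & `|z - y| < e].
  apply: (nc _ \oo (fun n z => x n = z -> exists2 y, acc_points x y & `|z - y| < e)).
  move=> z _; have [az|naz] := pselect (acc_points x z).
    exists ([set z' | `|z - z'| < e], setT).
      by split; [exact: nbhs_norm_lt|exact: filterT].
    by move=> [z' n] [/= zz' _] _; exists z => //; rewrite distrC.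
  have [C [D [xC zD CD]]] : exists C D, [/\ (x @ \oo) C, nbhs z D &
      forall t, C t -> D t -> False].
    apply: contrapT => H; apply: naz => C D xC zD.
    apply: contrapT => CD; apply: H; exists C, D; split=> // t Ct Dt.
    by apply: CD; exists t.
  exists (D, [set n | C (x n)]); first by split.
  by move=> [z' n] /= [Dz' Cn] xz; exfalso; apply: CD Cn _; rewrite xz.
by apply: filterS => n /(_ (x n) (xB n) erefl).
Qed.

(** Compactness, applied to the filter of the subsequences along which g is
    close to l. *)
Lemma acc_points_value (g : 'rV[R]_d -> R) l : continuous g ->
  (forall e N, 0 < e -> exists2 n, (N <= n)%N & `|g (x n) - l| <= e) ->
  exists2 y, acc_points x y & g y = l.
Proof.
move=> cg gl.
pose G : set_system 'rV[R]_d := [set A | exists e N, 0 < e /\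
  forall n, (N <= n)%N -> `|g (x n) - l| <= e -> A (x n)].
have GF : ProperFilter G.
  apply: Build_ProperFilter_ex.
    move=> A [e [N [e0 HA]]]; have [n Nn gn] := gl e N e0.
    by exists (x n); exact: HA.
  split.
  - by exists 1, 0%N.
  - move=> A1 A2 [e1 [N1 [e10 H1]]] [e2 [N2 [e20 H2]]].
    exists (Num.min e1 e2), (maxn N1 N2); split; first by rewrite lt_min e10.
    move=> n; rewrite geq_max le_min => /andP[n1 n2] /andP[g1 g2].
    by split; [exact: H1|exact: H2].
  - move=> A1 A2 A12 [e [N [e0 H]]]; exists e, N; split=> // n Nn gn.
    exact/A12/H.
have GK : G [set z : 'rV[R]_d | `|z| <= B].
  by exists 1, 0%N; split=> // n _ _; exact: xB.
have [y [_ cly]] := @norm_ball_compact R d B G GF GK; exists y.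
  move=> A D [N _ xA] yD; apply: cly => //; exists 1, N; split=> // n Nn _.
  exact: xA.
apply/eqP; rewrite -subr_eq0 -normr_le0; apply/ler_addgt0Pr => e e0.
rewrite add0r leNgt; apply/negP => ge.
have /cvgrPdist_lt cgy := cg y.
have h0 : 0 < `|g y - l| - e by rewrite subr_gt0.
have [||z [/= gz gyz]] := cly [set z | `|g z - l| <= e]
    [set z | `|g y - g z| < `|g y - l| - e].
- by exists e, 0%N.
- exact: cgy.
have := ler_normD (g y - g z) (g z - l); rewrite addrA subrK; lra.
Qed.

End accumulation.

Section liminf.
Context {R : realType}.
Variables (u : nat -> R) (B : R).
Hypothesis uB : forall n, `|u n| <= B.

Let l := limn_einf (fun n => (u n)%:E).

Let limE : l = ereal_sup (range (einfs (fun n => (u n)%:E))).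
Proof. by rewrite /l limn_einf_lim; apply/cvg_lim => //; exact: cvg_einfs_sup. Qed.

Lemma limn_einf_fin : l \is a fin_num.
Proof.
have h1 : (l <= B%:E)%E.
  rewrite limE; apply: ge_ereal_sup => _ [n _ <-]; apply: ge_ereal_inf.
  exists (u n)%:E; first by exists n => /=.
  by rewrite lee_fin; apply: le_trans (uB n); exact: ler_norm.
have h2 : ((- B)%:E <= l)%E.
  rewrite limE; apply: le_ereal_sup_tmp; eexists; first by exists 0%N.
  apply: le_ereal_inf_tmp => _ [n _ <-]; rewrite lee_fin.
  by have := uB n; rewrite ler_norml => /andP[].
by rewrite fin_numElt (lt_le_trans _ h2) ?ltNyr// (le_lt_trans h1)// ltry.
Qed.

Lemma limn_einf_low e : 0 < e -> \forall n \near \oo, fine l - e <= u n.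
Proof.
move=> e0.
have /ereal_sup_gtP[_ [N _ <-] HN] :
    ((fine l - e)%:E < ereal_sup (range (einfs (fun n => (u n)%:E))))%E.
  rewrite -limE EFinB fineK ?limn_einf_fin// lteBlDr// lteDl//.
  exact: limn_einf_fin.
exists N => // n Nn; rewrite -lee_fin; apply: le_trans (ltW HN) _.
by apply: ereal_inf_lbound; exists n.
Qed.

Lemma limn_einf_freq e N : 0 < e -> exists2 n, (N <= n)%N & u n <= fine l + e.
Proof.
move=> e0.
have : (einfs (fun n => (u n)%:E) N < (fine l + e)%:E)%E.
  apply: le_lt_trans (_ : l < _)%E.
    by rewrite limE; apply: ereal_sup_ubound; exists N.
  rewrite EFinD fineK ?limn_einf_fin// lteDl//; exact: limn_einf_fin.
move=> /ereal_inf_ltP[_ [n /= Nn <-]]; rewrite lte_fin => /ltW.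
by exists n.
Qed.

End liminf.

(** * Gradient descent along a path with a vanishing error *)

Section perturbed_descent.
Context {R : realType} {d : nat}.
Variable f : 'rV[R]_d -> R.
Hypothesis f_diff : forall t, differentiable f t.
Hypothesis grad_lip : locally_lipschitz (grad f).
Variables (al ga : nat -> R) (th e : nat -> 'rV[R]_d).
Hypothesis al_gt0 : forall n, 0 < al n.
Hypothesis al_cvg0 : forall k, 0 < k -> \forall n \near \oo, al n <= k.
Hypothesis gaS : forall n, ga n.+1 = ga n + al n.
Hypothesis ga_oo : ga @ \oo --> +oo.
Variable B : R.
Hypothesis thB : forall n, `|th n| <= B.
Hypothesis step : forall n,
  th n.+1 - e n.+1 = th n - e n - al n *: grad f (th n).
Variables (s mu M del rho l : R).
Hypotheses (s0 : 0 < s) (mu1 : 1 < mu) (mu2 : mu <= 2) (M0 : 0 < M)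
  (del0 : 0 < del) (rho0 : 0 < rho) (smu : (2 - mu) * s <= 1).
Hypothesis e_small : forall k, 0 < k ->
  \forall n \near \oo, enorm (e n) <= k * ga n `^ (- s).
Hypothesis l_low : forall k, 0 < k -> \forall n \near \oo, l - k <= f (th n).
Hypothesis l_freq : forall k N, 0 < k -> exists2 n, (N <= n)%N & f (th n) <= l + k.
Hypothesis loja : forall t, (exists2 y, acc_points th y & enorm (t - y) <= rho) ->
  `|f t - l| <= del -> `|f t - l| <= M * enorm (grad f t) `^ mu.

(* x makes an exact step; the error enters only through the point at which
   the gradient is taken *)
Let x n := th n - e n.
Let G n := enorm (grad f (x n)) ^+ 2.
Let v n := f (x n) - l.

Lemma near_e_le k : 0 < k -> \forall n \near \oo, enorm (e n) <= k.
Proof.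
move=> k0; near=> n.
have h1 : enorm (e n) <= 1 * ga n `^ (- s) by near: n; exact: e_small.
have h2 : ga n `^ (- s) <= k by near: n; apply: near_powRN_le.
by rewrite mul1r in h1; apply: le_trans h2.
Unshelve. all: by end_near. Qed.

(** One Lipschitz constant and one gradient bound serve along the whole tail
    of the path, since it stays in a fixed ball. *)
Lemma tail_estimates : exists L Bg, [/\ 0 < L, 0 < Bg &
  \forall n \near \oo, [/\ enorm (grad f (th n)) <= Bg,
    enorm (grad f (x n)) <= Bg,
    enorm (grad f (th n) - grad f (x n)) <= L * enorm (e n),
    `|f (th n) - f (x n) - dotv (grad f (x n)) (e n)| <= L * enorm (e n) ^+ 2 &
    (enorm (grad f (x n.+1) - grad f (x n)) <= L * (al n * enorm (grad f (th n))) /\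
    `|f (x n.+1) - f (x n) - dotv (grad f (x n)) (- (al n *: grad f (th n)))|
       <= L * (al n * enorm (grad f (th n))) ^+ 2)]].
Proof.
have cK := @norm_ball_compact R d (B + 1).
have [L [L0 HL]] := locally_lipschitz_compact grad_lip cK.
have cg : continuous (fun z => enorm (grad f z)).
  move=> z; apply: continuous_comp; last exact: enorm_continuous.
  exact: locally_lipschitz_continuous.
have [Bg Bg0 HBg] := continuous_compact_bounded cg cK.
have gB z : `|z| <= B + 1 -> enorm (grad f z) <= Bg.
  by move=> /HBg; apply: le_trans; exact: ler_norm.
exists L, Bg; split=> //; near=> n.
have e1 : `|e n| <= 1.
  by apply: le_trans (norm_le_enorm _) _; near: n; exact: near_e_le.
have eL : `|e n| < L^-1.
  apply: le_lt_trans (norm_le_enorm _) _.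
  apply: (@le_lt_trans _ _ (L^-1 / 2)); last first.
    by rewrite ltr_pdivrMr// ltr_pMr ?invr_gt0// ltr1n.
  by near: n; apply: near_e_le; rewrite divr_gt0// invr_gt0.
have aL : al n * Bg < L^-1.
  apply: (@le_lt_trans _ _ (L^-1 / 2)); last first.
    by rewrite ltr_pdivrMr// ltr_pMr ?invr_gt0// ltr1n.
  rewrite -ler_pdivlMr//; near: n; apply: al_cvg0.
  by rewrite !divr_gt0// invr_gt0.
have Kx : `|x n| <= B + 1.
  apply: le_trans (ler_normB _ _) _; exact: lerD.
have thx : th n - x n = e n by rewrite /x opprB addrC subrK.
have xx : x n.+1 - x n = - (al n *: grad f (th n)).
  by rewrite /x step addrC addKr.
have Bth : enorm (grad f (th n)) <= Bg.
  by apply: gB; apply: le_trans (thB n) _; lra.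
have ex : enorm (x n.+1 - x n) = al n * enorm (grad f (th n)).
  by rewrite xx enormN enormZ gtr0_norm.
have xL : `|x n.+1 - x n| < L^-1.
  apply: le_lt_trans (norm_le_enorm _) _; rewrite ex; apply: le_lt_trans aL.
  by rewrite ler_wpM2l// ltW.
have lipx z : `|z - x n| < L^-1 ->
    enorm (grad f z - grad f (x n)) <= L * enorm (z - x n) by exact: HL.
have ty z := taylor_bound f_diff (ltW L0) lipx (z := z).
split=> //; first exact: gB.
- by have := lipx (th n); rewrite thx; exact.
- by have := ty (th n); rewrite thx; exact.
- split; first by have := lipx _ xL; rewrite ex.
  by have := ty _ xL; rewrite ex xx.
Unshelve. all: by end_near. Qed.

Let a := mu * s.
(* the exponent in G >= c |v|^q *)
Let q := 2 / mu.
Let a0 : 0 < a. Proof. by rewrite mulr_gt0//; have := mu1; lra. Qed.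
Let q1 : 1 <= q.
Proof. have mu1' := mu1; rewrite ler_pdivlMr; [by have := mu2; lra|lra]. Qed.
Let qaE : q * a = 2 * s.
Proof. by have mu1' := mu1; rewrite /q /a; field; lra. Qed.
Let qa : q * a <= a + 1.
Proof. by rewrite qaE /a; have := smu; lra. Qed.

Lemma sqr_powRN k n : 0 < k -> enorm (e n) <= k * ga n `^ (- s) ->
  enorm (e n) ^+ 2 <= k ^+ 2 * ga n `^ (- (q * a)).
Proof.
move=> k0 H.
have -> : - (q * a) = (- s) + (- s) by rewrite qaE; ring.
have [g0|g0] := leP (ga n `^ (- s)) 0.
  have e0 : enorm (e n) = 0.
    apply/eqP; rewrite eq_le enorm_ge0 andbT; apply: le_trans H _.
    by rewrite pmulr_rle0.
  by rewrite e0 expr0n/= mulr_ge0 ?sqr_ge0 ?powR_ge0.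
have gn0 : ga n != 0.
  by apply/negP => /eqP E; move: g0; rewrite E powR0 ?ltxx// oppr_eq0 gt_eqF.
rewrite powRD; last by rewrite gn0 implybT.
rewrite -expr2 -exprMn ler_sqr ?nnegrE ?enorm_ge0//.
exact: le_trans (enorm_ge0 _) H.
Qed.

Lemma sqr_e_small E k : 0 <= E -> 0 < k ->
  \forall n \near \oo, E * enorm (e n) ^+ 2 <= k * ga n `^ (- (q * a)).
Proof.
move=> E0 k0; pose c := Num.sqrt (k / (E + 1)).
have c0 : 0 < c by rewrite sqrtr_gt0 divr_gt0//; lra.
near=> n.
have /(sqr_powRN c0) h : enorm (e n) <= c * ga n `^ (- s).
  by near: n; exact: e_small.
have cc : c ^+ 2 = k / (E + 1).
  by rewrite sqr_sqrtr// divr_ge0 ?(ltW k0)//; lra.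
rewrite cc in h.
apply: le_trans (ler_wpM2l E0 h) _; rewrite mulrA ler_wpM2r ?powR_ge0//.
rewrite mulrCA ler_piMr ?(ltW k0)// ler_pdivrMr; lra.
Unshelve. all: by end_near. Qed.

(** Taylor expansions at x_n.  Replacing grad f(theta_n) by grad f(x_n) in the
    step costs, after Young's inequality, a fraction of G_n and a multiple of
    ||e_n||^2; the quadratic remainder is absorbed by alpha_n -> 0. *)
Lemma path_recursion : exists C E : R, (0 < C /\ 0 < E) /\ [/\
  (\forall n \near \oo, G n <= C),
  (\forall n \near \oo,
     v n.+1 <= v n - 2^-1 * al n * G n + al n * (E * enorm (e n) ^+ 2)),
  (\forall n \near \oo,
     G n - C * al n * (G n + E * enorm (e n) ^+ 2) <= G n.+1) &
  (\forall n \near \oo, enorm (grad f (th n)) ^+ 2 <= 2 * G n + E * enorm (e n) ^+ 2) /\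
  (\forall n \near \oo, `|f (th n) - f (x n)| <= G n + E * enorm (e n) ^+ 2) /\
  (\forall n \near \oo, `|f (th n) - f (x n)| <= C * enorm (e n) + E * enorm (e n) ^+ 2)].
Proof.
have [L [Bg [L0 Bg0 [N _ est]]]] := tail_estimates.
exists (3 * L + Bg ^+ 2 + Bg), (2 * L ^+ 2 + L + 1).
have L20 : 0 <= L ^+ 2 by exact: sqr_ge0.
have Bg20 : 0 <= Bg ^+ 2 by exact: sqr_ge0.
split; first by split; lra.
have hh n : enorm (grad f (th n) - grad f (x n)) <= L * enorm (e n) ->
    enorm (grad f (th n) - grad f (x n)) ^+ 2 <= L ^+ 2 * enorm (e n) ^+ 2.
  by move=> H; rewrite -exprMn ler_sqr ?nnegrE ?enorm_ge0// mulr_ge0 ?enorm_ge0// ltW.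
have h2 n : enorm (grad f (th n) - grad f (x n)) <= L * enorm (e n) ->
    enorm (grad f (th n)) ^+ 2 <= 2 * G n + 2 * L ^+ 2 * enorm (e n) ^+ 2.
  move=> /hh H.
  have := enormD (grad f (th n) - grad f (x n)) (grad f (x n)).
  rewrite subrK -ler_sqr ?nnegrE ?addr_ge0 ?enorm_ge0// => /le_trans; apply.
  rewrite -/(G n) sqrrD -/(G n).
  have : 0 <= (enorm (grad f (th n) - grad f (x n)) - enorm (grad f (x n))) ^+ 2.
    exact: sqr_ge0.
  rewrite sqrrB -/(G n); move: H; rewrite !mulr2n; lra.
split.
- near=> n.
  have Nn : (N <= n)%N by near: n; exists N.
  have [_ h _ _ _] := est n Nn.
  have : G n <= Bg ^+ 2 by rewrite ler_sqr ?nnegrE ?enorm_ge0// ltW.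
  lra.
- near=> n.
  have small : al n <= (8 * L)^-1 by near: n; apply: al_cvg0; rewrite invr_gt0; lra.
  have Nn : (N <= n)%N by near: n; exists N.
  have [_ _ lip _ [_ tay]] := est n Nn.
  have hn := hh n lip; have h2n := h2 n lip.
  have an := al_gt0 n.
  rewrite exprMn -scaleNr dotvZr in tay.
  have yo := @dotv_young R d (grad f (x n)) (grad f (th n) - grad f (x n)) 2^-1 ltac:(lra).
  rewrite invrK -/(G n) in yo.
  have dotE : dotv (grad f (x n)) (grad f (th n)) = G n +
     dotv (grad f (x n)) (grad f (th n) - grad f (x n)).
    by rewrite /G enorm_sqr_dot -dotvDr addrC subrK.
  rewrite dotE in tay.
  have G0 : 0 <= G n by exact: sqr_ge0.
  have e0 : 0 <= enorm (e n) ^+ 2 by exact: sqr_ge0.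
  have H20 : 0 <= enorm (grad f (th n)) ^+ 2 by exact: sqr_ge0.
  move: tay yo hn h2n e0 H20; rewrite !ler_norml /v.
  set D := dotv _ _; set E2 := enorm (e n) ^+ 2; set H2 := enorm (grad f (th n)) ^+ 2.
  set dh := enorm _ ^+ 2.
  clearbody D E2 H2 dh; move=> /andP[_ tay] yo hn h2n e0 H20.
  have yo' : - D <= G n / 4 + L ^+ 2 * E2.
    have := ler_norm (- D); rewrite normrN; lra.
  have aL : L * al n <= 8^-1.
    have := ler_wpM2l (ltW L0) small; rewrite invfM mulrCA divff ?gt_eqF//; lra.
  have k1 : L * (al n ^+ 2 * H2) <= 8^-1 * al n * (2 * G n + 2 * L ^+ 2 * E2).
    have -> : L * (al n ^+ 2 * H2) = (L * al n) * al n * H2 by ring.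
    apply: ler_pM => //; rewrite ?sqr_ge0 ?mulr_ge0 ?(ltW L0) ?(ltW an)//.
    by rewrite ler_wpM2r// ltW.
  have k2 := ler_wpM2l (ltW an) yo'.
  have k3 : 0 <= al n * L * E2 by rewrite !mulr_ge0 ?enorm_ge0 ?(ltW L0) ?(ltW an).
  have k4 : 0 <= al n * L ^+ 2 * E2 by rewrite !mulr_ge0 ?enorm_ge0 ?(ltW L0) ?(ltW an).
  have k5 : 0 <= al n * E2 by rewrite !mulr_ge0 ?enorm_ge0 ?(ltW L0) ?(ltW an).
  lra.
- near=> n.
  have Nn : (N <= n)%N by near: n; exists N.
  have [_ _ lip _ [glip _]] := est n Nn.
  have h2n := h2 n lip.
  have an := al_gt0 n.
  have := enormD (grad f (x n.+1)) (grad f (x n) - grad f (x n.+1)).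
  rewrite addrC subrK enormB => tri.
  have G0 : 0 <= G n by exact: sqr_ge0.
  have e0 : 0 <= enorm (e n) ^+ 2 by exact: sqr_ge0.
  have g0 := enorm_ge0 (grad f (x n)); have g10 := enorm_ge0 (grad f (x n.+1)).
  have hg0 := enorm_ge0 (grad f (th n)).
  move: tri glip h2n G0 e0 g0 g10 hg0; rewrite /G.
  set g := enorm (grad f (x n)); set g' := enorm (grad f (x n.+1)).
  set h := enorm (grad f (th n)); set E2 := enorm (e n) ^+ 2.
  clearbody g g' h E2; move=> tri glip h2n G0 e0 g0 g10 hg0.
  have low : g - L * (al n * h) <= g' by lra.
  have k1 : g ^+ 2 - 2 * (L * al n) * (g * h) <= g' ^+ 2.
    have [neg|pos] := leP g (L * (al n * h)).
      have := ler_wpM2l g0 neg.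
      have : 0 <= L * al n * (g * h) by rewrite !mulr_ge0 ?enorm_ge0 ?(ltW L0) ?(ltW an).
      have : 0 <= g' ^+ 2 by exact: sqr_ge0.
      rewrite expr2; lra.
    have : (g - L * (al n * h)) ^+ 2 <= g' ^+ 2.
      by rewrite ler_sqr ?nnegrE// subr_ge0 ltW.
    have : 0 <= (L * (al n * h)) ^+ 2 by exact: sqr_ge0.
    rewrite sqrrB mulr2n; lra.
  have k2 : 2 * (g * h) <= 3 * g ^+ 2 + 2 * L ^+ 2 * E2.
    have : 0 <= (g - h) ^+ 2 by exact: sqr_ge0.
    rewrite sqrrB mulr2n; lra.
  have La0 : 0 <= L * al n by rewrite mulr_ge0 ?(ltW L0) ?(ltW an).
  have k3 := ler_wpM2l La0 k2.
  have k4 : 0 <= L * al n * (L ^+ 2 * E2) by rewrite !mulr_ge0 ?enorm_ge0 ?(ltW L0) ?(ltW an).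
  have k5 : 0 <= L * al n * (L * E2) by rewrite !mulr_ge0 ?enorm_ge0 ?(ltW L0) ?(ltW an).
  have k6 : 0 <= L * al n * E2 by rewrite !mulr_ge0 ?enorm_ge0 ?(ltW L0) ?(ltW an).
  have k7 : 0 <= (Bg ^+ 2 + Bg) * al n * (g ^+ 2 + (2 * L ^+ 2 + L + 1) * E2).
    have p1 : 0 <= Bg ^+ 2 + Bg by apply: addr_ge0 => //; exact: ltW.
    have p2 : 0 <= 2 * L ^+ 2 + L + 1 by lra.
    apply: mulr_ge0; first by apply: mulr_ge0 p1 (ltW an).
    by apply: addr_ge0 => //; exact: mulr_ge0.
  lra.
- split; [|split]; near=> n.
  + have Nn : (N <= n)%N by near: n; exists N.
    have [_ _ lip _ _] := est n Nn.
    have e0 : 0 <= enorm (e n) ^+ 2 by exact: sqr_ge0.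
    have := mulr_ge0 (ltW L0) e0; have := h2 n lip; lra.
  + have Nn : (N <= n)%N by near: n; exists N.
    have [_ _ _ tay _] := est n Nn.
    have yo := @dotv_young R d (grad f (x n)) (e n) 1 ltr01.
    have G0 : 0 <= G n by exact: sqr_ge0.
    have e0 : 0 <= enorm (e n) ^+ 2 by exact: sqr_ge0.
    have Le : 0 <= L ^+ 2 * enorm (e n) ^+ 2 by exact: mulr_ge0.
    have := ler_normD (f (th n) - f (x n) - dotv (grad f (x n)) (e n))
      (dotv (grad f (x n)) (e n)); rewrite subrK.
    move: yo; rewrite invr1 -/(G n); lra.
  + have Nn : (N <= n)%N by near: n; exists N.
    have [_ gB _ tay _] := est n Nn.
    have cs := dotv_le (grad f (x n)) (e n).
    have e0 : 0 <= enorm (e n) ^+ 2 by exact: sqr_ge0.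
    have Le : 0 <= L ^+ 2 * enorm (e n) ^+ 2 by exact: mulr_ge0.
    have en0 := enorm_ge0 (e n).
    have gBe := ler_wpM2r en0 gB.
    have Le0 := mulr_ge0 (ltW L0) en0; have Be0 := mulr_ge0 Bg20 en0.
    have := ler_normD (f (th n) - f (x n) - dotv (grad f (x n)) (e n))
      (dotv (grad f (x n)) (e n)); rewrite subrK.
    lra.
Unshelve. all: by end_near. Qed.

(** The Lojasiewicz inequality raised to the power 2 / mu.  It applies at x_n,
    which is eventually within rho of an accumulation point of theta. *)
Lemma path_loja : \forall n \near \oo, `|v n| <= del ->
  M `^ (- q) * `|v n| `^ q <= G n.
Proof.
near=> n => vd.
have [y ay xy] : exists2 y, acc_points th y & `|th n - y| < rho / 2 / (d%:R + 1).
  near: n; apply: near_acc_points thB _ _.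
  by rewrite !divr_gt0// ltr_wpDl.
have er : enorm (e n) <= rho / 2 by near: n; apply: near_e_le; rewrite divr_gt0.
have txy : enorm (x n - y) <= rho.
  have -> : x n - y = (th n - y) + (- e n) by rewrite /x addrAC.
  apply: le_trans (enormD _ _) _; rewrite enormN.
  suff : enorm (th n - y) <= rho / 2 by lra.
  apply: le_trans (enorm_le_norm _) _; move: xy.
  rewrite ltr_pdivlMr ?ltr_wpDl// => /ltW; apply: le_trans.
  by rewrite mulrC ler_wpM2l// lerDl.
have vM := loja (ex_intro2 _ _ y ay txy) vd; rewrite -/(v n) in vM.
have mu0 : mu != 0 by rewrite gt_eqF//; have := mu1; lra.
have q0 : 0 <= q by have := q1; lra.
have : `|v n| `^ q <= (M * enorm (grad f (x n)) `^ mu) `^ q.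
  by apply: ge0_ler_powR; rewrite // nnegrE mulr_ge0 ?powR_ge0 ?ltW.
rewrite powRM ?powR_ge0 ?(ltW M0)// -powRrM [mu * q]mulrC divfK//.
rewrite -[2]/(2%:R) powR_mulrn ?enorm_ge0// -/(G n) => H.
have Mq0 : 0 < M `^ q by exact: powR_gt0.
by rewrite powRN mulrC ler_pdivrMr// mulrC.
Unshelve. all: by end_near. Qed.

Lemma path_small k : 0 < k -> \forall n \near \oo, `|f (th n) - f (x n)| <= k.
Proof.
move=> k0; have [C [E [[C0 E0] [_ _ _ [_ [_ H]]]]]] := path_recursion.
near=> n; have h : `|f (th n) - f (x n)| <= C * enorm (e n) + E * enorm (e n) ^+ 2.
  by near: n; exact: H.
have e1 : enorm (e n) <= 1 by near: n; exact: near_e_le.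
have e2 : enorm (e n) <= k / (C + E).
  by near: n; apply: near_e_le; rewrite divr_gt0// addr_gt0.
rewrite ler_pdivlMr ?addr_gt0// in e2.
have e3 : enorm (e n) ^+ 2 <= enorm (e n).
  by rewrite expr2 ler_piMl ?enorm_ge0.
have := ler_wpM2l (ltW E0) e3; lra.
Unshelve. all: by end_near. Qed.

(** A rate for f along x bounds the gradient at x, and ||e_n||^2 is of smaller
    order, so both rates pass to theta. *)
Lemma path_rate_transfer : exists D, 0 < D /\ forall k, 0 < k ->
  (\forall n \near \oo, `|v n| <= k * ga n `^ (- a)) ->
  \forall n \near \oo, enorm (grad f (th n)) ^+ 2 <= D * k * ga n `^ (- a) /\
    `|f (th n) - l| <= D * k * ga n `^ (- a).
Proof.
have [C [E [[C0 E0] [GB rec Grec [hG [hf _]]]]]] := path_recursion.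
have eps_a k : 0 < k -> \forall n \near \oo, E * enorm (e n) ^+ 2 <= k * ga n `^ (- a).
  move=> k0; near=> n; have h : E * enorm (e n) ^+ 2 <= k * ga n `^ (- (q * a)).
    by near: n; apply: sqr_e_small => //; exact: ltW.
  apply: le_trans h _; rewrite ler_wpM2l ?(ltW k0)//; apply: ler_powR.
    by near: n; exact: near_gamma_ge.
  by rewrite lerN2 ler_peMl ?(ltW a0).
pose D0 := 2 * ((C + 1) / 2^-1) + (C + 1) / 2^-1 + C + 1.
have D00 : 0 < D0 by rewrite /D0; lra.
exists (2 * D0 + 2); split=> [|k k0 vk]; first by lra.
have Gk : \forall n \near \oo, G n <= D0 * k * ga n `^ (- a).
  apply: (@recursion_gradient R al ga v G (fun n => E * enorm (e n) ^+ 2) 2^-1 C a C) => //.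
  - lra.
  - exact: eps_a.
near=> n.
have h1 : G n <= D0 * k * ga n `^ (- a) by near: n.
have h2 : E * enorm (e n) ^+ 2 <= k * ga n `^ (- a) by near: n; exact: eps_a.
have h3 : `|v n| <= k * ga n `^ (- a) by near: n.
have h4 : enorm (grad f (th n)) ^+ 2 <= 2 * G n + E * enorm (e n) ^+ 2 by near: n.
have h5 : `|f (th n) - f (x n)| <= G n + E * enorm (e n) ^+ 2 by near: n.
have p0 : 0 <= D0 * k * ga n `^ (- a) by rewrite !mulr_ge0 ?powR_ge0 ?ltW.
have p1 : 0 <= k * ga n `^ (- a) by rewrite !mulr_ge0 ?powR_ge0 ?ltW.
split; first by lra.
have := ler_normD (f (th n) - f (x n)) (v n); rewrite /v addrA subrK -/(v n); lra.
Unshelve. all: by end_near. Qed.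

Let v_low k : 0 < k -> \forall n \near \oo, - k <= v n.
Proof.
move=> k0; near=> n.
have h1 : l - k / 2 <= f (th n) by near: n; apply: l_low; rewrite divr_gt0.
have h2 : `|f (th n) - f (x n)| <= k / 2 by near: n; apply: path_small; rewrite divr_gt0.
move: h2; rewrite /v ler_norml; lra.
Unshelve. all: by end_near. Qed.

Let v_freq k N : 0 < k -> exists2 n, (N <= n)%N & v n <= k.
Proof.
move=> k0; have k20 : 0 < k / 2 by rewrite divr_gt0.
have [N' _ HN'] := path_small k20.
have [n Nn fn] := l_freq (maxn N N') k20.
exists n; first by apply: leq_trans Nn; exact: leq_maxl.
have := HN' n (leq_trans (leq_maxr _ _) Nn); rewrite /= /v ler_norml; lra.
Qed.

Theorem path_rate_o : (2 - mu) * s < 1 -> forall k, 0 < k ->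
  \forall n \near \oo, enorm (grad f (th n)) ^+ 2 <= k * ga n `^ (- a) /\
    `|f (th n) - l| <= k * ga n `^ (- a).
Proof.
move=> smu' k k0; have [D [D0 HD]] := path_rate_transfer.
have -> : k = D * (k / D) by rewrite mulrC divfK// gt_eqF.
have kD0 : 0 < k / D by rewrite divr_gt0.
apply: (HD _ kD0).
have [C [E [[C0 E0] [GB rec Grec _]]]] := path_recursion.
apply: (@recursion_o R al ga v G (fun n => E * enorm (e n) ^+ 2) 2^-1 (M `^ (- q)) a q del) => //.
- exact: powR_gt0.
- by move=> n; rewrite mulr_ge0 ?sqr_ge0// ltW.
- by move=> y y0; apply: sqr_e_small => //; exact: ltW.
- by move=> n; exact: sqr_ge0.
- exact: path_loja.
- by rewrite qaE /a; lra.
Qed.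

Theorem path_rate_O : mu < 2 -> exists2 k, 0 < k &
  \forall n \near \oo, enorm (grad f (th n)) ^+ 2 <= k * ga n `^ (- a) /\
    `|f (th n) - l| <= k * ga n `^ (- a).
Proof.
move=> mu2'; have [D [D0 HD]] := path_rate_transfer.
have [C [E [[C0 E0] [GB rec Grec _]]]] := path_recursion.
have [] := @recursion_O R al ga v G (fun n => E * enorm (e n) ^+ 2) 2^-1 (M `^ (- q)) a q del => //.
- exact: powR_gt0.
- by move=> n; rewrite mulr_ge0 ?sqr_ge0// ltW.
- by move=> y y0; apply: sqr_e_small => //; exact: ltW.
- by move=> n; exact: sqr_ge0.
- exact: path_loja.
- by have mu1' := mu1; rewrite ltr_pdivlMr; lra.
move=> k k0 /(HD _ k0) H; exists (D * k) => //; exact: mulr_gt0.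
Qed.

End perturbed_descent.

(** * Step sizes, weights and Abel summation *)

Section series_lemmas.
Context {R : realType}.
Implicit Types (u v a d : nat -> R).

(** Replacing every d_i by the last one, d_m, changes the sum by at most the
    total decrease d_n - d_m times the bound e on the partial sums. *)
Lemma abel_inequality d a (n m : nat) e :
  (forall i, (n <= i)%N -> 0 <= d i.+1 <= d i) ->
  (forall k, (n <= k)%N -> `|\sum_(n <= i < k) a i| <= e) ->
  (n <= m)%N -> `|\sum_(n <= i < m) d i * a i| <= d n * e.
Proof.
move=> dn ae nm.
have dm : 0 <= d m /\ `|\sum_(n <= i < m) d i * a i - d m * \sum_(n <= i < m) a i|
    <= (d n - d m) * e.
  elim: m nm => [|m IH].
    rewrite leqn0 => /eqP n0; rewrite n0 !big_nil mulr0 !subrr mul0r normr0; split=> //.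
    by have /andP[d1 d2] := dn 0%N ltac:(by rewrite n0); apply: le_trans d2.
  rewrite leq_eqVlt => /predU1P[<-|].
    rewrite !big_geq// mulr0 !subrr mul0r normr0; split=> //.
    by have /andP[d1 d2] := dn n (leqnn n); apply: le_trans d2.
  rewrite ltnS => nm; have [dm0 H] := IH nm.
  have /andP[d1 d2] := dn m nm; split=> //.
  have aS := ae m.+1 (leqW nm).
  rewrite big_nat_recr//=.
  have -> : \sum_(n <= i < m) d i * a i + d m * a m - d m.+1 * \sum_(n <= i < m.+1) a i
    = (\sum_(n <= i < m) d i * a i - d m * \sum_(n <= i < m) a i) +
      (d m - d m.+1) * \sum_(n <= i < m.+1) a i.
    by rewrite big_nat_recr//=; ring.
  apply: le_trans (ler_normD _ _) _; rewrite normrM (ger0_norm (_ : 0 <= d m - d m.+1)) ?subr_ge0//.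
  have := ler_wpM2l (_ : 0 <= d m - d m.+1) aS; rewrite subr_ge0 => /(_ d2).
  lra.
have {dm}[dm0 H] := dm.
have := ler_normD (\sum_(n <= i < m) d i * a i - d m * \sum_(n <= i < m) a i)
   (d m * \sum_(n <= i < m) a i).
rewrite subrK normrM (ger0_norm dm0).
have := ler_wpM2l dm0 (ae m nm); lra.
Qed.

Definition bounded_series u := exists C, forall n, series u n <= C.

Lemma bounded_series_cvg u : (forall n, 0 <= u n) -> bounded_series u ->
  cvgn (series u).
Proof.
move=> u0 [C uC]; apply: nondecreasing_is_cvgn.
  by apply: nondecreasing_series => n _ _; exact: u0.
by exists C => _ [n _ <-]; exact: uC.
Qed.

Lemma bounded_series_near_le u v : (forall n, 0 <= u n) -> (forall n, 0 <= v n) ->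
  (\forall n \near \oo, u n <= v n) -> bounded_series v -> bounded_series u.
Proof.
move=> u0 v0 [N _ uv] [C vC]; exists (series u N + C) => n.
have [nN|Nn] := leqP n N.
  apply: le_trans (_ : series u N <= _).
    by rewrite -subr_ge0 sub_series_geq// sumr_ge0.
  by rewrite lerDl; apply: le_trans (vC 0%N); rewrite /series/= big_geq.
rewrite -lerBlDl sub_series_geq ?(ltnW Nn)//.
apply: le_trans (vC n); rewrite {1}/series/= (big_cat_nat (leq0n N) (ltnW Nn))/=.
apply: le_trans (_ : \sum_(N <= k < n) v k <= _); last first.
  by rewrite lerDr sumr_ge0.
by rewrite big_nat_cond [leRHS]big_nat_cond; apply: ler_sum => i /andP[/andP[Ni _] _]; exact: uv.
Qed.

Lemma bounded_seriesD u v : bounded_series u -> bounded_series v ->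
  bounded_series (fun n => u n + v n).
Proof.
move=> [C uC] [D vD]; exists (C + D) => n.
have -> : series (fun n => u n + v n) n = series u n + series v n.
  by rewrite /series/= big_split.
exact: lerD.
Qed.

Lemma bounded_seriesZ u k : 0 <= k -> bounded_series u ->
  bounded_series (fun n => k * u n).
Proof.
move=> k0 [C uC]; exists (k * C) => n.
have -> : series (fun n => k * u n) n = k * series u n.
  by rewrite /series/= mulr_sumr.
exact: ler_wpM2l.
Qed.

Lemma bounded_series_shift u : (forall n, 0 <= u n) -> bounded_series u ->
  bounded_series (fun n => u n.+1).
Proof.
move=> u0 [C uC]; exists C => n; apply: le_trans (uC n.+1).
rewrite /series/= big_nat_recl//= lerDr; exact: u0.
Qed.

Lemma bounded_series_ereal u : (forall n, 0 <= u n) ->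
  (\sum_(0 <= n <oo) (u n)%:E < +oo)%E -> bounded_series u.
Proof.
move=> u0 fin.
have S0 : (0 <= \sum_(0 <= n <oo) (u n)%:E)%E.
  by apply: nneseries_ge0 => n _ _; rewrite lee_fin.
exists (fine (\sum_(0 <= n <oo) (u n)%:E)%E) => n.
rewrite -lee_fin fineK ?ge0_fin_numE// /series/= -sumEFin.
by apply: nneseries_lim_ge => k _ _; rewrite lee_fin.
Qed.

End series_lemmas.

Section steps.
Context {R : realType}.
Variables (al : nat -> R) (r : R).
Hypothesis al_gt0 : forall n, 0 < al n.
Hypothesis r_gt0 : 0 < r.
Hypothesis al_cvg0 : al @ \oo --> 0.
Hypothesis al_sum : (\sum_(0 <= n <oo) (al n)%:E = +oo)%E.
Hypothesis al_inv :
  (limn_esup (fun n => `|(al n.+1)^-1 - (al n)^-1|%:E) < +oo)%E.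
Hypothesis al_ga :
  (\sum_(0 <= n <oo) (al n ^+ 2 * series al n `^ (2 * r))%:E < +oo)%E.
Let ga := series al.

Lemma gammaS n : ga n.+1 = ga n + al n.
Proof. by rewrite /ga /series/= big_nat_recr. Qed.

Lemma gamma_cvgy : ga @ \oo --> +oo.
Proof.
have [|c] := pselect (cvgn ga); last first.
  apply: nondecreasing_dvgn_lt => //.
  by apply: nondecreasing_series => n _ _; exact: ltW.
move=> /cvg_ex[l gl]; exfalso.
have : (\sum_(0 <= i < n) (al i)%:E)%E @[n --> \oo] --> l%:E.
  under eq_fun do rewrite sumEFin.
  by apply: cvg_EFin => //; exact: nearW.
by move=> /(cvg_lim (@ereal_hausdorff R)); rewrite al_sum.
Qed.

Lemma near_alpha_le k : 0 < k -> \forall n \near \oo, al n <= k.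
Proof.
move=> k0; move/cvgrPdist_le: al_cvg0 => /(_ k k0); apply: filterS => n.
by rewrite sub0r normrN gtr0_norm.
Qed.

Lemma alpha_inv_bounded : exists2 B, 0 < B &
  \forall n \near \oo, `|(al n.+1)^-1 - (al n)^-1| <= B.
Proof.
have fin_sup := al_inv.
set u := fun n => `|(al n.+1)^-1 - (al n)^-1|%:E in fin_sup.
have ul : limn_esup u = ereal_inf (range (esups u)).
  by rewrite limn_esup_lim; apply/cvg_lim => //; exact: cvg_esups_inf.
move: fin_sup; rewrite ul => /ereal_inf_ltP[_ [N _ <-] HN].
have bd n : (N <= n)%N -> (u n <= esups u N)%E.
  by move=> Nn; apply: ereal_sup_ubound; exists n.
have fin : esups u N \is a fin_num.
  rewrite ge0_fin_numE//; apply: le_trans (bd N (leqnn N)).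
  by rewrite lee_fin.
exists (fine (esups u N) + 1).
  rewrite ltr_wpDl// fine_ge0//; apply: le_trans (bd N (leqnn N)).
  by rewrite lee_fin.
exists N => // n /= Nn; apply: le_trans (_ : fine (esups u N) <= _); last by rewrite lerDl.
by rewrite -lee_fin fineK//; exact: bd.
Qed.

Definition weight n := al n * ga n `^ r.

Lemma weight_ge0 n : 0 <= weight n.
Proof. by rewrite mulr_ge0 ?powR_ge0 ?ltW. Qed.

Lemma weight0 : weight 0 = 0.
Proof. by rewrite /weight /ga /series/= big_geq// powR0 ?mulr0// gt_eqF. Qed.

Lemma gamma_ge0 n : 0 <= ga n.
Proof. by rewrite /ga /series/= sumr_ge0// => i _; exact: ltW. Qed.

Lemma gamma_mono n m : (n <= m)%N -> ga n <= ga m.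
Proof. by move=> nm; rewrite -subr_ge0 sub_series_geq// sumr_ge0// => i _; exact: ltW. Qed.

Lemma weight_sqr_bounded : bounded_series (fun n => weight n ^+ 2).
Proof.
apply: bounded_series_ereal; first by move=> n; exact: sqr_ge0.
move: al_ga; congr (_ < _)%E; congr (limn _); apply: funext => n.
apply: eq_bigr => i _; congr EFin; rewrite /weight exprMn; congr (_ * _).
by rewrite mulrC powRrM powR_mulrn// powR_ge0.
Qed.

(** Bounded increments of 1 / alpha make consecutive steps comparable, and the
    increments of alpha quadratic in the step. *)
Lemma near_step : exists2 B, 0 < B & \forall n \near \oo,
  [/\ al n <= 2 * al n.+1, `|al n.+1 - al n| <= B * al n * al n.+1 ,
      1 <= ga n & ga n.+1 <= 2 * ga n].
Proof.
have [B B0 HB] := alpha_inv_bounded; exists B => //; near=> n.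
have h : `|(al n.+1)^-1 - (al n)^-1| <= B by near: n.
have a0 := al_gt0 n; have a1 := al_gt0 n.+1.
have E : `|al n.+1 - al n| = al n * al n.+1 * `|(al n.+1)^-1 - (al n)^-1|.
  rewrite -[X in X * `|_|]gtr0_norm ?mulr_gt0// -normrM distrC; congr (`| _ |).
  by field; rewrite !gt_eqF.
have aa : 0 <= al n * al n.+1 by rewrite mulr_ge0 ?ltW.
have d : `|al n.+1 - al n| <= B * al n * al n.+1.
  have -> : B * al n * al n.+1 = al n * al n.+1 * B by ring.
  by rewrite E ler_wpM2l.
have g1 : 1 <= ga n by near: n; apply: near_gamma_ge; exact: gamma_cvgy.
have small : al n <= B^-1 by near: n; apply: near_alpha_le; rewrite invr_gt0.
have small1 : al n <= 1 by near: n; exact: near_alpha_le.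
split=> //; last by rewrite gammaS; lra.
move: d; rewrite ler_norml => /andP[d _].
have : B * al n * al n.+1 <= al n.+1.
  by rewrite ler_piMl ?(ltW a1)// mulrC -ler_pdivlMr// div1r.
lra.
Unshelve. all: by end_near. Qed.

Lemma powR_increment t u : 0 < t -> t <= u ->
  u `^ r - t `^ r <= r * u `^ r * ((u - t) / t).
Proof.
move=> t0 tu; have u0 : 0 < u by lra.
have ut : 0 < u / t by rewrite divr_gt0.
have tE : t = u * (u / t)^-1 by field; lra.
have r0 := r_gt0.
rewrite [in t `^ r]tE powRM ?(ltW u0) ?invr_ge0 ?(ltW ut)//.
have : 1 - r * (u / t - 1) <= (u / t)^-1 `^ r.
  rewrite /powR gt_eqF ?invr_gt0// lnV ?posrE//.
  apply: le_trans (expR_ge1Dx _); have := ler_wpM2l (ltW r0) (ln_le_subr1 ut); lra.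
move=> /(ler_wpM2l (powR_ge0 u r)).
have -> : (u - t) / t = u / t - 1 by field; lra.
lra.
Qed.

(** Both factors of the weight change by a relative amount O(alpha_n), so the
    increments are dominated by alpha_n times the weight, hence by the squares
    of the weights as gamma_n >= 1. *)
Lemma weight_increment_bounded : bounded_series (fun n => `|weight n.+1 - weight n|).
Proof.
have [B B0 HB] := near_step.
apply: (bounded_series_near_le _ _ _
  (bounded_seriesZ (_ : 0 <= 2 * B + 4 * r) (bounded_series_shift _ weight_sqr_bounded))).
- by [].
- by move=> n; rewrite mulr_ge0 ?sqr_ge0//; have := r_gt0; lra.
- near=> n.
  have [a2 d g1 g2] : [/\ al n <= 2 * al n.+1, `|al n.+1 - al n| <= B * al n * al n.+1 ,
      1 <= ga n & ga n.+1 <= 2 * ga n] by near: n.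
  have a0 := al_gt0 n; have a1 := al_gt0 n.+1.
  have gs := gammaS n; have r0 := r_gt0.
  have inc : ga n.+1 `^ r - ga n `^ r <= r * ga n.+1 `^ r * al n.
    apply: le_trans (powR_increment _ _) _; [lra|lra|].
    rewrite ler_wpM2l ?mulr_ge0 ?powR_ge0 ?(ltW r0)//.
    rewrite ler_pdivrMr; last by lra.
    rewrite gs addrC addKr ler_peMr ?(ltW a0)//.
  have mono : ga n `^ r <= ga n.+1 `^ r.
    by apply: ge0_ler_powR; rewrite ?nnegrE ?(ltW r0) ?gamma_ge0// gs; lra.
  have P1 : 1 <= ga n.+1 `^ r.
    by rewrite -(powRr0 (ga n.+1)); apply: ler_powR; rewrite ?(ltW r0)//; lra.
  set p := ga n `^ r in inc mono *; set P := ga n.+1 `^ r in inc mono P1 *.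
  have -> : weight n.+1 ^+ 2 = al n.+1 ^+ 2 * P * P.
    by rewrite /weight -/P; ring.
  have -> : weight n.+1 - weight n = (al n.+1 - al n) * P + al n * (P - p).
    by rewrite /weight -/P -/p; ring.
  apply: le_trans (ler_normD _ _) _; rewrite !normrM.
  rewrite (gtr0_norm a0) (ger0_norm (_ : 0 <= P)); last by lra.
  rewrite (ger0_norm (_ : 0 <= P - p)); last by lra.
  have P0 : 0 <= P by lra.
  have t1 : `|al n.+1 - al n| * P <= 2 * B * (al n.+1 ^+ 2 * P).
    rewrite !mulrA ler_wpM2r//; apply: le_trans d _.
    have -> : 2 * B * al n.+1 * al n.+1 = B * (2 * al n.+1) * al n.+1 by ring.
    by rewrite ler_wpM2r ?(ltW a1)// ler_wpM2l ?(ltW B0).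
  have t2 : al n * (P - p) <= 4 * r * (al n.+1 ^+ 2 * P).
    apply: le_trans (ler_wpM2l (ltW a0) inc) _.
    have -> : al n * (r * P * al n) = (r * P) * (al n ^+ 2) by ring.
    have -> : 4 * r * (al n.+1 ^+ 2 * P) = (r * P) * ((2 * al n.+1) ^+ 2) by ring.
    rewrite ler_wpM2l ?mulr_ge0 ?(ltW r0)// ler_sqr ?nnegrE ?mulr_ge0 ?(ltW a0) ?(ltW a1)//.
  apply: le_trans (lerD t1 t2) _; rewrite -mulrDl ler_wpM2l//; first by lra.
  by rewrite ler_peMr// mulr_ge0 ?sqr_ge0.
- by have := r_gt0; lra.
- by move=> n; exact: sqr_ge0.
Unshelve. all: by end_near. Qed.

(** Comparison with the telescoping series of 1 / gamma_n. *)
Lemma gamma_sqr_bounded : bounded_series (fun n => al n / ga n ^+ 2).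
Proof.
have [B B0 [N _ HN]] := near_step.
have gN0 : 0 < ga N by have [_ _ g1 _] := HN N (leqnn N); lra.
pose v n := if (n < N)%N then 0 else 2 * ((ga n)^-1 - (ga n.+1)^-1).
have v0 n : 0 <= v n.
  rewrite /v; case: ltnP => // Nn; rewrite mulr_ge0// subr_ge0.
  have gn := gamma_mono Nn.
  by rewrite lef_pV2 ?posrE ?gammaS; have := al_gt0 n; lra.
apply: (bounded_series_near_le _ v0).
- by move=> n; rewrite divr_ge0 ?sqr_ge0// ltW.
- exists N => // n /= Nn; rewrite /v ltnNge Nn/=.
  have [_ _ g1 g2] := HN n Nn; have a0 := al_gt0 n.
  have g0 : 0 < ga n by lra.
  have -> : 2 * ((ga n)^-1 - (ga n.+1)^-1) = al n * (2 / (ga n * ga n.+1)).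
    by rewrite gammaS; field; rewrite !gt_eqF//; lra.
  rewrite ler_wpM2l ?(ltW a0)// ler_pdivlMr; last by rewrite mulr_gt0// gammaS; lra.
  rewrite mulrC ler_pdivrMr ?exprn_gt0// expr2 [2 * _]mulrCA ler_wpM2l// ltW//.
- exists (2 / ga N) => n.
  have [nN|Nn] := leqP n N.
    rewrite /series/= big_nat_cond big1 ?divr_ge0 ?(ltW gN0)// => i /andP[/andP[_ iN] _].
    by rewrite /v (leq_trans iN nN).
  rewrite /series/= (big_cat_nat (leq0n N) (ltnW Nn))/= big_nat_cond big1; last first.
    by move=> i /andP[/andP[_ iN] _]; rewrite /v iN.
  rewrite add0r.
  have -> : \sum_(N <= i < n) v i = - (2 * \sum_(N <= i < n) ((ga i.+1)^-1 - (ga i)^-1)).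
    rewrite mulr_sumr -sumrN big_nat_cond [RHS]big_nat_cond.
    by apply: eq_bigr => i /andP[/andP[Ni _] _]; rewrite /v ltnNge Ni/=; ring.
  rewrite telescope_sumr ?(ltnW Nn)//.
  have : 0 <= (ga n)^-1 by rewrite invr_ge0 gamma_ge0.
  lra.
Qed.

(** The Hoelder exponent s for which the weighted variation of the kernel
    average is summable: Young's inequality splits
    al^(1+s) ga^r = (al^2 ga^(2r))^s (al ga^-(2+2r))^(1-s). *)
Definition hexp : R := 1 - r / (2 + 4 * r).

Lemma hexp_range : 0 < hexp < 1.
Proof.
have r0 := r_gt0; have h : 0 < r / (2 + 4 * r) by rewrite divr_gt0//; lra.
have h2 : r / (2 + 4 * r) < 1 by rewrite ltr_pdivrMr; lra.
rewrite /hexp; apply/andP; split; lra.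
Qed.

Lemma young_powR (x y s : R) : 0 <= x -> 0 <= y -> 0 < s < 1 ->
  x `^ s * y `^ (1 - s) <= x + y.
Proof.
move=> x0 y0 /andP[s0 s1]; have s10 : 0 < 1 - s by rewrite subr_gt0.
have := @conjugate_powR R (x `^ s) (y `^ (1 - s)) s^-1 (1 - s)^-1
  (powR_ge0 _ _) (powR_ge0 _ _).
rewrite !invr_gt0 => /(_ s0 s10); rewrite !invrK -!powRrM !divff ?gt_eqF//.
rewrite !powRr1// => H; apply: le_trans (H _) _; first by ring.
by apply: lerD; rewrite ler_piMr// ltW//; lra.
Qed.

Lemma weight_hexp_bounded : bounded_series (fun n => weight n.+1 * al n `^ hexp).
Proof.
have [B B0 HB] := near_step; have /andP[s0 s1] := hexp_range; have r0 := r_gt0.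
have V0 n : 0 <= weight n.+1 ^+ 2 + al n.+1 / ga n.+1 ^+ 2.
  by rewrite addr_ge0 ?divr_ge0 ?sqr_ge0// ltW.
apply: (bounded_series_near_le _ _ _ (bounded_seriesZ (_ : 0 <= 2)
   (bounded_seriesD (bounded_series_shift _ weight_sqr_bounded)
                    (bounded_series_shift _ gamma_sqr_bounded)))) => //.
- by move=> n; rewrite mulr_ge0 ?weight_ge0 ?powR_ge0.
- by move=> n; rewrite mulr_ge0.
- near=> n.
  have [a2 _ g1 g2] : [/\ al n <= 2 * al n.+1, `|al n.+1 - al n| <= B * al n * al n.+1 ,
      1 <= ga n & ga n.+1 <= 2 * ga n] by near: n.
  have a0 := al_gt0 n; have a1 := al_gt0 n.+1.
  have gs := gammaS n.
  have G1 : 1 <= ga n.+1 by lra.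
  have G0 : 0 < ga n.+1 by lra.
  set a := al n.+1 in a1 a2 *; set g := ga n.+1 in G1 G0 *.
  have h1 : al n `^ hexp <= 2 * a `^ hexp.
    apply: le_trans (_ : (2 * a) `^ hexp <= _).
      by apply: ge0_ler_powR; rewrite ?nnegrE ?mulr_ge0 ?(ltW a0) ?(ltW s0) ?(ltW a1).
    rewrite powRM ?(ltW a1)// ler_wpM2r ?powR_ge0//.
    by apply: ler1_powR; [lra|exact: ltW].
  have h2 : weight n.+1 * a `^ hexp <= weight n.+1 ^+ 2 + a / g ^+ 2.
    have := @young_powR (weight n.+1 ^+ 2) (a * g `^ (- (2 + 2 * r))) hexp
      (sqr_ge0 _) (mulr_ge0 (ltW a1) (powR_ge0 _ _)) hexp_range.
    have -> : (weight n.+1 ^+ 2) `^ hexp * (a * g `^ (- (2 + 2 * r))) `^ (1 - hexp) =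
       weight n.+1 * a `^ hexp.
      have rE : r * hexp + r * hexp + - (2 + 2 * r) * (1 - hexp) = r.
        by rewrite /hexp; field; lra.
      rewrite /weight -/a -/g; move: rE; generalize hexp => s rE.
      rewrite expr2 !powRM ?mulr_ge0 ?powR_ge0 ?(ltW a1)//.
      rewrite -!powRrM; have an := gt_eqF a1; have gn := gt_eqF G0.
      have -> : a * g `^ r * a `^ s = a `^ (1 + s) * g `^ r.
        by rewrite powRD ?an ?implybT// powRr1 ?(ltW a1)//; ring.
      have <- : s + s + (1 - s) = 1 + s by ring.
      rewrite -[in RHS]rE.
      by rewrite !powRD ?an ?gn ?implybT//; ring.
    move=> H; apply: le_trans H _; rewrite lerD2l ler_wpM2l ?(ltW a1)//.
    rewrite -[X in _ <= X^-1]powR_mulrn ?(ltW G0)// -powRN; apply: ler_powR => //; lra.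
  have := ler_wpM2l (weight_ge0 n.+1) h1; lra.
- by move=> n; exact: sqr_ge0.
- by move=> n; rewrite divr_ge0 ?sqr_ge0// ltW.
Unshelve. all: by end_near. Qed.

(** Abel summation with the decreasing factors ga^-r turns the Cauchy property
    of the weighted series into a rate for the tails of the unweighted one. *)
Lemma weighted_tail (a : nat -> R) : cvgn (series (fun n => weight n * a n)) ->
  exists W, forall k, 0 < k ->
    \forall n \near \oo, `|W - series (fun n => al n * a n) n| <= k * ga n `^ (- r).
Proof.
move=> /cvg_cauchy/cauchy_seriesP cau.
have tail k : 0 < k -> exists2 N, (0 < N)%N & forall n m, (N <= n)%N -> (n <= m)%N ->
    `|\sum_(n <= i < m) al i * a i| <= k * ga n `^ (- r).
  move=> k0; have [[A B] /= [[N1 _ HA] [N2 _ HB]] HAB] := cau k k0.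
  exists (maxn N1 N2).+1 => // n m Nn nm.
  have n0 : (0 < n)%N by exact: leq_trans Nn.
  have g0 i : (n <= i)%N -> 0 < ga i.
    move=> ni; apply: lt_le_trans (gamma_mono (leq_trans n0 ni)).
    by rewrite gammaS /ga /series/= big_geq// add0r.
  rewrite mulrC.
  have -> : \sum_(n <= i < m) al i * a i =
      \sum_(n <= i < m) ga i `^ (- r) * (weight i * a i).
    rewrite big_nat_cond [RHS]big_nat_cond; apply: eq_bigr => i /andP[/andP[ni _] _].
    rewrite /weight powRN; field; rewrite gt_eqF// powR_gt0//; exact: g0.
  apply: abel_inequality => //.
    move=> i ni; rewrite powR_ge0/=; apply: ler_powRN; rewrite ?(ltW r_gt0) ?g0//.
    exact: gamma_mono.
  move=> j nj; apply/ltW/(HAB (n, j)); split; [apply: HA|apply: HB] => /=.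
    by apply: leq_trans (leq_trans (leq_maxl _ _) (ltnW Nn)) _.
  by apply: leq_trans (leq_trans (leq_trans (leq_maxr _ _) (ltnW Nn)) nj) _.
have cv : cvgn (series (fun n => al n * a n)).
  apply: cauchy_cvg; apply/cauchy_seriesP => e e0.
  have e20 : 0 < e / 2 by rewrite divr_gt0.
  have [N N0 HN] := tail _ e20.
  have [N' _ HN'] := near_powRN_le gamma_cvgy r_gt0 (@ltr01 R).
  exists ([set n | (maxn N N' <= n)%N], [set n | (maxn N N' <= n)%N]).
    by split; exists (maxn N N').
  move=> [n m] /= [nN mN].
  have [mn|/ltnW nm] := leqP m n; first by rewrite big_geq// normr0.
  apply: le_lt_trans (HN n m (leq_trans (leq_maxl _ _) nN) nm) _.
  apply: (@le_lt_trans _ _ (e / 2 * 1)); last by lra.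
  rewrite ler_wpM2l ?(ltW e20)//; apply: HN' => /=.
  exact: leq_trans (leq_maxr _ _) nN.
exists (limn (series (fun n => al n * a n))) => k k0.
have [N N0 HN] := tail k k0; exists N => // n /= Nn.
set u := series _ in cv *.
have cvd : `|u m - u n| @[m --> \oo] --> `|limn u - u n|.
  by apply: cvg_norm; apply: cvgB => //; exact: cvg_cst.
rewrite -(cvg_lim _ cvd)//; apply: limr_le.
  by apply/cvg_ex; eexists; exact: cvd.
by exists n => // m /= nm; rewrite /u sub_series_geq//; exact: HN.
Qed.

End steps.

(** * Borel sets, indicator series and conditional means *)

Section borel_rV.
Context {R : realType} {d : nat}.

Lemma open_rV_measurable (U : set 'rV[R]_d) : open U -> measurable U.
Proof. exact: sub_sigma_algebra. Qed.

Lemma closed_rV_measurable (U : set 'rV[R]_d) : closed U -> measurable U.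
Proof.
move=> cU; rewrite -[U]setCK; apply: measurableC; apply: open_rV_measurable.
exact: closed_openC.
Qed.

Lemma continuous_rV_measurable (g : 'rV[R]_d -> R) :
  continuous g -> measurable_fun setT g.
Proof.
move=> cg; apply: (measurability _ (RGenOInfty.measurableE R)) => _ [_ [x ->] <-].
rewrite setTI; apply: open_rV_measurable.
by apply: open_comp => // y _; exact: cg.
Qed.

Lemma measurable_coord (i : 'I_d) :
  measurable_fun setT (fun x : 'rV[R]_d => x ord0 i).
Proof. by apply: continuous_rV_measurable => x; exact: coord_continuous. Qed.

(** Every open set is a countable union of boxes with rational centres and
    inverse integer radii, which are cut out by the coordinates. *)
Lemma measurable_fun_rV {d'} {T : measurableType d'} (g : T -> 'rV[R]_d) :
  (forall i, measurable_fun setT (fun w => g w ord0 i)) -> measurable_fun setT g.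
Proof.
move=> mg; apply: (@measurability _ _ _ _ setT g (@open 'rV[R]_d) erefl).
move=> _ [U oU <-]; rewrite setTI.
pose box (q : 'rV[rat]_d) (n : nat) : set 'rV[R]_d :=
  [set y | forall i, `|y ord0 i - ratr (q ord0 i)| < n.+1%:R^-1].
pose F (k : nat) : set T :=
  if @unpickle ('rV[rat]_d * nat)%type k is Some (q, n) then
    if `[< box q n `<=` U >] then g @^-1` box q n else set0
  else set0.
have -> : g @^-1` U = \bigcup_k F k.
  apply/seteqP; split=> [w /= Ugw|w [k _]]; last first.
    rewrite /F; case: unpickle => // -[q n].
    by case: asboolP => // qU /qU.
  have /nbhs_ballP[e /= e0 eU] : nbhs (g w) U by exact: open_nbhs_nbhs.
  pose n := Num.truncn (2 / e).
  have ne : n.+1%:R^-1 < e / 2.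
    rewrite -[e / 2]invrK invf_div ltf_pV2 ?posrE ?divr_gt0//.
    exact: truncnS_gt.
  have n0 : 0 < n.+1%:R^-1 :> R by rewrite invr_gt0.
  have sub_add (x : R) : x - n.+1%:R^-1 < x + n.+1%:R^-1 by rewrite ltrD2l gtrN.
  have /choice[q Hq] : forall i : 'I_d, exists q : rat,
      `|g w ord0 i - ratr q| < n.+1%:R^-1.
    move=> i; have [q] := rat_in_itvoo (sub_add (g w ord0 i)).
    rewrite in_itv/= => /andP[q1 q2]; exists q.
    by move: (n.+1%:R^-1) q1 q2 => c q1 q2; rewrite ltr_norml; lra.
  exists (pickle ((\row_i q i)%R : 'rV[rat]_d, n)) => //.
  rewrite /F pickleK; case: asboolP => [_ /= i|]; first by rewrite mxE.
  move=> []; move=> y yq; apply: eU; rewrite -ball_normE/= [X in X < _]/Num.norm/= mx_normrE.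
  apply/bigmax_ltP; split=> // -[i j] _; rewrite ord1 !mxE/=.
  have := yq j; rewrite mxE => yj; have wj := Hq j.
  have := ler_normB (g w ord0 j - ratr (q j)) (y ord0 j - ratr (q j)).
  rewrite opprB addrA subrK; move: (n.+1%:R^-1) ne yj wj => c ne yj wj; lra.
apply: bigcupT_measurable => k; rewrite /F; case: unpickle => [[q n]|//].
case: asboolP => // _.
have -> : g @^-1` box q n = \bigcap_(i in [set: 'I_d])
    ((fun w => `|g w ord0 i - ratr (q ord0 i)|) @^-1` `]-oo, n.+1%:R^-1[).
  apply/seteqP; split=> w /= H i; first by rewrite /= in_itv/=.
  by have := H i Logic.I; rewrite /= in_itv/=.
apply: fin_bigcap_measurable => [|i _]; first exact: finite_finset.
have mi : measurable_fun setT (fun w => `|g w ord0 i - ratr (q ord0 i)|).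
  apply: measurableT_comp => //.
  by apply: measurable_funB; [exact: mg|exact: measurable_cst].
by rewrite -[X in measurable X]setTI; exact: mi.
Qed.

End borel_rV.

Section indicator_series.
Local Open Scope ereal_scope.
Context {d : measure_display} {T : measurableType d} {R : realType}.
Variable f : T -> \bar R.
Hypothesis mf : measurable_fun setT f.
Hypothesis f0 : forall x, 0 <= f x.

(** Greedy expansion along the harmonic series: a term is added whenever it
    still fits below f.  As the terms tend to 0 and their series diverges, the
    expansion exhausts f, also where f is infinite. *)
Fixpoint greedy (k : nat) (x : T) : R :=
  if k is k'.+1 then
    (greedy k' x + (if ((greedy k' x + harmonic k')%R%:E <= f x)%E
       then harmonic k' else 0))%R else 0%R.

Definition greedy_set k : set T :=
  [set x | (greedy k x + harmonic k)%R%:E <= f x].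

Lemma greedyS k x :
  greedy k.+1 x = (greedy k x + harmonic k * \1_(greedy_set k) x)%R.
Proof.
rewrite /= indicE; case: ifPn => [H|/negP H].
  by rewrite mem_set// mulr1.
by rewrite memNset// mulr0.
Qed.

Lemma greedy_series k x :
  greedy k x = (\sum_(0 <= i < k) harmonic i * \1_(greedy_set i) x)%R.
Proof.
elim: k => [|k IH]; first by rewrite big_geq.
by rewrite greedyS big_nat_recr//= -IH.
Qed.

Lemma greedy_measurable k : measurable_fun setT (greedy k) /\ measurable (greedy_set k).
Proof.
elim: k => [|k [IH1 IH2]].
  have m0 : measurable_fun setT (greedy 0) by exact: measurable_cst.
  split=> //; rewrite -[greedy_set _]setTI; apply: measurable_lee => //.
  by apply/measurable_EFinP; apply: measurable_funD => //; exact: measurable_cst.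
have mS : measurable_fun setT (greedy k.+1).
  have -> : greedy k.+1 = fun x => (greedy k x + harmonic k * \1_(greedy_set k) x)%R.
    by apply: funext => x; rewrite greedyS.
  apply: measurable_funD => //; apply: measurable_funM.
    exact: measurable_cst.
  exact: measurable_indic.
split=> //; rewrite -[greedy_set _]setTI; apply: measurable_lee => //.
by apply/measurable_EFinP; exact: measurable_funD.
Qed.

Lemma greedy_le k x : (greedy k x)%:E <= f x.
Proof.
elim: k => [|k IH]; first exact: f0.
by rewrite /=; case: ifPn => // _; rewrite addr0.
Qed.

Lemma harmonic_sum_large (N : nat) (c : R) :
  exists n, (N <= n)%N /\ (c < \sum_(N <= i < n) harmonic i)%R.
Proof.
apply: contrapT => H; apply: (@dvg_harmonic R).
apply: nondecreasing_is_cvgn.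
  by apply: nondecreasing_series => n _ _; exact: harmonic_ge0.
exists (series harmonic N + `|c|)%R => _ [n _ <-].
have [nN|Nn] := leqP n N.
  apply: (@le_trans _ _ (series harmonic N)); last by rewrite lerDl.
  rewrite -subr_ge0 sub_series_geq// sumr_ge0// => i _; exact: harmonic_ge0.
rewrite -lerBlDl sub_series_geq ?(ltnW Nn)//; apply: le_trans (ler_norm c).
rewrite leNgt; apply/negP => h; apply: H; exists n; split=> //; exact: ltnW.
Qed.

Lemma greedy_nd x : {homo greedy^~ x : m n / (m <= n)%N >-> (m <= n)%R}.
Proof.
apply/nondecreasing_seqP => n; rewrite greedyS lerDl mulr_ge0 ?harmonic_ge0//.
Qed.

Lemma greedy_cvg x : (greedy n x)%:E @[n --> \oo] --> f x.
Proof.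
have add n m : (n <= m)%N -> (forall k, (n <= k)%N -> greedy_set k x) ->
    greedy m x = (greedy n x + \sum_(n <= i < m) harmonic i)%R.
  move=> nm H; elim: m nm => [|m IH].
    by rewrite leqn0 => /eqP ->; rewrite big_geq// addr0.
  rewrite leq_eqVlt => /predU1P[<-|]; first by rewrite big_geq// addr0.
  rewrite ltnS => nm; rewrite greedyS (IH nm) big_nat_recr//= indicE.
  by rewrite mem_set ?mulr1 ?addrA//; exact: H.
have := f0 x; have := greedy_le^~ x.
case fx : (f x) => [r| |] // gle _.
- apply: cvg_EFin; first exact: nearW.
  apply/cvgrPdist_le => e e0.
  have [N _ HN] : \forall n \near \oo, (@harmonic R n <= e)%R.
    have /cvgrPdist_le/(_ e e0) := @cvg_harmonic R; apply: filterS => n.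
    by rewrite sub0r normrN ger0_norm ?harmonic_ge0.
  have [k [Nk nk]] : exists k, (N <= k)%N /\ ~ greedy_set k x.
    apply: contrapT => H; have [n [Nn]] := harmonic_sum_large N (r - greedy N x)%R.
    have := gle n; rewrite lee_fin (add _ _ Nn).
      by move: (\sum_(N <= i < n) _)%R => S; lra.
    by move=> k Nk; apply: contrapT => nk; apply: H; exists k.
  exists k => // n /= kn.
  have rk : (r < greedy k x + harmonic k)%R.
    by rewrite ltNge; apply/negP => h; apply: nk; rewrite /greedy_set /= fx lee_fin.
  have kn' := greedy_nd x kn; have hk := HN k Nk; have := gle n; rewrite lee_fin => gn.
  rewrite ger0_norm ?subr_ge0//.
  by move: (harmonic k) (greedy k x) (greedy n x) rk kn' hk gn => h g1 g2; lra.
- apply/cvgeyPge => A.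
  have [N [_ HN]] := harmonic_sum_large 0 A.
  exists N => // n /= Nn; rewrite lee_fin; apply: le_trans (greedy_nd x Nn).
  rewrite (add 0%N) ?add0r ?ltW// => k _.
  by rewrite /greedy_set /= fx leey.
Qed.

(** With constant coefficients and one series, statements that are linear and
    pass to increasing limits extend from sets to functions in one step. *)
Lemma nonneg_indicator_series : exists (a : nat -> R) (C : nat -> set T),
  [/\ forall k, (0 <= a k)%R, forall k, measurable (C k) &
   forall x, f x = \sum_(0 <= k <oo) ((a k)%:E * (\1_(C k) x)%:E)].
Proof.
exists harmonic, greedy_set; split=> [k|k|x].
- exact: harmonic_ge0.
- by have [] := greedy_measurable k.
- apply/esym/cvg_lim => //.
  rewrite [X in X @ _ --> _](_ : _ = fun n => (greedy n x)%:E); first exact: greedy_cvg.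
  apply: funext => n; rewrite greedy_series -sumEFin.
  by apply: eq_bigr => i _; rewrite EFinM.
Qed.

End indicator_series.

Section nneseries_mul.
Context {R : realType}.
Local Open Scope ereal_scope.

Lemma nneseries_mulr (u : nat -> \bar R) (y : \bar R) :
  (forall k, 0 <= u k) -> 0 <= y ->
  (\sum_(0 <= k <oo) u k) * y = \sum_(0 <= k <oo) (u k * y).
Proof.
move=> u0; case: y => [y y0|_|//].
  rewrite muleC -nneseriesZl//; apply: eq_eseriesr => i _; exact: muleC.
have [u_0|/existsNP[k uk]] := pselect (forall k, u k = 0).
  by rewrite !eseries0 ?mul0e// => i _ _; rewrite u_0// mul0e.
have {}uk : 0 < u k by rewrite lt_def u0 andbT; exact/eqP.
have ge (v : nat -> \bar R) : (forall i, 0 <= v i) -> v k <= \sum_(0 <= i <oo) v i.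
  move=> v0; apply: le_trans (nneseries_lim_ge k.+1 _) => //.
  by rewrite big_nat_recr//= leeDr// sume_ge0.
have vy0 i : 0 <= u i * +oo by rewrite mule_ge0.
rewrite gt0_muley; last by apply: lt_le_trans uk _; exact: ge.
apply/esym/eqP; rewrite -leye_eq; have := ge _ vy0.
by rewrite gt0_muley.
Qed.

End nneseries_mul.

Section subsigma.
Context {d : measure_display} {T : measurableType d} {R : realType}.
Variable mu : {measure set T -> \bar R}.
Variable gen : set (set T).
Hypothesis gen_sub : <<s gen >> `<=` measurable.
Local Open Scope ereal_scope.

Let TG := g_sigma_algebraType gen.

Lemma sub_measurable_fun {d'} {U : measurableType d'} (g : T -> U) :
  measurable_fun (setT : set TG) (g : TG -> U) -> measurable_fun (setT : set T) g.
Proof.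
move=> mg _ Y mY; rewrite setTI; apply: gen_sub.
by have := mg measurableT Y mY; rewrite setTI.
Qed.

Lemma integral_indic_mul (C : set T) (Y : T -> \bar R) : measurable C ->
  \int[mu]_w ((\1_C w)%:E * Y w) = \int[mu]_(w in C) Y w.
Proof.
move=> mC; rewrite [RHS]integral_mkcond; apply: eq_integral => w _.
rewrite indicE /patch; case: ifPn; first by rewrite mul1e.
by rewrite mul0e.
Qed.

(** Equality of the integrals over all sets of the sub-sigma-algebra extends
    from indicators to all nonnegative multipliers. *)
Lemma cond_expectation_mul (X Y Z : T -> \bar R) :
  measurable_fun setT X -> measurable_fun setT Y ->
  (forall w, 0 <= X w) -> (forall w, 0 <= Y w) ->
  measurable_fun (setT : set TG) (Z : TG -> \bar R) -> (forall w, 0 <= Z w) ->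
  (forall A, <<s gen >> A -> \int[mu]_(w in A) Y w = \int[mu]_(w in A) X w) ->
  \int[mu]_w (Z w * Y w) = \int[mu]_w (Z w * X w).
Proof.
move=> mX mY X0 Y0 mZ Z0 XY.
have [a [CG [a0 mC ZE']]] := nonneg_indicator_series mZ Z0.
pose C : nat -> set T := CG.
have ZE w : Z w = \sum_(0 <= k <oo) ((a k)%:E * (\1_(C k) w)%:E) by exact: ZE'.
have expand V : measurable_fun setT V -> (forall w, 0 <= V w) ->
    \int[mu]_w (Z w * V w) = \sum_(0 <= k <oo) ((a k)%:E * \int[mu]_(w in C k) V w).
  move=> mV V0.
  have mCk k : measurable (C k : set T) by apply: gen_sub; exact: mC.
  transitivity (\int[mu]_w (\sum_(0 <= k <oo) ((a k)%:E * ((\1_(C k) w)%:E * V w)))).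
    apply: eq_integral => w _; rewrite ZE nneseries_mulr//.
      by apply: eq_eseriesr => i _; rewrite muleA.
    by move=> k; rewrite mule_ge0 ?lee_fin.
  have m1 k : measurable_fun setT (fun w => (\1_(C k) w)%:E * V w).
    apply: emeasurable_funM => //; apply/measurable_EFinP; exact: measurable_indic.
  rewrite integral_nneseries//; last 2 first.
  - move=> k; apply: emeasurable_funM => //; exact: measurable_cst.
  - by move=> k w _; rewrite !mule_ge0 ?lee_fin.
  apply: eq_eseriesr => k _; rewrite ge0_integralZl//.
  - by rewrite integral_indic_mul.
  - by move=> w _; rewrite mule_ge0 ?lee_fin.
  - by rewrite lee_fin.
rewrite (expand Y)// (expand X)//; apply: eq_eseriesr => k _.
by rewrite XY//; exact: mC.
Qed.

End subsigma.

(** * Averages along the controlled kernel *)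

Section markov.
Context {d : measure_display} {T : measurableType d} {R : realType}.
Context {dt dx : nat}.
Variables (P : probability T R).
Variables (theta : nat -> T -> 'rV[R]_dt) (xi : nat -> T -> 'rV[R]_dx).
Variable Pi : 'rV[R]_dt -> R.-pker 'rV[R]_dx ~> 'rV[R]_dx.
Hypothesis markov : controlled_markov P theta xi Pi.
Hypothesis mtheta : forall n, measurable_fun setT (theta n).
Local Open Scope ereal_scope.

(** The generators of the history, named so that measurability with respect to
    it becomes plain measurability on the type pastType. *)
Definition past (n : nat) : set (set T) :=
  \bigcup_(k in [set k | (k <= n)%N])
    (g_sigma_algebra_preimage (theta k) `|` g_sigma_algebra_preimage (xi k)).

Definition pastType (n : nat) := g_sigma_algebraType (past n).

Lemma past_sub n : <<s past n >> `<=` measurable.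
Proof.
apply: smallest_sub; first exact: sigma_algebra_measurable.
move=> A [k _ [|]] [B mB <-].
  exact: mtheta.
by apply: markov.1.
Qed.

Lemma past_mono n m : (n <= m)%N -> <<s past n >> `<=` <<s past m >>.
Proof.
move=> nm; apply: sub_sigma_algebra2 => A [k /= kn Ak]; exists k => //=.
exact: leq_trans nm.
Qed.

Lemma past_measurable_mono n m {d'} {U : measurableType d'} (g : T -> U) :
  (n <= m)%N -> measurable_fun (setT : set (pastType n)) (g : pastType n -> U) ->
  measurable_fun (setT : set (pastType m)) (g : pastType m -> U).
Proof.
move=> nm mg _ Y mY; rewrite setTI; apply: (past_mono nm).
by have := mg measurableT Y mY; rewrite setTI.
Qed.

Lemma past_theta n k : (k <= n)%N ->
  measurable_fun (setT : set (pastType n)) (theta k : pastType n -> _).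
Proof.
move=> kn _ Y mY; rewrite setTI; apply: sub_sigma_algebra; exists k => //.
by left; exists Y => //; rewrite setTI.
Qed.

Lemma past_xi n k : (k <= n)%N ->
  measurable_fun (setT : set (pastType n)) (xi k : pastType n -> _).
Proof.
move=> kn _ Y mY; rewrite setTI; apply: sub_sigma_algebra; exists k => //.
by right; exists Y => //; rewrite setTI.
Qed.

Lemma measurable_next n :
  measurable_fun setT (fun w => (theta n w, xi n.+1 w)).
Proof. by apply: measurable_fun_pair; [exact: mtheta|exact: markov.1]. Qed.

(** The one-step average of G along the controlled kernel is a version of the
    conditional expectation of G (theta_n, xi_(n+1)) given the past.  The average
    may fail to be measurable, as no measurability of Pi in theta is available,
    so a measurable representative Y is carried along. *)
Definition transfers n (G : 'rV[R]_dt * 'rV[R]_dx -> \bar R) : Prop :=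
  [/\ measurable_fun setT G, forall z, 0 <= G z & exists Y : T -> \bar R,
   [/\ measurable_fun (setT : set (pastType n)) (Y : pastType n -> \bar R),
       forall w, 0 <= Y w,
       {ae P, forall w, Y w = \int[Pi (theta n w) (xi n w)]_x G (theta n w, x)} &
       forall A, <<s past n >> A ->
         \int[P]_(w in A) Y w = \int[P]_(w in A) G (theta n w, xi n.+1 w)]].

Lemma measurable_slice (G : 'rV[R]_dt * 'rV[R]_dx -> \bar R) t :
  measurable_fun setT G -> measurable_fun setT (fun x => G (t, x)).
Proof. by move=> mG; apply: (measurableT_comp mG); exact: pair1_measurable. Qed.

Lemma measurable_along (G : 'rV[R]_dt * 'rV[R]_dx -> \bar R) n :
  measurable_fun setT G -> measurable_fun setT (fun w => G (theta n w, xi n.+1 w)).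
Proof. by move=> mG; apply: (measurableT_comp mG); exact: measurable_next. Qed.

Lemma transfers_sum n (G : nat -> 'rV[R]_dt * 'rV[R]_dx -> \bar R) :
  (forall k, transfers n (G k)) ->
  transfers n (fun z => \sum_(0 <= k <oo) G k z).
Proof.
move=> tG.
have mG k : measurable_fun setT (G k) by have [] := tG k.
have G0 k z : 0 <= G k z by have [_ + _] := tG k; exact.
have mS d' (U : measurableType d') (h : nat -> U -> \bar R) :
    (forall k, measurable_fun setT (h k)) -> (forall k u, 0 <= h k u) ->
    measurable_fun setT (fun u => \sum_(0 <= k <oo) h k u).
  by move=> mh h0; apply: (@ge0_emeasurable_sum _ _ _ _ h xpredT).
split; first exact: mS.
  by move=> z; apply: nneseries_ge0.
have /choice[Y HY] := fun k => let: And3 _ _ H := tG k in H.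
have mYp k : measurable_fun (setT : set (pastType n)) (Y k : pastType n -> \bar R).
  by have [] := HY k.
have Y0 k w : 0 <= Y k w by have [_ + _ _] := HY k; exact.
exists (fun w => \sum_(0 <= k <oo) Y k w); split.
- exact: (mS _ (pastType n)).
- by move=> w; apply: nneseries_ge0.
- have H : {ae P, forall w, forall k, Y k w = \int[Pi (theta n w) (xi n w)]_x G k (theta n w, x)}.
    by apply: ae_foralln => k; have [] := HY k.
  apply: filterS H => w H; rewrite integral_nneseries//.
    by apply: eq_eseriesr => k _; exact: H.
  by move=> k; exact: measurable_slice.
- move=> A pA; have mA := past_sub pA.
  rewrite !integral_nneseries//.
  + by apply: eq_eseriesr => k _; have [_ _ _] := HY k; exact.
  + by move=> k; apply: measurable_funTS; exact: measurable_along.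
  + move=> k; apply: measurable_funTS.
    by apply: (sub_measurable_fun (@past_sub n)); exact: mYp.
Qed.

Lemma transfers_scale n (a : R) G : (0 <= a)%R -> transfers n G ->
  transfers n (fun z => a%:E * G z).
Proof.
move=> a0 [mG G0 [Y [mY Y0 YE YA]]]; split.
- by apply: emeasurable_funM => //; exact: measurable_cst.
- by move=> z; rewrite mule_ge0.
exists (fun w => a%:E * Y w); split.
- by apply: emeasurable_funM => //; exact: measurable_cst.
- by move=> w; rewrite mule_ge0.
- apply: filterS YE => w ->; rewrite ge0_integralZl//.
  by apply: measurable_slice.
- move=> A pA; have mA := past_sub pA.
  rewrite !ge0_integralZl//.
  + by rewrite YA.
  + by apply: measurable_funTS; exact: measurable_along.
  + by apply: measurable_funTS; exact: (sub_measurable_fun (@past_sub n)).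
Qed.

Lemma integral_setI_indic (mu : {measure set T -> \bar R}) (A D : set T) (Y : T -> \bar R) :
  \int[mu]_(w in A) ((\1_D w)%:E * Y w) = \int[mu]_(w in A `&` D) Y w.
Proof.
rewrite [LHS]integral_mkcond [RHS]integral_mkcond; apply: eq_integral => w _.
rewrite /patch in_setI indicE; case: (w \in A) => //=.
by case: (w \in D); rewrite ?mul1e ?mul0e.
Qed.

Lemma transfers_rectangle n (A : set 'rV[R]_dt) (B : set 'rV[R]_dx) :
  measurable A -> measurable B -> transfers n (fun z => (\1_(A `*` B) z)%:E).
Proof.
move=> mA mB.
have GE t x : (\1_(A `*` B) (t, x))%:E = (\1_A t)%:E * (\1_B x)%:E :> \bar R.
  by rewrite -EFinM !indicE in_setX; case: (t \in A) => /=; rewrite ?mul1r ?mul0r.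
split.
- by apply/measurable_EFinP; apply: measurable_indic; exact: measurableX.
- by move=> z; rewrite lee_fin.
have [Y [Y0 mY YA] YE] := markov.2 B n mB.
have mYp : measurable_fun (setT : set (pastType n)) (Y : pastType n -> \bar R).
  by move=> _ C mC; rewrite setTI; exact: mY.
exists (fun w => (\1_A (theta n w))%:E * Y w); split.
- apply: emeasurable_funM => //; apply/measurable_EFinP.
  apply: (@measurableT_comp _ _ _ (pastType n) _ _ (\1_A : 'rV[R]_dt -> R) setT (theta n)).
    exact: measurable_indic.
  exact: past_theta.
- by move=> w; rewrite mule_ge0 ?lee_fin.
- apply: filterS YE => w ->; under eq_integral do rewrite GE.
  rewrite ge0_integralZl ?lee_fin//.
    by rewrite integral_indic// setIT.
  by apply/measurable_EFinP; exact: measurable_indic.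
- move=> C pC.
  pose D := theta n @^-1` A.
  have pD : <<s past n >> D.
    by have := past_theta (leqnn n) measurableT mA; rewrite setTI.
  have pCD : <<s past n >> (C `&` D).
    exact: (@measurableI _ (pastType n)).
  transitivity (\int[P]_(w in C `&` D) Y w).
    by rewrite -integral_setI_indic.
  rewrite YA// -integral_setI_indic; apply: eq_integral => w _.
  by rewrite GE.
Qed.

(** The kernels have mass one, so 1 - Y represents the complement almost
    surely; truncation at 0 makes it nonnegative everywhere. *)
Lemma transfers_compl n (C : set ('rV[R]_dt * 'rV[R]_dx)) :
  measurable C -> transfers n (fun z => (\1_C z)%:E) ->
  transfers n (fun z => (\1_(~` C) z)%:E).
Proof.
move=> mC [mG G0 [Y [mY Y0 YE YA]]].
have mG' : measurable_fun setT (fun z => (\1_(~` C) z)%:E : \bar R).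
  by apply/measurable_EFinP; apply: measurable_indic; exact: measurableC.
have sum1 z : (\1_(~` C) z)%:E + (\1_C z)%:E = 1 :> \bar R.
  by rewrite -EFinD !indicE in_setC; case: (z \in C); rewrite /= ?addr0 ?add0r.
split=> //.
pose Y' w := maxe (1 - Y w) 0.
have mY' : measurable_fun (setT : set (pastType n)) (Y' : pastType n -> \bar R).
  by apply: measurable_maxe => //; apply: emeasurable_funB.
have Y'0 w : 0 <= Y' w by rewrite le_max lexx orbT.
have hsum t x : \int[Pi t x]_y (\1_(~` C) (t, y))%:E + \int[Pi t x]_y (\1_C (t, y))%:E = 1.
  rewrite -ge0_integralD//.
  - under eq_integral do rewrite sum1.
    by rewrite integral_cst// mul1e prob_kernel.
  - exact: (measurable_slice t mG').
  - exact: (measurable_slice t mG).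
have ge0 (D : set ('rV[R]_dt * 'rV[R]_dx)) t x : 0 <= \int[Pi t x]_y (\1_D (t, y))%:E.
  by apply: integral_ge0 => y _; rewrite lee_fin.
have Y'E : {ae P, forall w, Y' w = \int[Pi (theta n w) (xi n w)]_y (\1_(~` C) (theta n w, y))%:E
     /\ Y' w + Y w = 1}.
  apply: filterS YE => w; have := hsum (theta n w) (xi n w).
  have := ge0 C (theta n w) (xi n w); have := ge0 (~` C) (theta n w) (xi n w).
  rewrite /Y' => + + + ->.
  case: (\int[_]_y (\1_(~` C) _)%:E) => [a| |]; case: (\int[_]_y (\1_C _)%:E) => [b| |] //.
  rewrite !lee_fin -EFinD => a0 b0 [ab].
  have -> : (1%:E - b%:E = a%:E)%E by rewrite -EFinB -ab addrK.
  by rewrite max_l ?lee_fin// -EFinD ab.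
exists Y'; split=> //.
  by apply: filterS Y'E => w [].
move=> A pA; have mA := past_sub pA.
have mYA : measurable_fun A Y by apply: measurable_funTS; exact: (sub_measurable_fun (@past_sub n)).
have mY'A : measurable_fun A Y' by apply: measurable_funTS; exact: (sub_measurable_fun (@past_sub n)).
have mCA : measurable_fun A (fun w => (\1_C (theta n w, xi n.+1 w))%:E : \bar R).
  by apply: measurable_funTS; exact: (measurable_along n mG).
have mC'A : measurable_fun A (fun w => (\1_(~` C) (theta n w, xi n.+1 w))%:E : \bar R).
  by apply: measurable_funTS; exact: (measurable_along n mG').
have e1 : \int[P]_(w in A) Y' w + \int[P]_(w in A) Y w = P A.
  rewrite -ge0_integralD//; transitivity (\int[P]_(w in A) (cst 1 w : \bar R)).
    apply: ge0_ae_eq_integral => //.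
    - exact: emeasurable_funD.
    - by move=> w _; rewrite adde_ge0.
    - by apply: filterS Y'E => w [].
  by rewrite integral_cst// mul1e.
have e2 : \int[P]_(w in A) (\1_(~` C) (theta n w, xi n.+1 w))%:E + \int[P]_(w in A) Y w = P A.
  rewrite YA// -ge0_integralD//.
  under eq_integral do rewrite sum1.
  by rewrite integral_cst// mul1e.
have fin : \int[P]_(w in A) Y w \is a fin_num.
  rewrite ge0_fin_numE ?integral_ge0//.
  apply: (@le_lt_trans _ _ (P A)); last by rewrite ltey_eq fin_num_measure.
  by rewrite -e2 leeDr// integral_ge0// => w _; rewrite lee_fin.
by rewrite -[LHS](addeK _ fin) e1 -e2 addeK.
Qed.

(** Dynkin's theorem: rectangles generate the product sigma-algebra. *)
Lemma transfers_indic n (C : set ('rV[R]_dt * 'rV[R]_dx)) :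
  measurable C -> transfers n (fun z => (\1_C z)%:E).
Proof.
rewrite measurable_prod_measurableType; move: C.
apply: dynkin_induction => /=.
- by rewrite measurable_prod_measurableType.
- move=> _ _ [A1 mA1 [A2 mA2 <-]] [B1 mB1 [B2 mB2 <-]].
  exists (A1 `&` B1); first exact: measurableI.
  exists (A2 `&` B2); first exact: measurableI.
  by rewrite setXI.
- by rewrite -setXTT; apply: transfers_rectangle.
- by move=> _ [A mA [B mB <-]]; exact: transfers_rectangle.
- by move=> C mC tC; exact: transfers_compl.
- move=> F mF tF tG; have := transfers_sum tG.
  congr (transfers n _); apply: funext => z.
  by rewrite indic_bigcup.
Qed.

Lemma transfers_ge0 n G : measurable_fun setT G -> (forall z, 0 <= G z) ->
  transfers n G.
Proof.
move=> mG G0; have [a [C [a0 mC GE]]] := nonneg_indicator_series mG G0.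
have -> : G = fun z => \sum_(0 <= k <oo) ((a k)%:E * (\1_(C k) z)%:E).
  exact: funext.
by apply: transfers_sum => k; apply: transfers_scale => //; exact: transfers_indic.
Qed.

End markov.

(** * Almost sure convergence of centred increments *)

Section one_step_mean.
Context {d : measure_display} {T : measurableType d} {R : realType}.
Context {dt dx : nat}.
Variables (P : probability T R).
Variables (theta : nat -> T -> 'rV[R]_dt) (xi : nat -> T -> 'rV[R]_dx).
Variable Pi : 'rV[R]_dt -> R.-pker 'rV[R]_dx ~> 'rV[R]_dx.
Hypothesis markov : controlled_markov P theta xi Pi.
Hypothesis mtheta : forall n, measurable_fun setT (theta n).
Local Open Scope ereal_scope.

Variables (n : nat) (g : 'rV[R]_dt * 'rV[R]_dx -> R).
Hypothesis mg : measurable_fun setT g.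
Hypothesis ig : forall t x, (Pi t x).-integrable setT (fun y => (g (t, y))%:E).
Let avg t x := (\int[Pi t x]_y (g (t, y)))%R.
Hypothesis mavg : measurable_fun setT (fun w => avg (theta n w) (xi n w)).

(** The positive and negative parts of g are transferred separately.  The
    integrability of the averaged side comes out of the transfer, since no
    bound on the average is assumed. *)
Lemma one_step_mean (Z : T -> R) :
  measurable_fun (setT : set (pastType theta xi n)) (Z : pastType theta xi n -> R) ->
  (forall w, 0 <= Z w)%R ->
  P.-integrable setT (fun w => (Z w * g (theta n w, xi n.+1 w))%:E) ->
  P.-integrable setT (fun w => (Z w * avg (theta n w) (xi n w))%:E) /\
  \int[P]_w (Z w * avg (theta n w) (xi n w))%:E =
  \int[P]_w (Z w * g (theta n w, xi n.+1 w))%:E.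
Proof.
move=> mZ Z0 iZ.
pose gp := (EFin \o g)^\+; pose gn := (EFin \o g)^\-.
have mEg : measurable_fun setT (EFin \o g) by exact/measurable_EFinP.
have mgp : measurable_fun setT gp by exact: measurable_funepos.
have mgn : measurable_fun setT gn by exact: measurable_funeneg.
have gp0 z : 0 <= gp z by exact: funepos_ge0.
have gn0 z : 0 <= gn z by exact: funeneg_ge0.
have gE z : (g z)%:E = gp z - gn z by rewrite [LHS](congr1 (@^~ z) (funeposneg (EFin \o g))).
have [_ _ [Yp [mYp Yp0 YpE YpA]]] := transfers_ge0 markov mtheta n mgp gp0.
have [_ _ [Yn [mYn Yn0 YnE YnA]]] := transfers_ge0 markov mtheta n mgn gn0.
have sub := @past_sub _ _ _ _ _ P theta xi Pi markov mtheta n.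
have mYpT := sub_measurable_fun sub mYp.
have mYnT := sub_measurable_fun sub mYn.
have mZT : measurable_fun setT Z := sub_measurable_fun sub mZ.
have mEZ : measurable_fun (setT : set (pastType theta xi n))
    ((fun w => (Z w)%:E) : pastType theta xi n -> \bar R) by exact/measurable_EFinP.
have mEZT : measurable_fun setT (fun w => (Z w)%:E) by exact/measurable_EFinP.
have EZ0 w : 0 <= (Z w)%:E by rewrite lee_fin.
pose nxt w := (theta n w, xi n.+1 w).
have mgpn : measurable_fun setT (fun w => gp (nxt w)).
  exact: (measurable_along markov mtheta n mgp).
have mgnn : measurable_fun setT (fun w => gn (nxt w)).
  exact: (measurable_along markov mtheta n mgn).
have Ep := cond_expectation_mul sub mgpn mYpT (fun w => gp0 _) Yp0 mEZ EZ0 YpA.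
have En := cond_expectation_mul sub mgnn mYnT (fun w => gn0 _) Yn0 mEZ EZ0 YnA.
have dom (h : 'rV[R]_dt * 'rV[R]_dx -> \bar R) : measurable_fun setT (fun w => h (nxt w)) ->
    (forall z, 0 <= h z) -> (forall z, h z <= `|(g z)%:E|) ->
    P.-integrable setT (fun w => (Z w)%:E * h (nxt w)).
  move=> mh h0 hg; apply: le_integrable iZ => //; first exact: emeasurable_funM.
  move=> w _; rewrite EFinM !abseM (gee0_abs (h0 _)); apply: lee_wpmul2l => //.
have igp : P.-integrable setT (fun w => (Z w)%:E * gp (nxt w)).
  by apply: dom => // z; rewrite /gp funeposE ge_max lee_abs abse_ge0.
have ign : P.-integrable setT (fun w => (Z w)%:E * gn (nxt w)).
  by apply: dom => // z; rewrite /gn funenegE ge_max -abseN lee_abs abse_ge0.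
have iY (Y : T -> \bar R) (h : T -> \bar R) : measurable_fun setT Y -> (forall w, 0 <= Y w) ->
    \int[P]_w ((Z w)%:E * Y w) = \int[P]_w ((Z w)%:E * h w) ->
    P.-integrable setT (fun w => (Z w)%:E * h w) ->
    P.-integrable setT (fun w => (Z w)%:E * Y w).
  move=> mY Y0 YE ih; apply/integrableP; split; first exact: emeasurable_funM.
  rewrite (eq_integral (fun w => (Z w)%:E * Y w)).
    by rewrite YE; exact: (integrable_lty _ ih).
  by move=> w _; rewrite gee0_abs// mule_ge0.
have iYp := iY _ _ mYpT Yp0 Ep igp.
have iYn := iY _ _ mYnT Yn0 En ign.
have iV := integrableB measurableT iYp iYn.
have mZavg : measurable_fun setT (fun w => (Z w * avg (theta n w) (xi n w))%:E).
  by apply/measurable_EFinP; exact: measurable_funM.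
have aeV : {ae P, forall w, setT w -> (Z w * avg (theta n w) (xi n w))%:E =
    (Z w)%:E * Yp w - (Z w)%:E * Yn w}.
  apply: filterS2 YpE YnE => w -> -> _.
  have iw := ig (theta n w) (xi n w).
  have fp := integrable_pos_fin_num measurableT iw.
  have fn := integrable_neg_fin_num measurableT iw.
  have -> : \int[Pi (theta n w) (xi n w)]_x gp (theta n w, x) =
      \int[Pi (theta n w) (xi n w)]_x (fun y => (g (theta n w, y))%:E)^\+ x.
    by apply: eq_integral => x _; rewrite /gp !funeposE.
  have -> : \int[Pi (theta n w) (xi n w)]_x gn (theta n w, x) =
      \int[Pi (theta n w) (xi n w)]_x (fun y => (g (theta n w, y))%:E)^\- x.
    by apply: eq_integral => x _; rewrite /gn !funenegE.
  rewrite -muleBr//; last exact: fin_num_adde_defr.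
  rewrite EFinM; congr (_ * _); rewrite /avg /Rintegral fineK.
    by rewrite integralE.
  exact: integrable_fin_num.
have eqV : \int[P]_w (Z w * avg (theta n w) (xi n w))%:E =
    \int[P]_w ((Z w)%:E * Yp w - (Z w)%:E * Yn w).
  by apply: ae_eq_integral => //; exact: (measurable_int P iV).
split.
  apply/integrableP; split=> //.
  have /integrableP[mV] := iV; apply: le_lt_trans.
  rewrite le_eqVlt; apply/orP; left; apply/eqP; apply: ae_eq_integral => //.
  - exact: measurableT_comp.
  - exact: measurableT_comp.
  - by apply: filterS aeV => w /[apply] ->.
rewrite eqV integralB// Ep En -integralB//; apply: eq_integral => w _.
rewrite EFinM gE muleBr//; last first.
  rewrite /gp /gn; apply: fin_num_adde_defl.
  by rewrite funenegE/=; case: (leP (- (g (nxt w))%:E) 0).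
Qed.

End one_step_mean.

(** X_orth is the martingale difference property, tested on bounded multipliers
    that are measurable with respect to the past. *)
Section l2_series.
Context {d : measure_display} {T : measurableType d} {R : realType}.
Variable P : probability T R.
Variable F : nat -> set (set T).
Hypothesis F_sub : forall n, <<s F n >> `<=` measurable.
Hypothesis F_mono : forall n, <<s F n >> `<=` <<s F n.+1 >>.
Variables (X : nat -> T -> R) (v : nat -> R).
Let FT n := g_sigma_algebraType (F n).
Hypothesis X_adapted : forall n, measurable_fun (setT : set (FT n.+1)) (X n : FT n.+1 -> R).
Hypothesis X_var : forall n, (\int[P]_w (X n w ^+ 2)%:E <= (v n)%:E)%E.
Hypothesis X_orth : forall n (Z : T -> R) (c : R),
  measurable_fun (setT : set (FT n)) (Z : FT n -> R) -> (forall w, `|Z w| <= c) ->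
  (\int[P]_w (Z w * X n w)%:E = 0)%E.
Hypothesis v_sum : bounded_series v.

Let mXT n : measurable_fun setT (X n).
Proof. exact: (sub_measurable_fun (@F_sub n.+1)). Qed.

Let v_ge0 n : 0 <= v n.
Proof.
rewrite -lee_fin; apply: le_trans (X_var n).
by apply: integral_ge0 => w _; rewrite lee_fin sqr_ge0.
Qed.

Section stopped.
Variables (m : nat) (e : R).
Hypothesis e_gt0 : 0 < e.

(** Freezing the sums at their first exit from [-e, e] keeps the multipliers of
    the increments bounded, and lets the event of an exit up to time j be read
    off at time j. *)
Fixpoint frozen_sum (j : nat) (w : T) : R :=
  if j is j'.+1 then
    frozen_sum j' w + (if `|frozen_sum j' w| <= e then X (m + j') w else 0)
  else 0.

Lemma frozen_sum_adapted j :
  measurable_fun (setT : set (FT (m + j))) (frozen_sum j : FT (m + j) -> R).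
Proof.
elim: j => [|j IH]; first exact: measurable_cst.
have IH' : measurable_fun (setT : set (FT (m + j.+1))) (frozen_sum j : FT (m + j.+1) -> R).
  move=> _ Y mY; rewrite setTI addnS; apply: F_mono.
  by have := IH measurableT Y mY; rewrite setTI.
apply: measurable_funD => //; apply: measurable_fun_ifT.
- by apply: measurable_fun_ler => //; apply: measurableT_comp.
- by rewrite addnS; exact: X_adapted.
- exact: measurable_cst.
Qed.

Lemma frozen_sumT j : measurable_fun setT (frozen_sum j).
Proof.
apply: (sub_measurable_fun (@F_sub (m + j))); exact: frozen_sum_adapted.
Qed.

(** The cross term vanishes because the multiplier Z, the frozen sum before
    its exit, is bounded and known before the increment. *)
Lemma frozen_sum_var j :
  (\int[P]_w (frozen_sum j w ^+ 2)%:E <= (\sum_(m <= i < m + j) v i)%:E)%E.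
Proof.
elim: j => [|j IH].
  rewrite addn0 big_geq//= (eq_integral (cst 0%E)) ?integral0//.
  by move=> w _; rewrite expr0n.
pose I w : R := if `|frozen_sum j w| <= e then 1 else 0.
pose Z w := I w * frozen_sum j w.
have mI : measurable_fun (setT : set (FT (m + j))) (I : FT (m + j) -> R).
  apply: measurable_fun_ifT; [|exact: measurable_cst|exact: measurable_cst].
  apply: measurable_fun_ler => //; apply: measurableT_comp => //.
  exact: frozen_sum_adapted.
have mZ : measurable_fun (setT : set (FT (m + j))) (Z : FT (m + j) -> R).
  by apply: measurable_funM => //; exact: frozen_sum_adapted.
have Ze w : `|Z w| <= e.
  rewrite /Z /I; case: ifPn => [h|_]; first by rewrite mul1r.
  by rewrite mul0r normr0 ltW.
have mIT := sub_measurable_fun (@F_sub _) mI.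
have mZT := sub_measurable_fun (@F_sub _) mZ.
have msq (h : T -> R) : measurable_fun setT h -> measurable_fun setT (fun w => (h w ^+ 2)%:E).
  by move=> mh; apply/measurable_EFinP; exact: measurable_funX.
have isq (h : T -> R) (c : R) : measurable_fun setT h -> (\int[P]_w (h w ^+ 2)%:E <= c%:E)%E ->
    P.-integrable setT (EFin \o (fun w => h w ^+ 2)).
  move=> mh hc; apply/integrableP; split; first exact: msq.
  apply: le_lt_trans (ltry c); apply: le_trans hc.
  rewrite le_eqVlt; apply/orP; left; apply/eqP; apply: eq_integral => w _ /=.
  by rewrite ger0_norm// sqr_ge0.
have iS := isq _ _ (frozen_sumT j) IH.
have iX2 := isq _ _ (mXT (m + j)) (X_var (m + j)).
have iIX2 : P.-integrable setT (EFin \o (fun w => I w * X (m + j) w ^+ 2)).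
  apply: le_integrable iX2 => //.
    by apply/measurable_EFinP; apply: measurable_funM => //; exact: measurable_funX.
  move=> w _ /=; rewrite lee_fin normrM /I.
  by case: ifPn => _; rewrite ?normr1 ?mul1r// normr0 mul0r.
have iZX : P.-integrable setT (EFin \o (fun w => Z w * X (m + j) w)).
  have i1 : P.-integrable setT (EFin \o (fun w => e ^+ 2 + X (m + j) w ^+ 2)).
    have ic : P.-integrable setT (EFin \o cst (e ^+ 2)).
      exact: finite_measure_integrable_cst.
    exact: (integrableD measurableT ic iX2).
  apply: le_integrable i1 => //.
    by apply/measurable_EFinP; exact: measurable_funM.
  move=> w _ /=; rewrite lee_fin [leRHS]ger0_norm ?addr_ge0 ?sqr_ge0// normrM.
  apply: le_trans (ler_wpM2r (normr_ge0 _) (Ze w)) _.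
  rewrite -[X in _ <= _ + X]real_normK ?num_real//.
  have : 0 <= (e - `|X (m + j) w|) ^+ 2 by exact: sqr_ge0.
  have e0 := e_gt0; have := sqr_ge0 e; have := sqr_ge0 `|X (m + j) w|.
  rewrite sqrrB mulr2n; lra.
have -> : (\int[P]_w (frozen_sum j.+1 w ^+ 2)%:E =
    \int[P]_w ((EFin \o (fun w => frozen_sum j w ^+ 2 + 2 * (Z w * X (m + j) w))%R) w +
       (EFin \o (fun w => I w * X (m + j) w ^+ 2)%R) w))%E.
  apply: eq_integral => w _; rewrite /= -EFinD; congr EFin; rewrite /Z /I.
  case: ifPn => _; ring.
have i2 : P.-integrable setT (EFin \o (fun w => 2 * (Z w * X (m + j) w))).
  exact: (integrableZl measurableT 2 iZX).
have i3 : P.-integrable setT (EFin \o (fun w => frozen_sum j w ^+ 2 + 2 * (Z w * X (m + j) w))).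
  exact: (integrableD measurableT iS i2).
rewrite integralD_EFin//.
have -> : (\int[P]_w (EFin \o (fun w => (frozen_sum j w ^+ 2 + 2 * (Z w * X (m + j) w))%R)) w =
   \int[P]_w (EFin \o (fun w => (frozen_sum j w ^+ 2)%R)) w)%E.
  transitivity (\int[P]_w ((EFin \o (fun w => (frozen_sum j w ^+ 2)%R)) w +
     (EFin \o (fun w => (2 * (Z w * X (m + j) w))%R)) w))%E.
    by apply: eq_integral.
  rewrite integralD_EFin//.
  have -> : (\int[P]_w (EFin \o (fun w => (2 * (Z w * X (m + j) w))%R)) w = 0)%E.
    transitivity (\int[P]_w (2%:E * (EFin \o (fun w => (Z w * X (m + j) w)%R)) w))%E.
      by apply: eq_integral.
    by rewrite integralZl// (X_orth mZ Ze) mule0.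
  by rewrite adde0.
rewrite addnS big_nat_recr ?leq_addr//= EFinD; apply: leeD => //.
apply: le_trans (X_var (m + j)); apply: ge0_le_integral => //.
- move=> w _ /=; rewrite lee_fin mulr_ge0 ?sqr_ge0// /I; case: ifP => //.
- exact: (measurable_int P iIX2).
- exact: (measurable_int P iX2).
- move=> w _ /=; rewrite lee_fin /I; case: ifP; rewrite ?mul1r ?mul0r ?sqr_ge0//.
Qed.

Definition exceed (j : nat) : set T := [set w | e < `|frozen_sum j w|].

Lemma exceed_measurable j : measurable (exceed j).
Proof.
rewrite -[exceed j]setTI; apply: (@measurable_fun_ltr _ _ _ setT (cst e) (fun w => `|frozen_sum j w|)) => //.
by apply: measurableT_comp => //; exact: frozen_sumT.
Qed.

(** Chebyshev's inequality; on frozen sums it is Kolmogorov's maximal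
    inequality. *)
Lemma exceed_prob j : (P (exceed j) <= ((e ^+ 2)^-1 * \sum_(m <= i < m + j) v i)%:E)%E.
Proof.
have e2 : 0 < e ^+ 2 by exact: exprn_gt0.
have h : ((e ^+ 2)%:E * P (exceed j) <= (\sum_(m <= i < m + j) v i)%:E)%E.
  apply: le_trans (frozen_sum_var j).
  have -> : ((e ^+ 2)%:E * P (exceed j) = \int[P]_(w in exceed j) (cst (e ^+ 2)%:E w))%E.
    by rewrite integral_cst//; exact: exceed_measurable.
  apply: (@le_trans _ _ (\int[P]_(w in exceed j) (frozen_sum j w ^+ 2)%:E)%E).
    apply: ge0_le_integral => //.
    - exact: exceed_measurable.
    - by move=> w _; rewrite lee_fin ltW.
    - apply/measurable_EFinP; apply: measurable_funX; apply: measurable_funTS.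
      exact: frozen_sumT.
    - move=> w /= we; rewrite lee_fin -[leRHS]real_normK ?num_real//.
      by rewrite ler_sqr ?nnegrE ?(ltW e_gt0)// ltW.
  apply: ge0_subset_integral => //; first exact: exceed_measurable.
  - by apply/measurable_EFinP; apply: measurable_funX; exact: frozen_sumT.
  - by move=> w _; rewrite lee_fin sqr_ge0.
move: h; have : P (exceed j) \is a fin_num by rewrite fin_num_measure//; exact: exceed_measurable.
case: (P (exceed j)) => // x _; rewrite -!EFinM !lee_fin => h.
by rewrite ler_pdivlMl.
Qed.

Lemma exceed_mono : {homo exceed : i j / (i <= j)%N >-> (i <= j)%O}.
Proof.
apply/nondecreasing_seqP => j; apply/subsetPset => w /= ej.
by rewrite /exceed /= leNgt ej /= addr0.
Qed.

Lemma frozen_sum_series w j : ~ (\bigcup_j exceed j) w ->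
  frozen_sum j w = \sum_(m <= i < m + j) X i w.
Proof.
move=> nw; elim: j => [|j IH]; first by rewrite addn0 big_geq.
rewrite /= ifT; last first.
  by rewrite leNgt; apply/negP => h; apply: nw; exists j.
by rewrite IH addnS big_nat_recr ?leq_addr.
Qed.

Lemma exceed_bigcup_prob (r : R) : (forall j, \sum_(m <= i < m + j) v i <= r) ->
  (P (\bigcup_j exceed j) <= ((e ^+ 2)^-1 * r)%:E)%E.
Proof.
move=> vr.
have mU : measurable (\bigcup_j exceed j).
  by apply: bigcupT_measurable => j; exact: exceed_measurable.
have cv := nondecreasing_cvg_mu (mu := P) exceed_measurable mU exceed_mono.
rewrite -(cvg_lim _ cv)//; apply: lime_le; first by apply/cvg_ex; eexists; exact: cv.
apply: nearW => j /=; apply: le_trans (exceed_prob j) _.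
by rewrite lee_fin ler_wpM2l// invr_ge0 sqr_ge0.
Qed.

End stopped.

Lemma series_tail_small (r : R) : 0 < r ->
  exists m, forall j, \sum_(m <= i < m + j) v i <= r.
Proof.
move=> r0; have /cvg_cauchy/cauchy_seriesP := bounded_series_cvg v_ge0 v_sum.
move=> /(_ r r0)[[A B] /= [[N1 _ HA] [N2 _ HB]] H].
exists (maxn N1 N2) => j; apply: le_trans (ler_norm _) _; apply/ltW.
apply: (H (maxn N1 N2, maxn N1 N2 + j)%N); split; [apply: HA|apply: HB] => /=.
  exact: leq_maxl.
exact: leq_trans (leq_maxr N1 N2) (leq_addr _ _).
Qed.

Lemma ae_partial_sums_small (e : R) : 0 < e ->
  {ae P, forall w, exists m, forall j, `|\sum_(m <= i < m + j) X i w| <= e}.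
Proof.
move=> e0; pose bad := \bigcap_m \bigcup_j exceed m e j.
have mU m : measurable (\bigcup_j exceed m e j).
  by apply: bigcupT_measurable => j; exact: exceed_measurable.
exists bad; split.
- exact: bigcapT_measurable.
- apply/eqP; rewrite eq_le measure_ge0 andbT; apply/lee_addgt0Pr => k k0.
  rewrite add0e; have e2k : 0 < e ^+ 2 * k by rewrite mulr_gt0// exprn_gt0.
  have [m Hm] := series_tail_small e2k.
  apply: (@le_trans _ _ (P (\bigcup_j exceed m e j))).
    apply: le_measure; rewrite ?inE//; first exact: bigcapT_measurable.
    by move=> w; exact.
  apply: le_trans (exceed_bigcup_prob e0 Hm) _.
  by rewrite lee_fin mulKf// gt_eqF// exprn_gt0.
- move=> w /= nw m _; apply: contrapT => nm; apply: nw; exists m => j.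
  rewrite -(frozen_sum_series j nm) leNgt; apply/negP => h; apply: nm.
  by exists j.
Qed.

Theorem l2_series_cvg : {ae P, forall w, cvgn (series (fun n => X n w))}.
Proof.
have : {ae P, forall w, forall l : nat, exists m, forall j,
    `|\sum_(m <= i < m + j) X i w| <= l.+1%:R^-1}.
  by apply: ae_foralln => l; apply: ae_partial_sums_small; rewrite invr_gt0.
apply: filterS => w H; apply: cauchy_cvg; apply/cauchy_seriesP => e e0.
pose l := Num.truncn (2 / e).
have le : l.+1%:R^-1 < e / 2.
  by rewrite -[e / 2]invrK invf_div ltf_pV2 ?posrE ?divr_gt0// truncnS_gt.
have [m Hm] := H l.
exists ([set n | (m <= n)%N], [set n | (m <= n)%N]); first by split; exists m.
move=> [a b] /= [ma mb].
have [ba|/ltnW ab] := leqP b a; first by rewrite big_geq// normr0.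
have h1 := Hm (a - m)%N; have h2 := Hm (b - m)%N; rewrite !subnKC// in h1 h2.
rewrite (big_cat_nat ma ab)/= in h2.
have := ler_normB (\sum_(m <= i < a) X i w + \sum_(a <= i < b) X i w) (\sum_(m <= i < a) X i w).
rewrite addrAC subrr add0r => h3.
apply: le_lt_trans h3 _; move: h1 h2 le.
by move: (`|_|) (`|_ + _|) (l.+1%:R^-1) => *; lra.
Qed.

End l2_series.

(** * Summability of the weighted noise *)

Section drift.
Context {R : realType}.
Variables (c u H B : nat -> R).
Hypothesis c0 : c 0%N = 0.
Hypothesis BE : forall n, B n.+1 = H n + (u n - u n.+1).
Hypothesis H_sum : bounded_series (fun n => `|c n.+1 * H n|).
Hypothesis u_sum : bounded_series (fun n => `|(c n.+1 - c n) * u n|).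
Hypothesis cu0 : (fun n => c n * u n) @ \oo --> 0.

(** The terms B are differences u_n - u_(n+1), shifted by one index against the
    drift H.  Summation by parts moves the difference to the weights c. *)
Lemma summation_by_parts_cvg : cvgn (series (fun n => c n * B n)).
Proof.
have abs_cvg (a : nat -> R) : bounded_series (fun n => `|a n|) -> cvgn (series a).
  move=> ba; apply: normed_cvg.
  exact: bounded_series_cvg (fun n => normr_ge0 (a n)) ba.
have /cvg_ex[l1 cv1] := abs_cvg _ H_sum; have /cvg_ex[l2 cv2] := abs_cvg _ u_sum.
have E n : series (fun n => c n * B n) n.+1 =
    series (fun n => c n.+1 * H n) n + series (fun n => (c n.+1 - c n) * u n) n - c n * u n.
  rewrite /series/=; elim: n => [|n IH].
    by rewrite big_nat1 !big_geq// c0 !mul0r subr0 addr0.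
  by rewrite big_nat_recr//= IH !big_nat_recr//= BE; ring.
apply/cvg_ex; exists (l1 + l2 - 0); rewrite -cvg_shiftS.
by under eq_fun do rewrite E; apply: cvgB => //; exact: cvgD.
Qed.

End drift.

Section noise.
Variables (R : realType) (dt dx : nat)
  (disp : measure_display) (Omega : measurableType disp)
  (P : probability Omega R)
  (F : 'rV[R]_dt -> 'rV[R]_dx -> 'rV[R]_dt).
Hypothesis F_meas : measurable_fun setT (fun z : 'rV[R]_dt * 'rV[R]_dx => F z.1 z.2).
Variable alpha : nat -> R.
Hypothesis alpha_gt0 : forall n, 0 < alpha n.
Variables (theta : nat -> Omega -> 'rV[R]_dt) (xi : nat -> Omega -> 'rV[R]_dx).
Hypothesis theta0_meas : measurable_fun setT (theta 0%N).
Variable Pi : 'rV[R]_dt -> R.-pker 'rV[R]_dx ~> 'rV[R]_dx.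
Hypothesis xi_markov : controlled_markov P theta xi Pi.
Hypothesis theta_rec : forall n w,
  theta n.+1 w = theta n w - alpha n *: F (theta n w) (xi n.+1 w).
Hypothesis alpha_cvg0 : alpha @ \oo --> 0.
Hypothesis alpha_inv :
  (limn_esup (fun n => `|(alpha n.+1)^-1 - (alpha n)^-1|%:E) < +oo)%E.
Hypothesis alpha_sum : (\sum_(0 <= n <oo) (alpha n)%:E = +oo)%E.
Variables (r : R).
Hypothesis r_gt0 : 0 < r.
Hypothesis alpha_gamma_sum :
  (\sum_(0 <= n <oo) (alpha n ^+ 2 * series alpha n `^ (2 * r))%:E < +oo)%E.
Variable G : 'rV[R]_dt -> 'rV[R]_dt.
Hypothesis G_cont : continuous G.
Variable Ft : 'rV[R]_dt -> 'rV[R]_dx -> 'rV[R]_dt.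
Hypothesis Ft_meas : measurable_fun setT (fun z : 'rV[R]_dt * 'rV[R]_dx => Ft z.1 z.2).
Hypothesis Ft_int : kernel_integrable Pi Ft.
Hypothesis poisson : forall t x, F t x - G t = Ft t x - kernel_average Pi Ft t x.
Variable phi : set 'rV[R]_dt -> R -> 'rV[R]_dx -> R.
Hypothesis phi_meas : forall Q s, compact Q -> 0 < s < 1 ->
  measurable_fun setT (phi Q s).
Hypothesis phi_ge1 : forall Q s x, compact Q -> 0 < s < 1 -> 1 <= phi Q s x.
Hypothesis phi_bound : forall Q s t x, compact Q -> 0 < s < 1 -> Q t ->
  Num.max (Num.max (enorm (F t x)) (enorm (Ft t x)))
    (enorm (kernel_average Pi Ft t x)) <= phi Q s x.
Hypothesis phi_hoelder : forall Q s t' t'' x, compact Q -> 0 < s < 1 -> Q t' -> Q t'' ->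
  enorm (kernel_average Pi Ft t' x - kernel_average Pi Ft t'' x)
    <= phi Q s x * enorm (t' - t'') `^ s.
Hypothesis phi_moment : forall Q s, compact Q -> 0 < s < 1 ->
  exists g : nat -> 'rV[R]_dt * 'rV[R]_dx -> \bar R,
    (forall n, is_cond_expectation_at P
       (fun w => (theta 0%N w, xi 0%N w))
       (fun w => (phi Q s (xi n w) ^+ 2 *
          \1_[set w' | (n%:R%:E <= exit_time (theta^~ w') Q)%E] w)%:E)
       (g n)) /\
    (forall t x, (ereal_sup (range (fun n => g n (t, x))) < +oo)%E).

Let ka := kernel_average Pi Ft.

Let coord_meas (H : 'rV[R]_dt -> 'rV[R]_dx -> 'rV[R]_dt) i :
  measurable_fun setT (fun z : 'rV[R]_dt * 'rV[R]_dx => H z.1 z.2) ->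
  measurable_fun setT (fun z : 'rV[R]_dt * 'rV[R]_dx => H z.1 z.2 ord0 i).
Proof. by move=> mH; apply: (measurableT_comp (measurable_coord i) mH). Qed.

Lemma theta_meas n : measurable_fun setT (theta n).
Proof.
elim: n => // n IH; apply: measurable_fun_rV => i.
have mF : measurable_fun setT (fun w => F (theta n w) (xi n.+1 w) ord0 i).
  apply: (measurableT_comp (coord_meas i F_meas)
    (g := fun w => (theta n w, xi n.+1 w))).
  by apply: measurable_fun_pair => //; exact: xi_markov.1.
under eq_fun do rewrite theta_rec !mxE.
apply: measurable_funB.
  exact: (measurableT_comp (measurable_coord i) IH).
by apply: measurable_funM => //; exact: measurable_cst.
Qed.

(** The Poisson equation expresses the average through measurable functions,
    although Pi itself need not be measurable in theta. *)
Lemma average_meas i :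
  measurable_fun setT (fun z : 'rV[R]_dt * 'rV[R]_dx => ka z.1 z.2 ord0 i).
Proof.
have -> : (fun z => ka z.1 z.2 ord0 i) =
    (fun z => Ft z.1 z.2 ord0 i - F z.1 z.2 ord0 i + G z.1 ord0 i).
  apply: funext => z; have /rowP/(_ i) := poisson z.1 z.2.
  by rewrite /ka !mxE; lra.
apply: measurable_funD.
  by apply: measurable_funB; exact: coord_meas.
apply: (measurableT_comp (f := fun t => G t ord0 i) _ measurable_fst).
apply: continuous_rV_measurable => t.
apply: (@continuous_comp _ _ _ G (fun y => y ord0 i) t); first exact: G_cont.
exact: coord_continuous.
Qed.

Section localized.
Variable Q : set 'rV[R]_dt.
Hypothesis cQ : compact Q.
Variable K : nat.
Variable g : nat -> 'rV[R]_dt * 'rV[R]_dx -> \bar R.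
Let s := hexp r.
Let s01 : 0 < s < 1. Proof. exact: hexp_range. Qed.
Let ph := phi Q s.
Hypothesis g_cond : forall n, is_cond_expectation_at P
  (fun w => (theta 0%N w, xi 0%N w))
  (fun w => (ph (xi n w) ^+ 2 *
     \1_[set w' | (n%:R%:E <= exit_time (theta^~ w') Q)%E] w)%:E) (g n).

Definition start_set : set Omega :=
  [set w | forall n, (g n (theta 0%N w, xi 0%N w) <= K%:R%:E)%E].

(** stay_set n.+1 is decided by the past at time n, so an increment restricted
    to it keeps conditional mean zero. *)
Definition stay_set (n : nat) : set Omega :=
  start_set `&` [set w | forall k, (k < n)%N -> Q (theta k w)].

Lemma exit_timeP n w : (n%:R%:E <= exit_time (theta^~ w) Q)%E <->
  forall k, (k < n)%N -> Q (theta k w).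
Proof.
split=> [/ereal_infP H k kn|H].
  apply: contrapT => nQ; have := H k%:R%:E (ex_intro2 _ _ k nQ erefl).
  by rewrite lee_fin ler_nat leqNgt kn.
apply/ereal_infP => _ [k nQ <-]; rewrite lee_fin ler_nat leqNgt.
by apply/negP => kn; apply: nQ; exact: H.
Qed.

Let Z0 w := (theta 0%N w, xi 0%N w).
Let D0 : set ('rV[R]_dt * 'rV[R]_dx) := [set z | forall n, (g n z <= K%:R%:E)%E].

Let D0_meas : measurable D0.
Proof.
have -> : D0 = \bigcap_n [set z | (g n z <= K%:R%:E)%E].
  by apply/seteqP; split=> z H n; [move=> _; exact: H|exact: H].
apply: bigcapT_measurable => n; rewrite -[X in measurable X]setTI.
have [mgn _] := g_cond n.
exact: (measurable_lee measurableT mgn (measurable_cst _)).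
Qed.

Lemma start_set_past n : <<s past theta xi n >> start_set.
Proof.
have mZ : measurable_fun (setT : set (pastType theta xi n)) (Z0 : pastType theta xi n -> _).
  by apply: measurable_fun_pair; [exact: past_theta|exact: past_xi].
by have := mZ measurableT D0 D0_meas; rewrite setTI.
Qed.

Lemma stay_set_past n : <<s past theta xi n >> (stay_set n.+1).
Proof.
apply: (@measurableI _ (pastType theta xi n)); first exact: start_set_past.
have -> : [set w | forall k, (k < n.+1)%N -> Q (theta k w)] =
    \bigcap_(k in [set k | (k <= n)%N]) (theta k @^-1` Q).
  by apply/seteqP; split=> w H k kn; apply: H.
apply: (@bigcap_measurable _ (pastType theta xi n)); first by exists 0%N.
move=> k /= kn; have mQ : measurable Q.
  by apply: closed_rV_measurable; apply: compact_closed => //; exact: norm_hausdorff.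
have mth : measurable_fun (setT : set (pastType theta xi n))
  (theta k : pastType theta xi n -> _) by exact: past_theta.
by have := mth measurableT Q mQ; rewrite setTI.
Qed.

Let psub n := @past_sub _ _ _ _ _ P theta xi Pi xi_markov theta_meas n.

Lemma stay_set_meas n : measurable (stay_set n).
Proof.
case: n => [|n]; last by apply: (@psub n); exact: stay_set_past.
rewrite /stay_set (_ : [set w | _] = setT) ?setIT.
  by apply: (@psub 0%N); exact: start_set_past.
by apply/seteqP; split=> // w _ k.
Qed.

Let ph_meas n : measurable_fun setT (fun w => ph (xi n w)).
Proof.
apply: (measurableT_comp (f := ph)); first exact: phi_meas.
exact: xi_markov.1.
Qed.

Let ph_ge1 x : 1 <= ph x. Proof. exact: phi_ge1. Qed.

(** start_set is an event about the initial condition, over which the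
    conditional moments given the initial condition are at most K. *)
Lemma localized_moment n :
  (\int[P]_w (\1_(stay_set n) w * ph (xi n w) ^+ 2)%:E <= K%:R%:E)%E.
Proof.
have [mg [gZ0 _ gA]] := g_cond n.
have mS : measurable start_set by apply: (@psub 0%N); exact: start_set_past.
have mSZ : g_sigma_algebra_preimage Z0 start_set.
  by exists D0 => //; rewrite setTI.
have -> : (\int[P]_w (\1_(stay_set n) w * ph (xi n w) ^+ 2)%:E =
    \int[P]_(w in start_set) (ph (xi n w) ^+ 2 *
     \1_[set w' | (n%:R%:E <= exit_time (theta^~ w') Q)%E] w)%:E)%E.
  rewrite [RHS]integral_mkcond; apply: eq_integral => w _.
  rewrite /patch /stay_set !indicE in_setI; case: ifP => _ /=; last by rewrite mul0r.
  rewrite mulrC; congr (_ * _)%:E; congr (nat_of_bool _)%:R.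
  by apply/idP/idP; rewrite !inE => /exit_timeP.
rewrite -gA//; apply: (@le_trans _ _ (\int[P]_(w in start_set) cst K%:R%:E w)%E).
  apply: ge0_le_integral => //.
  - apply: measurable_funTS; apply: (measurableT_comp mg).
    by apply: measurable_fun_pair; [exact: theta_meas|exact: xi_markov.1].
  - by move=> w; exact.
rewrite integral_cst// -[leRHS]mule1; apply: lee_wpmul2l.
  by rewrite lee_fin ler0n.
exact: probability_le1.
Qed.

Lemma stay_set_mono n : stay_set n.+1 `<=` stay_set n.
Proof. by move=> w [Sw H]; split=> // k kn; apply: H; exact: ltnW. Qed.

(** A summable weight makes the second moments summable in mean, hence almost
    surely, on the localization event. *)
Lemma ae_moment_series (b : nat -> R) : (forall n, 0 <= b n) -> bounded_series b ->
  {ae P, forall w, start_set w -> (forall n, Q (theta n w)) ->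
    bounded_series (fun n => b n * ph (xi n.+1 w) ^+ 2)}.
Proof.
move=> b0 [C bC].
pose u n w := ((b n)%:E * (\1_(stay_set n.+1) w * ph (xi n.+1 w) ^+ 2)%:E)%E.
have u0 n w : (0 <= u n w)%E.
  by rewrite /u -EFinM lee_fin mulr_ge0 ?b0// mulr_ge0 ?sqr_ge0.
have mi n : measurable_fun setT (fun w => (\1_(stay_set n.+1) w * ph (xi n.+1 w) ^+ 2)%:E).
  apply/measurable_EFinP; apply: measurable_funM; last exact: measurable_funX.
  by apply: measurable_indic; exact: stay_set_meas.
have mu n : measurable_fun setT (u n).
  by apply: emeasurable_funM => //; exact: measurable_cst.
have C0 : 0 <= C by apply: le_trans (bC 0%N); rewrite /series/= big_geq.
have fin : (\int[P]_w \sum_(0 <= n <oo) u n w <= (C * K%:R)%:E)%E.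
  rewrite integral_nneseries//; apply: lime_le.
    by apply: is_cvg_nneseries => n _ _; exact: integral_ge0.
  apply: nearW => n.
  apply: (@le_trans _ _ (\sum_(0 <= i < n) (b i * K%:R)%:E)%E).
    apply: lee_sum => i _; rewrite ge0_integralZl//; last first.
    - by rewrite lee_fin.
    - by move=> w _; rewrite lee_fin mulr_ge0 ?sqr_ge0.
    by rewrite EFinM; apply: lee_wpmul2l; rewrite ?lee_fin//; exact: localized_moment.
  by rewrite sumEFin lee_fin -mulr_suml ler_wpM2r// bC.
have mU : measurable_fun setT (fun w => (\sum_(0 <= n <oo) u n w)%E).
  by apply: (@ge0_emeasurable_sum _ _ _ _ u xpredT).
have U0 w : (0 <= \sum_(0 <= n <oo) u n w)%E by apply: nneseries_ge0.
have iU : P.-integrable setT (fun w => (\sum_(0 <= n <oo) u n w)%E).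
  apply/integrableP; split=> //; under eq_integral do rewrite gee0_abs//.
  by apply: le_lt_trans fin _; rewrite ltry.
have := integrable_ae measurableT iU; apply: filterS => w /(_ Logic.I) fU Sw Qw.
apply: bounded_series_ereal; first by move=> n; rewrite mulr_ge0 ?sqr_ge0.
have -> : (\sum_(0 <= n <oo) (b n * ph (xi n.+1 w) ^+ 2)%:E = \sum_(0 <= n <oo) u n w)%E.
  apply: eq_eseriesr => n _; rewrite /u -EFinM; congr EFin.
  have st : stay_set n.+1 w by split.
  by rewrite indicE (mem_set st) mul1r.
by move: fU; rewrite ge0_fin_numE.
Qed.

Variable i : 'I_dt.
Let gt z := Ft z.1 z.2 ord0 i.
Let inc n w := gt (theta n w, xi n.+1 w) - ka (theta n w) (xi n w) ord0 i.

Let gt_meas : measurable_fun setT gt. Proof. exact: coord_meas. Qed.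

Let gt_meas_along n : measurable_fun setT (fun w => gt (theta n w, xi n.+1 w)).
Proof.
apply: (measurableT_comp gt_meas); apply: measurable_fun_pair; first exact: theta_meas.
exact: xi_markov.1.
Qed.

Let ka_meas_past n : measurable_fun (setT : set (pastType theta xi n))
  ((fun w => ka (theta n w) (xi n w) ord0 i) : pastType theta xi n -> R).
Proof.
apply: (@measurableT_comp _ _ _ (pastType theta xi n) _ _ (fun z => ka z.1 z.2 ord0 i) setT
  (fun w => (theta n w, xi n w))); first exact: average_meas.
by apply: measurable_fun_pair; [exact: past_theta|exact: past_xi].
Qed.

Let ka_meas n : measurable_fun setT (fun w => ka (theta n w) (xi n w) ord0 i).
Proof. apply: (sub_measurable_fun (@psub n)); exact: ka_meas_past. Qed.

Let gt_le n w : stay_set n.+1 w -> `|gt (theta n w, xi n.+1 w)| <= ph (xi n.+1 w).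
Proof.
move=> [_ H]; apply: le_trans (coord_le_enorm _ _) _.
have := phi_bound (xi n.+1 w) cQ s01 (H n (leqnn _)).
by rewrite !ge_max => /andP[/andP[_ h] _].
Qed.

Let ka_le n w x : stay_set n.+1 w -> `|ka (theta n w) x ord0 i| <= ph x.
Proof.
move=> [_ H]; apply: le_trans (coord_le_enorm _ _) _.
have := phi_bound x cQ s01 (H n (leqnn _)).
by rewrite !ge_max => /andP[_ h].
Qed.

Let le_sqr x : 1 <= x -> x <= x ^+ 2 :> R.
Proof. by move=> x1; rewrite expr2 ler_peMl//; lra. Qed.

Let integrable_stay (h : Omega -> R) m c : measurable_fun setT h ->
  (forall w, `|h w| <= c * (\1_(stay_set m) w * ph (xi m w) ^+ 2)) -> 0 <= c ->
  P.-integrable setT (fun w => (h w)%:E).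
Proof.
move=> mh hc c0; have mm : measurable_fun setT (fun w => (\1_(stay_set m) w * ph (xi m w) ^+ 2)%:E).
  apply/measurable_EFinP; apply: measurable_funM; last exact: measurable_funX.
  by apply: measurable_indic; exact: stay_set_meas.
have p0 w : 0 <= \1_(stay_set m) w * ph (xi m w) ^+ 2 by rewrite mulr_ge0 ?sqr_ge0.
apply/integrableP; split; first exact/measurable_EFinP.
apply: (@le_lt_trans _ _ (\int[P]_w (c%:E * (\1_(stay_set m) w * ph (xi m w) ^+ 2)%:E))%E).
  apply: ge0_le_integral => //.
  - by apply: measurableT_comp => //; exact/measurable_EFinP.
  - by apply: emeasurable_funM => //; exact: measurable_cst.
  - by move=> w _; rewrite -EFinM lee_fin; exact: hc.
rewrite ge0_integralZl//.
apply: (@le_lt_trans _ _ (c%:E * K%:R%:E)%E); last by rewrite -EFinM ltry.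
  by apply: lee_wpmul2l; [rewrite lee_fin|exact: localized_moment].
by move=> w _; rewrite lee_fin.
Qed.

(** The indicator of stay_set, known at time n, makes the increment integrable;
    W is nonnegative, as the transfer of conditional means requires. *)
Lemma localized_mean_zero n (W : Omega -> R) C :
  measurable_fun (setT : set (pastType theta xi n)) (W : pastType theta xi n -> R) ->
  (forall w, 0 <= W w <= C) ->
  P.-integrable setT (fun w => (W w * \1_(stay_set n.+1) w * inc n w)%:E) /\
  (\int[P]_w (W w * \1_(stay_set n.+1) w * inc n w)%:E = 0)%E.
Proof.
move=> mW WC; pose Z w := W w * \1_(stay_set n.+1) w.
have mZ : measurable_fun (setT : set (pastType theta xi n)) (Z : pastType theta xi n -> R).
  apply: measurable_funM => //; apply: (@measurable_indic _ (pastType theta xi n)).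
  exact: stay_set_past.
have W0 w : 0 <= W w by have /andP[] := WC w.
have C0 : 0 <= C by have /andP[h1 h2] := WC point; exact: le_trans h2.
have Z0' w : 0 <= Z w by rewrite mulr_ge0.
have mZT := sub_measurable_fun (@psub n) mZ.
have iZ : P.-integrable setT (fun w => (Z w * gt (theta n w, xi n.+1 w))%:E).
  apply: (@integrable_stay _ n.+1 C) => //; first exact: measurable_funM.
  move=> w; rewrite /Z indicE; case: (boolP (w \in _)) => [/set_mem sw|_]; last first.
    by rewrite mulr0 !mul0r normr0 mulr0.
  rewrite mulr1 mul1r normrM ger0_norm//; have /andP[_ WCw] := WC w.
  apply: ler_pM => //; apply: le_trans (gt_le sw) _; exact: le_sqr.
have avgE t x : (\int[Pi t x]_y gt (t, y))%R = ka t x ord0 i.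
  by rewrite /ka /kernel_average mxE.
have mavg : measurable_fun setT (fun w => \int[Pi (theta n w) (xi n w)]_y gt (theta n w, y))%R.
  by under eq_fun do rewrite avgE; exact: ka_meas.
have [iA EA] := one_step_mean xi_markov theta_meas gt_meas
  (fun t x => Ft_int t x i) mavg mZ Z0' iZ.
have eA : (fun w => (Z w * \int[Pi (theta n w) (xi n w)]_y gt (theta n w, y))%:E) =
    (fun w => (Z w * ka (theta n w) (xi n w) ord0 i)%:E).
  by apply: funext => w; rewrite avgE.
rewrite eA in iA EA.
have eI : (fun w => (W w * \1_(stay_set n.+1) w * inc n w)%:E) =
   (fun w => (Z w * gt (theta n w, xi n.+1 w))%:E -
             (Z w * ka (theta n w) (xi n w) ord0 i)%:E)%E.
  by apply: funext => w; rewrite -EFinB -mulrBr.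
rewrite eI; split; first exact: integrableB.
rewrite integralB// EA subee//; exact: integrable_fin_num.
Qed.

Let c := weight alpha r.
Let c0 n : 0 <= c n. Proof. exact: weight_ge0. Qed.

Lemma ae_martingale_part : {ae P, forall w, start_set w -> (forall n, Q (theta n w)) ->
  cvgn (series (fun n => c n * inc n w))}.
Proof.
pose X n w := c n * \1_(stay_set n.+1) w * inc n w.
pose v n := 4 * K%:R * c n ^+ 2.
have : {ae P, forall w, cvgn (series (fun n => X n w))}.
  apply: (@l2_series_cvg _ _ _ P (past theta xi) psub _ X v).
  - by move=> n; apply: past_mono.
  - move=> n; apply: measurable_funM; first apply: measurable_funM.
    + exact: measurable_cst.
    + apply: (@measurable_indic _ (pastType theta xi n.+1)).
      change (<<s past theta xi n.+1 >> (stay_set n.+1)).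
      by apply: (past_mono (leqnSn n)); exact: stay_set_past.
    + apply: measurable_funB; last first.
        apply: (past_measurable_mono (leqnSn n)); exact: ka_meas_past.
      apply: (@measurableT_comp _ _ _ (pastType theta xi n.+1) _ _ gt setT
        (fun w => (theta n w, xi n.+1 w))) => //.
      by apply: measurable_fun_pair; [exact: past_theta|exact: past_xi].
  - move=> n.
    have mi m : measurable_fun setT (fun w => (\1_(stay_set m) w * ph (xi m w) ^+ 2)%:E).
      apply/measurable_EFinP; apply: measurable_funM; last exact: measurable_funX.
      by apply: measurable_indic; exact: stay_set_meas.
    have p0 m w : (0 <= (\1_(stay_set m) w * ph (xi m w) ^+ 2)%:E)%E.
      by rewrite lee_fin mulr_ge0 ?sqr_ge0.
    have k0 : (0 <= (2 * c n ^+ 2)%:E)%E by rewrite lee_fin mulr_ge0 ?sqr_ge0.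
    apply: (@le_trans _ _ (\int[P]_w ((2 * c n ^+ 2)%:E *
      ((\1_(stay_set n.+1) w * ph (xi n.+1 w) ^+ 2)%:E +
       (\1_(stay_set n) w * ph (xi n w) ^+ 2)%:E)))%E).
      apply: ge0_le_integral => //.
      + by move=> w _; rewrite lee_fin sqr_ge0.
      + apply/measurable_EFinP; apply: measurable_funX.
        apply: measurable_funM; last exact: measurable_funB.
        apply: measurable_funM => //.
        by apply: measurable_indic; exact: stay_set_meas.
      + by apply: emeasurable_funM => //; exact: emeasurable_funD.
      + move=> w _; rewrite -EFinD -EFinM lee_fin /X.
        rewrite !indicE; case: (boolP (w \in stay_set n.+1)) => [/set_mem sw|_]; last first.
          by rewrite mulr0 mul0r expr0n/= !mul0r add0r; apply: mulr_ge0; rewrite mulr_ge0 ?sqr_ge0.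
        have sw' := stay_set_mono sw.
        rewrite (mem_set sw') mulr1 !mul1r exprMn (mulrC 2) -(mulrA (c n ^+ 2)).
        apply: ler_wpM2l; first exact: sqr_ge0.
        rewrite /inc; move: (gt_le sw) (ka_le (xi n w) sw) => h1 h2.
        move: h1 h2; set a := gt _; set b := ka _ _ _ _; set A := ph _; set B := ph _.
        move=> h1 h2.
        have a2 : a ^+ 2 <= A ^+ 2.
          by rewrite -(real_normK (num_real a)) ler_sqr ?nnegrE// (le_trans _ h1).
        have b2 : b ^+ 2 <= B ^+ 2.
          by rewrite -(real_normK (num_real b)) ler_sqr ?nnegrE// (le_trans _ h2).
        have := sqr_ge0 (a + b); rewrite sqrrD sqrrB !mulr2n; lra.
    rewrite ge0_integralZl//; last 2 first.
    + by apply: emeasurable_funD.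
    + by move=> w _; rewrite adde_ge0.
    rewrite ge0_integralD//.
    have -> : (v n)%:E = ((2 * c n ^+ 2)%:E * (K%:R%:E + K%:R%:E))%E.
      by rewrite -EFinD -EFinM /v; congr EFin; ring.
    by apply: lee_wpmul2l => //; apply: leeD; exact: localized_moment.
  (* the multiplier is shifted by b to become nonnegative *)
  - move=> n Z b mZ Zb.
    have b0 : 0 <= b by apply: le_trans (Zb point).
    have [i1 E1] := @localized_mean_zero n (fun w => (Z w + b) * c n) (2 * b * c n)
      ltac:(by apply: measurable_funM; [apply: measurable_funD => //|]; exact: measurable_cst)
      ltac:(by move=> w; have := Zb w; rewrite ler_norml => /andP[h1 h2];
            rewrite mulr_ge0 ?ler_wpM2r//; lra).
    have [i2 E2] := @localized_mean_zero n (fun w => b * c n) (b * c n)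
      ltac:(exact: measurable_cst) ltac:(by move=> w; rewrite mulr_ge0/=).
    transitivity (\int[P]_w ((((Z w + b) * c n) * \1_(stay_set n.+1) w * inc n w)%:E -
       (b * c n * \1_(stay_set n.+1) w * inc n w)%:E))%E.
      by apply: eq_integral => w _; rewrite -EFinB /X; congr EFin; ring.
    by rewrite integralB// E1 E2 sube0.
  - apply: bounded_seriesZ; first by rewrite mulr_ge0.
    exact: weight_sqr_bounded.
apply: filterS => w cv Sw Qw.
rewrite (_ : (fun n => c n * inc n w) = (fun n => X n w))//.
apply: funext => n; have st : stay_set n.+1 w by split.
by rewrite /X indicE (mem_set st) mulr1.
Qed.

(** The Poisson equation splits the noise into the martingale difference inc
    and B_n = PF(theta_n, xi_n) - PF(theta_n, xi_(n+1)).  The latter is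
    summed by parts, with the Hoelder bound on PF for its drift. *)
Lemma ae_localized_noise : {ae P, forall w, start_set w -> (forall n, Q (theta n w)) ->
  cvgn (series (fun n => c n * (F (theta n w) (xi n.+1 w) - G (theta n w)) ord0 i))}.
Proof.
have sq := @ae_moment_series (fun n => c n ^+ 2) (fun n => sqr_ge0 (c n))
  (weight_sqr_bounded alpha_gamma_sum).
have hx := @ae_moment_series (fun n => c n.+1 * alpha n `^ s)
  (fun n => mulr_ge0 (c0 _) (powR_ge0 _ _))
  (weight_hexp_bounded alpha_gt0 r_gt0 alpha_cvg0 alpha_sum alpha_inv alpha_gamma_sum).
have ic := @ae_moment_series (fun n => `|c n.+1 - c n|) (fun n => normr_ge0 (c n.+1 - c n))
  (weight_increment_bounded alpha_gt0 r_gt0 alpha_cvg0 alpha_sum alpha_inv alpha_gamma_sum).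
apply: filterS3 sq hx (filterI ic ae_martingale_part) => w sqw hxw [icw mw] Sw Qw.
move: (sqw Sw Qw) (hxw Sw Qw) (icw Sw Qw) (mw Sw Qw) => {sqw hxw icw mw} sqw hxw icw mw.
pose u n := ka (theta n w) (xi n.+1 w) ord0 i.
pose H n := (ka (theta n.+1 w) (xi n.+1 w) - ka (theta n w) (xi n.+1 w)) ord0 i.
pose B n := ka (theta n w) (xi n w) ord0 i - u n.
have stay n : stay_set n.+1 w by split.
have ph0 n : 0 <= ph (xi n w) by apply: le_trans (ph_ge1 _).
have ul n : `|u n| <= ph (xi n.+1 w) by exact: ka_le.
have coordB (x y : 'rV[R]_dt) : (x - y) ord0 i = x ord0 i - y ord0 i by rewrite !mxE.
have cvB : cvgn (series (fun n => c n * B n)).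
  apply: (@summation_by_parts_cvg _ c u H B).
  - exact: weight0.
  - by move=> n; rewrite /B /H coordB /u; ring.
  - apply: bounded_series_near_le hxw => //.
      by move=> n; rewrite mulr_ge0 ?sqr_ge0// mulr_ge0 ?powR_ge0.
    apply: nearW => n; rewrite normrM ger0_norm// -(mulrA (c n.+1)); apply: ler_wpM2l => //.
    apply: le_trans (coord_le_enorm _ _) _.
    apply: le_trans (phi_hoelder _ cQ s01 (Qw n.+1) (Qw n)) _; rewrite -/ph.
    have step : enorm (theta n.+1 w - theta n w) <= alpha n * ph (xi n.+1 w).
      rewrite theta_rec addrC addKr enormN enormZ gtr0_norm// ler_wpM2l ?(ltW (alpha_gt0 n))//.
      have := phi_bound (xi n.+1 w) cQ s01 (Qw n).
      by rewrite !ge_max => /andP[/andP[h _] _].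
    have /andP[s0 s1] := s01.
    apply: (@le_trans _ _ (ph (xi n.+1 w) * (alpha n * ph (xi n.+1 w)) `^ s)).
      rewrite ler_wpM2l//; apply: ge0_ler_powR => //; rewrite ?nnegrE ?enorm_ge0//.
      by rewrite ltW.
      by rewrite mulr_ge0// ltW.
    rewrite powRM ?(ltW (alpha_gt0 n))// mulrCA ler_wpM2l ?powR_ge0// expr2 ler_wpM2l//.
    by apply: ler1_powR; [exact: ph_ge1|exact: ltW].
  - apply: bounded_series_near_le icw => //.
      by move=> n; rewrite mulr_ge0 ?sqr_ge0.
    apply: nearW => n; rewrite normrM ler_wpM2l//.
    by apply: le_trans (ul n) _; exact: le_sqr.
  - have /cvg_series_cvg_0 sq0 : cvgn (series (fun n => c n ^+ 2 * ph (xi n.+1 w) ^+ 2)).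
      by apply: bounded_series_cvg => // n; rewrite mulr_ge0 ?sqr_ge0.
    apply/cvgrPdist_le => e e0.
    move/cvgrPdist_le: sq0 => /(_ _ (exprn_gt0 2 e0)); apply: filterS => n.
    rewrite !sub0r !normrN => h.
    rewrite -ler_sqr ?nnegrE ?(ltW e0)//; apply: le_trans h.
    have cph0 : 0 <= c n * ph (xi n.+1 w) by exact: mulr_ge0 (c0 n) (ph0 _).
    rewrite -exprMn (ger0_norm (sqr_ge0 _)) ler_sqr ?nnegrE// normrM (ger0_norm (c0 n)).
    exact: ler_wpM2l (c0 n) _ _ (ul n).
have -> : (fun n => c n * (F (theta n w) (xi n.+1 w) - G (theta n w)) ord0 i) =
    (fun n => c n * inc n w) \+ (fun n => c n * B n).
  by apply: funext => n /=; rewrite poisson coordB -/ka /inc /B /u /gt /=; ring.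
rewrite (_ : series _ = series (fun n => c n * inc n w) \+ series (fun n => c n * B n)).
  exact: (is_cvgD mw cvB).
by apply: funext => n; rewrite /series/= big_split.
Qed.

End localized.

(** Balls of integer radius and integer moment bounds exhaust the bounded
    paths, and they are countably many. *)
Theorem ae_noise_cvg : {ae P, forall w, bounded_path (theta^~ w) -> forall i : 'I_dt,
  cvgn (series (fun n => weight alpha r n *
    (F (theta n w) (xi n.+1 w) - G (theta n w)) ord0 i))}.
Proof.
pose Q (m : nat) : set 'rV[R]_dt := [set x | `|x| <= m%:R].
have cQ m : compact (Q m) by exact: norm_ball_compact.
have /choice[g Hg] := fun m => phi_moment (cQ m) (hexp_range r_gt0).
have : {ae P, forall w, forall m K : nat, forall i : 'I_dt,
    start_set K (g m) w -> (forall n, Q m (theta n w)) ->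
    cvgn (series (fun n => weight alpha r n *
      (F (theta n w) (xi n.+1 w) - G (theta n w)) ord0 i))}.
  apply: ae_foralln => m; apply: ae_foralln => K.
  have H i : {ae P, forall w, start_set K (g m) w -> (forall n, Q m (theta n w)) ->
      cvgn (series (fun n => weight alpha r n *
      (F (theta n w) (xi n.+1 w) - G (theta n w)) ord0 i))}.
    by apply: ae_localized_noise => //; exact: (Hg m).1.
  have : {ae P, forall w, forall j : nat, forall jd : (j < dt)%N,
     start_set K (g m) w -> (forall n, Q m (theta n w)) ->
      cvgn (series (fun n => weight alpha r n *
      (F (theta n w) (xi n.+1 w) - G (theta n w)) ord0 (Ordinal jd)))}.
    apply: ae_foralln => j; have [jd|jd] := pselect (j < dt)%N; last first.
      by apply: nearW => w jd'; case: jd.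
    have := H (Ordinal jd); apply: filterS => w Hw jd'.
    by rewrite (bool_irrelevance jd' jd).
  by apply: filterS => w Hw [j jd]; exact: Hw.
apply: filterS => w Hw bw i.
have [m Hm] : exists m : nat, forall n, Q m (theta n w).
  have [M HM] := bounded_path_norm bw; exists (Num.truncn M).+1 => n.
  by apply: le_trans (HM n) _; apply/ltW/truncnS_gt.
have [K HK] : exists K : nat, start_set K (g m) w.
  have := (Hg m).2 (theta 0%N w) (xi 0%N w).
  set S := ereal_sup _ => Sfin.
  exists (Num.truncn (fine S)).+1 => n.
  apply: (@le_trans _ _ S); first by apply: ereal_sup_ubound; exists n.
  move: Sfin; case: S => [x| |] // _; last by rewrite leNye.
  by rewrite lee_fin /= ltW// truncnS_gt.
exact: (Hw m K i HK Hm).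
Qed.

End noise.

(** * Convergence rates *)

Section single_path.
Context {R : realType} {d : nat}.
Variable f : 'rV[R]_d -> R.
Hypothesis f_diff : forall t, differentiable f t.
Hypothesis grad_lip : locally_lipschitz (grad f).
Variables (al : nat -> R) (r : R).
Hypothesis al_gt0 : forall n, 0 < al n.
Hypothesis r_gt0 : 0 < r.
Hypothesis al_cvg0 : al @ \oo --> 0.
Hypothesis al_sum : (\sum_(0 <= n <oo) (al n)%:E = +oo)%E.
Variables th noise : nat -> 'rV[R]_d.
Hypothesis th_bounded : bounded_path th.
Hypothesis th_rec : forall n, th n.+1 = th n - al n *: (grad f (th n) + noise n).
Hypothesis noise_cvg : forall i : 'I_d,
  cvgn (series (fun n => weight al r n * noise n ord0 i)).
Variables (delta mu M : set 'rV[R]_d -> R -> R) (nu N : set 'rV[R]_d -> R).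
Hypothesis delta_range : forall Q a, compact Q -> (f @` Q) a -> 0 < delta Q a < 1.
Hypothesis mu_range : forall Q a, compact Q -> (f @` Q) a -> 1 < mu Q a <= 2.
Hypothesis M_range : forall Q a, compact Q -> (f @` Q) a -> 1 <= M Q a.
Hypothesis lojasiewicz : forall Q a t, compact Q -> (f @` Q) a -> Q t ->
  `|f t - a| <= delta Q a ->
  `|f t - a| <= M Q a * enorm (grad f t) `^ mu Q a.
Hypothesis nu_range : forall Q, compact Q -> 0 < nu Q <= 1.
Hypothesis N_range : forall Q, compact Q -> 1 <= N Q.
Hypothesis dist_crit : forall Q t, compact Q -> Q t ->
  (edist_set t (crit_points f) <= (N Q * enorm (grad f t) `^ nu Q)%:E)%E.
Variable rho : R.
Hypothesis rho_gt0 : 0 < rho.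

Let ga := series al.
Let Qh := Qhat th rho.
Let l := fhat f th.
Let m := mu Qh l.
Let ph := phat f mu r th rho.
Let qh := qhat f mu nu r th rho.
Let distC n := fine (rdist_set (f (th n)) (crit_values f)).
Let distS n := fine (edist_set (th n) (crit_points f)).

Lemma f_continuous : continuous f.
Proof. by move=> t; exact: differentiable_continuous. Qed.

Lemma path_value_bounded : exists B, forall n, `|f (th n)| <= B.
Proof.
have [B thB] := bounded_path_norm th_bounded.
have [C _ fC] := continuous_compact_bounded f_continuous (@norm_ball_compact R d B).
by exists C => n; apply: fC; exact: thB.
Qed.

Lemma fhat_low e : 0 < e -> \forall n \near \oo, l - e <= f (th n).
Proof. have [C fC] := path_value_bounded; exact: (limn_einf_low fC). Qed.

Lemma fhat_freq e n0 : 0 < e -> exists2 n, (n0 <= n)%N & f (th n) <= l + e.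
Proof. have [C fC] := path_value_bounded; exact: (limn_einf_freq fC). Qed.

Lemma QhatE : Qh = [set y | (edist_set y (acc_points th) <= rho%:E)%E].
Proof. by rewrite /Qh /Qhat asboolT. Qed.

Lemma Qhat_compact : compact Qh.
Proof.
have [B thB] := bounded_path_norm th_bounded; rewrite QhatE; apply: edist_nbhd_compact.
exists (`|B| + 1) => [|y /(acc_points_bounded thB) yB]; first by rewrite ltr_wpDl.
by apply: le_trans yB _; rewrite lerD2r ler_norm.
Qed.

Lemma Qhat_near t y : acc_points th y -> enorm (t - y) <= rho -> Qh t.
Proof.
move=> ay ty; rewrite QhatE; apply/edist_leP => e e0; exists y => //.
by apply: le_lt_trans ty _; rewrite ltrDl.
Qed.

Lemma Qhat_eventually : \forall n \near \oo, Qh (th n).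
Proof.
have [B thB] := bounded_path_norm th_bounded.
have d0 : 0 < d%:R + 1 :> R by rewrite ltr_wpDl.
have := near_acc_points thB (divr_gt0 rho_gt0 d0); apply: filterS => n [y ay].
rewrite ltr_pdivlMr// => /ltW ny; apply: Qhat_near ay _.
apply: le_trans (enorm_le_norm _) _; apply: le_trans ny.
by rewrite mulrC ler_wpM2l// lerDl.
Qed.

Lemma fhat_acc_value : exists2 y, acc_points th y & f y = l.
Proof.
have [B thB] := bounded_path_norm th_bounded; apply: (acc_points_value thB f_continuous) => e n0 e0.
have [n1 _ low] := fhat_low e0; have [n n01 up] := fhat_freq (maxn n0 n1) e0.
move: n01; rewrite geq_max => /andP[n0n n1n]; exists n => //.
by have /= lown := low n n1n; rewrite ler_norml; apply/andP; split; lra.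
Qed.

Lemma fhat_in : (f @` Qh) l.
Proof.
have [y ay fy] := fhat_acc_value; exists y => //; apply: Qhat_near ay _.
by rewrite subrr enorm0 ltW.
Qed.

Let m1 : 1 < m. Proof. by have /andP[] := mu_range Qhat_compact fhat_in. Qed.
Let m2 : m <= 2. Proof. by have /andP[] := mu_range Qhat_compact fhat_in. Qed.
Let nuQ_gt0 : 0 < nu Qh. Proof. by have /andP[] := nu_range Qhat_compact. Qed.
Let N0 : 0 < N Qh. Proof. exact: lt_le_trans (N_range Qhat_compact). Qed.

Lemma muhatE : muhat f mu th rho = m.
Proof. by rewrite /muhat asboolT. Qed.

Let ga_oo : ga @ \oo --> +oo. Proof. exact: gamma_cvgy. Qed.

Lemma noise_remainder : exists2 e : nat -> 'rV[R]_d,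
  forall n, e n.+1 = e n - al n *: noise n &
  forall k, 0 < k -> \forall n \near \oo, enorm (e n) <= k * ga n `^ (- r).
Proof.
have /choice[W HW] := fun i => @weighted_tail R al r al_gt0 r_gt0 al_sum
  (fun n => noise n ord0 i) (@noise_cvg i).
exists (fun n => \row_i (W i - series (fun j => al j * noise j ord0 i) n)).
  by move=> n; apply/rowP => i; rewrite !mxE /series/= big_nat_recr//=; ring.
move=> k k0; have d0 : 0 < d%:R + 1 :> R by rewrite ltr_wpDl.
have H : \forall n \near \oo, forall i,
    `|W i - series (fun j => al j * noise j ord0 i) n| <= k / (d%:R + 1) * ga n `^ (- r).
  by apply: filter_forall => i; apply: HW; rewrite divr_gt0.
apply: filterS H => n Hn; apply: le_trans (enorm_le_sum _) _.
apply: (@le_trans _ _ (\sum_(i < d) k / (d%:R + 1) * ga n `^ (- r))).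
  by apply: ler_sum => i _; rewrite mxE; exact: Hn.
rewrite sumr_const card_ord -[leLHS]mulr_natl mulrA ler_wpM2r ?powR_ge0//.
rewrite mulrCA ler_piMr ?(ltW k0)// ler_pdivrMr// mul1r; lra.
Qed.

Lemma smaller_rate (e : nat -> 'rV[R]_d) s : s <= r ->
  (forall k, 0 < k -> \forall n \near \oo, enorm (e n) <= k * ga n `^ (- r)) ->
  forall k, 0 < k -> \forall n \near \oo, enorm (e n) <= k * ga n `^ (- s).
Proof.
move=> sr He k k0; near=> n.
have g1 : 1 <= ga n by near: n; exact: near_gamma_ge ga_oo 1.
apply: (@le_trans _ _ (k * ga n `^ (- r))); first by near: n; exact: He.
by rewrite ler_wpM2l ?(ltW k0)//; apply: ler_powR => //; rewrite lerN2.
Unshelve. all: by end_near. Qed.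

Lemma path_rates s : 0 < s -> s <= r -> (2 - m) * s <= 1 ->
  ((2 - m) * s < 1 -> forall k, 0 < k -> \forall n \near \oo,
     enorm (grad f (th n)) ^+ 2 <= k * ga n `^ (- (m * s)) /\
     `|f (th n) - l| <= k * ga n `^ (- (m * s))) /\
  (m < 2 -> exists2 k, 0 < k & \forall n \near \oo,
     enorm (grad f (th n)) ^+ 2 <= k * ga n `^ (- (m * s)) /\
     `|f (th n) - l| <= k * ga n `^ (- (m * s))).
Proof.
move=> s0 sr ms; have [B thB] := bounded_path_norm th_bounded.
have [e eS e_r] := noise_remainder; have e_s := smaller_rate sr e_r.
have step n : th n.+1 - e n.+1 = th n - e n - al n *: grad f (th n).
  by rewrite th_rec eS scalerDr; apply/rowP => i; rewrite !mxE; ring.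
have M0 : 0 < M Qh l by exact: lt_le_trans (M_range Qhat_compact fhat_in).
have /andP[del0 _] := delta_range Qhat_compact fhat_in.
have loja t : (exists2 y, acc_points th y & enorm (t - y) <= rho) ->
    `|f t - l| <= delta Qh l -> `|f t - l| <= M Qh l * enorm (grad f t) `^ m.
  move=> [y ay ty]; exact: lojasiewicz Qhat_compact fhat_in (Qhat_near ay ty).
have gaS := gammaS al; have al0 := near_alpha_le al_gt0 al_cvg0.
split=> [ms1 k k0|m_lt2].
  exact: (path_rate_o f_diff grad_lip al_gt0 al0 gaS ga_oo thB step s0 m1 m2 M0 del0
    rho_gt0 ms e_s fhat_low fhat_freq loja ms1 k0).
exact: (path_rate_O f_diff grad_lip al_gt0 al0 gaS ga_oo thB step s0 m1 m2 M0 del0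
    rho_gt0 ms e_s fhat_low fhat_freq loja m_lt2).
Qed.

Lemma fine_bounds (x : \bar R) k : (0 <= x)%E -> (x <= k%:E)%E -> 0 <= fine x <= k.
Proof.
move=> x0 xk; rewrite fine_ge0//= -lee_fin fineK// ge0_fin_numE//.
exact: le_lt_trans xk (ltry _).
Qed.

(** The value l is attained at an accumulation point, where the gradient
    vanishes by continuity. *)
Lemma fhat_critical : (forall k, 0 < k -> \forall n \near \oo, enorm (grad f (th n)) ^+ 2 <= k) ->
  crit_values f l.
Proof.
move=> H; have [y ay fy] := fhat_acc_value; exists y => //; apply: enorm_eq0.
apply/eqP; rewrite eq_le enorm_ge0 andbT; apply/ler_addgt0Pr => e e0; rewrite add0r.
have cg : continuous (fun t => enorm (grad f t)).
  move=> t; apply: continuous_comp; last exact: enorm_continuous.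
  exact: locally_lipschitz_continuous.
have e2 : 0 < e / 2 by lra.
have [n0 _ Hn0] := H _ (exprn_gt0 2 e2).
have A : (th @ \oo) (th @` [set n | (n0 <= n)%N]) by exists n0 => // n /= n0n; exists n.
have U : nbhs y [set t | `|enorm (grad f y) - enorm (grad f t)| <= e / 2].
  by move: (cg y) => /cvgrPdist_le; exact.
have [t [[n /= n0n <-]] /= tU] := ay _ _ A U.
have h1 : enorm (grad f (th n)) <= e / 2.
  by rewrite -ler_sqr ?nnegrE ?enorm_ge0 ?(ltW e2)//; exact: Hn0.
by have := ler_norm (enorm (grad f y) - enorm (grad f (th n))); lra.
Qed.

(** Nonnegativity is included because asymptotic comparison is of absolute values. *)
Definition rates k k' a b n :=
  [/\ enorm (grad f (th n)) ^+ 2 <= k * ga n `^ (- a),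
      0 <= distC n <= k * ga n `^ (- a) &
      0 <= distS n <= k' * ga n `^ (- b)].

Lemma distance_rates s k : 0 < s -> 0 < k ->
  (\forall n \near \oo, enorm (grad f (th n)) ^+ 2 <= k * ga n `^ (- (m * s)) /\
     `|f (th n) - l| <= k * ga n `^ (- (m * s))) ->
  \forall n \near \oo, rates k (N Qh * k `^ (nu Qh / 2)) (m * s) (m * nu Qh / 2 * s) n.
Proof.
move=> s0 k0 H; have ms0 : 0 < m * s by rewrite mulr_gt0// (lt_trans _ m1).
have Cl : crit_values f l.
  apply: fhat_critical => e e0.
  have := near_powRN_le ga_oo ms0 (divr_gt0 e0 k0); apply: filterS2 H => n [h _].
  by rewrite ler_pdivlMr// mulrC => /(le_trans h).
near=> n.
have [h1 h2] : enorm (grad f (th n)) ^+ 2 <= k * ga n `^ (- (m * s)) /\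
     `|f (th n) - l| <= k * ga n `^ (- (m * s)) by near: n.
have Qn : Qh (th n) by near: n; exact: Qhat_eventually.
split=> //; apply: fine_bounds.
- by apply: le_ereal_inf_tmp => _ [y _ <-]; rewrite lee_fin.
- apply: ge_ereal_inf; exists (`|f (th n) - l|)%:E; first by exists l.
  by rewrite lee_fin.
- by apply: le_ereal_inf_tmp => _ [y _ <-]; rewrite lee_fin enorm_ge0.
apply: le_trans (dist_crit Qhat_compact Qn) _; rewrite lee_fin -mulrA.
rewrite ler_wpM2l ?(ltW N0)//.
have -> : enorm (grad f (th n)) `^ nu Qh = (enorm (grad f (th n)) ^+ 2) `^ (nu Qh / 2).
  rewrite -powR_mulrn ?enorm_ge0// -powRrM; congr powR; lra.
have -> : ga n `^ (- (m * nu Qh / 2 * s)) = (ga n `^ (- (m * s))) `^ (nu Qh / 2).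
  rewrite -powRrM; congr powR; lra.
rewrite -powRM ?powR_ge0 ?(ltW k0)//; apply: ge0_ler_powR => //.
- by rewrite ltW// divr_gt0.
- by rewrite nnegrE sqr_ge0.
- by rewrite nnegrE mulr_ge0 ?powR_ge0// ltW.
Unshelve. all: by end_near. Qed.

Lemma qhatE s : fine (Order.min r%:E (rhat f mu th rho)) = s ->
  ph = m * s /\ qh = m * nu Qh / 2 * s.
Proof.
by move=> <-; rewrite /ph /qh /phat /qhat /nuhat muhatE asboolT.
Qed.

(** For r < rhat the noise decides: the rate is taken at s = r, below the
    critical exponent, so every constant k is reached. *)
Lemma path_rates_slow_noise : (r%:E < rhat f mu th rho)%E ->
  Num.min 1 r < ph /\
  forall k, 0 < k -> \forall n \near \oo, rates k k ph qh n.
Proof.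
move=> rr; have [] := @qhatE r; first by rewrite min_l// ltW.
move=> -> ->; split.
  apply: le_lt_trans (_ : r < _); first by rewrite ge_min lexx orbT.
  by rewrite ltr_pMl.
have mr : (2 - m) * r < 1.
  move: rr; rewrite /rhat muhatE; case: ifPn => [m_lt2|]; last first.
    rewrite -leNgt => h _; have -> : m = 2 by apply/le_anti; rewrite m2 h.
    by rewrite subrr mul0r.
  by rewrite lte_fin -[_^-1]mul1r ltr_pdivlMr ?subr_gt0// mulrC.
move=> k k0; pose k' := Num.min k ((k / N Qh) `^ (2 / nu Qh)).
have k'0 : 0 < k' by rewrite lt_min k0 powR_gt0// divr_gt0.
have := distance_rates r_gt0 k'0 ((path_rates r_gt0 (lexx r) (ltW mr)).1 mr _ k'0).
apply: filterS => n [h1 /andP[h2 h3] /andP[h4 h5]].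
have kk : k' * ga n `^ (- (m * r)) <= k * ga n `^ (- (m * r)).
  by rewrite ler_wpM2r ?powR_ge0// ge_min lexx.
split; first exact: le_trans h1 kk.
  by rewrite h2 (le_trans h3 kk).
rewrite h4 (le_trans h5)// ler_wpM2r ?powR_ge0// mulrC -ler_pdivlMr//.
apply: (@le_trans _ _ (((k / N Qh) `^ (2 / nu Qh)) `^ (nu Qh / 2))).
  apply: ge0_ler_powR; rewrite ?nnegrE ?powR_ge0 ?(ltW k'0)//.
    by rewrite ltW// divr_gt0.
  by rewrite ge_min lexx orbT.
rewrite -powRrM (_ : 2 / nu Qh * (nu Qh / 2) = 1) ?powRr1// ?ltW ?divr_gt0//.
by field; rewrite gt_eqF.
Qed.

(** For rhat <= r the drift decides: s = 1 / (2 - mu) is the critical exponent. *)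
Lemma path_rates_fast_noise : (rhat f mu th rho <= r%:E)%E ->
  Num.min 1 r < ph /\
  exists2 k, 0 < k & \forall n \near \oo, rates k k ph qh n.
Proof.
move=> rr; have : m < 2 by move: rr; rewrite /rhat muhatE; case: ifPn.
move=> m_lt2; have rE : rhat f mu th rho = ((2 - m)^-1)%:E by rewrite /rhat muhatE m_lt2.
have m0 : 0 < 2 - m by rewrite subr_gt0.
pose s := (2 - m)^-1; have s0 : 0 < s by rewrite invr_gt0.
have sr : s <= r by move: rr; rewrite rE lee_fin.
have ms : (2 - m) * s = 1 by rewrite mulfV// gt_eqF.
have ms1 : (2 - m) * s <= 1 by rewrite ms.
have [] := @qhatE s; first by rewrite min_r// rE.
move=> -> ->; split.
  apply: le_lt_trans (_ : 1 < _); first by rewrite ge_min lexx.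
  by rewrite ltr_pdivlMr// mul1r; have := m1; lra.
have [k k0 Hk] := (path_rates s0 sr ms1).2 m_lt2.
pose k' := N Qh * k `^ (nu Qh / 2).
exists (Num.max k k'); first by rewrite lt_max k0.
have := distance_rates s0 k0 Hk; apply: filterS => n [h1 /andP[h2 h3] /andP[h4 h5]].
have kk a : k * ga n `^ a <= Num.max k k' * ga n `^ a.
  by rewrite ler_wpM2r ?powR_ge0// le_max lexx.
split; first exact: le_trans h1 (kk _).
  by rewrite h2 (le_trans h3 (kk _)).
by rewrite h4 (le_trans h5)// ler_wpM2r ?powR_ge0// le_max lexx orbT.
Qed.

(** In both regimes phat exceeds min(1, r): mu r > r, and mu / (2 - mu) > 1. *)
Lemma path_rates_coarse k : 0 < k -> \forall n \near \oo,
  enorm (grad f (th n)) ^+ 2 <= k * ga n `^ (- Num.min 1 r) /\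
  0 <= distC n <= k * ga n `^ (- Num.min 1 r).
Proof.
move=> k0; have [pp [k' k'0 H]] : Num.min 1 r < ph /\
    exists2 k', 0 < k' & \forall n \near \oo, rates k' k' ph qh n.
  have [rr|rr] := leP (rhat f mu th rho) r%:E; first exact: path_rates_fast_noise.
  have [pp H] := path_rates_slow_noise rr.
  by split=> //; exists 1 => //; exact: H.
have := near_powRN_le_mul ga_oo pp (divr_gt0 k0 k'0); apply: filterS2 H.
move=> n [h1 /andP[h2 h3] _] h.
have kk : k' * ga n `^ (- ph) <= k * ga n `^ (- Num.min 1 r).
  by rewrite -ler_pdivlMl// mulrA (mulrC k'^-1).
by split; [exact: le_trans h1 kk|rewrite h2 (le_trans h3 kk)].
Qed.

End single_path.


Theorem theorem3p1
  (R : realType) (dt dx : nat)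
  (disp : measure_display) (Omega : measurableType disp)
  (P : probability Omega R)
  (F : 'rV[R]_dt -> 'rV[R]_dx -> 'rV[R]_dt)
  (F_meas : measurable_fun setT (fun z : 'rV[R]_dt * 'rV[R]_dx => F z.1 z.2))
  (alpha : nat -> R) (alpha_gt0 : forall n, 0 < alpha n)
  (theta : nat -> Omega -> 'rV[R]_dt) (xi : nat -> Omega -> 'rV[R]_dx)
  (theta0_meas : measurable_fun setT (theta 0%N))
  (Pi : 'rV[R]_dt -> R.-pker 'rV[R]_dx ~> 'rV[R]_dx)
  (xi_markov : controlled_markov P theta xi Pi)
  (theta_rec : forall n w,
     theta n.+1 w = theta n w - alpha n *: F (theta n w) (xi n.+1 w))
  (alpha_cvg0 : alpha @ \oo --> 0)
  (alpha_inv :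
     (limn_esup (fun n => `|(alpha n.+1)^-1 - (alpha n)^-1|%:E) < +oo)%E)
  (alpha_sum : (\sum_(0 <= n <oo) (alpha n)%:E = +oo)%E)
  (r : R) (r_gt0 : 0 < r)
  (alpha_gamma_sum :
     (\sum_(0 <= n <oo) (alpha n ^+ 2 * series alpha n `^ (2 * r))%:E < +oo)%E)
  (f : 'rV[R]_dt -> R) (f_diff : forall t, differentiable f t)
  (grad_lip : locally_lipschitz (grad f))
  (Ft : 'rV[R]_dt -> 'rV[R]_dx -> 'rV[R]_dt)
  (Ft_meas : measurable_fun setT (fun z : 'rV[R]_dt * 'rV[R]_dx => Ft z.1 z.2))
  (Ft_int : kernel_integrable Pi Ft)
  (poisson : forall t x, F t x - grad f t = Ft t x - kernel_average Pi Ft t x)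
  (phi : set 'rV[R]_dt -> R -> 'rV[R]_dx -> R)
  (phi_meas : forall Q s, compact Q -> 0 < s < 1 ->
     measurable_fun setT (phi Q s))
  (phi_ge1 : forall Q s x, compact Q -> 0 < s < 1 -> 1 <= phi Q s x)
  (phi_bound : forall Q s t x, compact Q -> 0 < s < 1 -> Q t ->
     Num.max (Num.max (enorm (F t x)) (enorm (Ft t x)))
       (enorm (kernel_average Pi Ft t x)) <= phi Q s x)
  (phi_hoelder : forall Q s t' t'' x, compact Q -> 0 < s < 1 -> Q t' -> Q t'' ->
     enorm (kernel_average Pi Ft t' x - kernel_average Pi Ft t'' x)
       <= phi Q s x * enorm (t' - t'') `^ s)
  (phi_moment : forall Q s, compact Q -> 0 < s < 1 ->
     exists g : nat -> 'rV[R]_dt * 'rV[R]_dx -> \bar R,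
       (forall n, is_cond_expectation_at P
          (fun w => (theta 0%N w, xi 0%N w))
          (fun w => (phi Q s (xi n w) ^+ 2 *
             \1_[set w' | (n%:R%:E <= exit_time (theta^~ w') Q)%E] w)%:E)
          (g n)) /\
       (forall t x, (ereal_sup (range (fun n => g n (t, x))) < +oo)%E))
  (delta mu M : set 'rV[R]_dt -> R -> R)
  (delta_range : forall Q a, compact Q -> (f @` Q) a -> 0 < delta Q a < 1)
  (mu_range : forall Q a, compact Q -> (f @` Q) a -> 1 < mu Q a <= 2)
  (M_range : forall Q a, compact Q -> (f @` Q) a -> 1 <= M Q a)
  (lojasiewicz : forall Q a t, compact Q -> (f @` Q) a -> Q t ->
     `|f t - a| <= delta Q a ->
     `|f t - a| <= M Q a * enorm (grad f t) `^ mu Q a)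
  (nu N : set 'rV[R]_dt -> R)
  (nu_range : forall Q, compact Q -> 0 < nu Q <= 1)
  (N_range : forall Q, compact Q -> 1 <= N Q)
  (dist_crit : forall Q t, compact Q -> Q t ->
     (edist_set t (crit_points f) <= (N Q * enorm (grad f t) `^ nu Q)%:E)%E)
  (rho : Omega -> R) (rho_gt0 : forall w, 0 < rho w) :
  let p := Num.min 1 r in
  let gamma := series alpha in
  let Lambda := [set w | bounded_path (theta^~ w)] in
  let rh w := rhat f mu (theta^~ w) (rho w) in
  let ph w := phat f mu r (theta^~ w) (rho w) in
  let qh w := qhat f mu nu r (theta^~ w) (rho w) in
  let grad2 w n := enorm (grad f (theta n w)) ^+ 2 in
  let distC w n := fine (rdist_set (f (theta n w)) (crit_values f)) in
  let distS w n := fine (edist_set (theta n w) (crit_points f)) in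
  [/\ {ae P, forall w, Lambda w ->
         grad2 w =o_\oo (fun n => gamma n `^ (- p)) /\
         distC w =o_\oo (fun n => gamma n `^ (- p))},
      {ae P, forall w, Lambda w -> (r%:E < rh w)%E ->
         [/\ grad2 w =o_\oo (fun n => gamma n `^ (- ph w)),
             distC w =o_\oo (fun n => gamma n `^ (- ph w)) &
             distS w =o_\oo (fun n => gamma n `^ (- qh w))]} &
      {ae P, forall w, Lambda w -> (rh w <= r%:E)%E ->
         [/\ grad2 w =O_\oo (fun n => gamma n `^ (- ph w)),
             distC w =O_\oo (fun n => gamma n `^ (- ph w)) &
             distS w =O_\oo (fun n => gamma n `^ (- qh w))]}].
Proof.
have gcont : continuous (grad f) by exact: locally_lipschitz_continuous.
have noise := @ae_noise_cvg R dt dx disp Omega P F F_meas alpha alpha_gt0 theta xi theta0_meas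
  Pi xi_markov theta_rec alpha_cvg0 alpha_inv alpha_sum r r_gt0 alpha_gamma_sum (grad f) gcont
  Ft Ft_meas Ft_int poisson phi phi_meas phi_ge1 phi_bound phi_hoelder phi_moment.
move=> p gamma Lambda rh ph qh grad2 distC distS.
pose nz w n := F (theta n w) (xi n.+1 w) - grad f (theta n w).
have rec w n : theta n.+1 w = theta n w - alpha n *: (grad f (theta n w) + nz w n).
  by rewrite /nz [_ + (_ - _)]addrC subrK.
split; apply: filterS noise => w nw Lw.
- have H k (k0 : 0 < k) := @path_rates_coarse R dt f f_diff grad_lip alpha r alpha_gt0 r_gt0
    alpha_cvg0 alpha_sum (theta^~ w) (nz w) Lw (rec w) (nw Lw) delta mu M nu N delta_range
    mu_range M_range lojasiewicz nu_range N_range dist_crit (rho w) (rho_gt0 w) k k0.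
  split; apply/eqoP => k k0; apply: filterS (H k k0) => n [h1 /andP[h2 h3]].
    by rewrite !ger0_norm ?powR_ge0 ?sqr_ge0.
  by rewrite !ger0_norm ?powR_ge0.
- move=> rr; have [_ H] := @path_rates_slow_noise R dt f f_diff grad_lip alpha r alpha_gt0 r_gt0
    alpha_cvg0 alpha_sum (theta^~ w) (nz w) Lw (rec w) (nw Lw) delta mu M nu N delta_range
    mu_range M_range lojasiewicz nu_range N_range dist_crit (rho w) (rho_gt0 w) rr.
  split; apply/eqoP => k k0; apply: filterS (H k k0) => n [h1 /andP[h2 h3] /andP[h4 h5]];
    by rewrite !ger0_norm ?powR_ge0 ?sqr_ge0.
- move=> rr; have [_ [k k0 H]] := @path_rates_fast_noise R dt f f_diff grad_lip alpha r alpha_gt0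
    r_gt0 alpha_cvg0 alpha_sum (theta^~ w) (nz w) Lw (rec w) (nw Lw) delta mu M nu N delta_range
    mu_range M_range lojasiewicz nu_range N_range dist_crit (rho w) (rho_gt0 w) rr.
  have bigO (u v : nat -> R) : (\forall n \near \oo, 0 <= u n <= k * v n) ->
      (forall n, 0 <= v n) -> u =O_\oo v.
    move=> uv v0; apply/eqOP; exists k; split; first exact: num_real.
    move=> K kK; apply: filterS uv => n /andP[un vn].
    by rewrite !ger0_norm//; apply: le_trans vn _; rewrite ler_wpM2r// ltW.
  split; apply: bigO => [|n]; rewrite ?powR_ge0//; apply: filterS H => n [h1 h2 h3] //.
  by rewrite sqr_ge0.
Qed.
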